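(* For $t\ge0$ and $\phi\in\mathbb{R}^d$, in the sense of asymptotic series, $\log\Phi_t(\phi)$ has the expansion in terms of connected Feynman graphs $$\log\Phi_t(\phi)=\sum_{m=1}^{\infty}\frac{(-1)^m}{m!}\sum_{G\in\bar F_c(m)}\mathcal{V}[G](t,\phi),$$ i.e. for every $N\in\mathbb{N}$ $$\lim_{\beta\searrow 0}\beta^{-N}\Big|\log\Phi^\beta_t(\phi)-\sum_{m=1}^{N}\frac{(-\beta)^m}{m!}\sum_{G\in\bar F_c(m)}\mathcal{V}[G](t,\phi)\Big|=0 .$$ Here $\Phi_t$ is the solution of $\frac{\partial}{\partial t}\Phi_t=\Psi(\nabla)\Phi_t$, $\Phi_0=e^{-V}$.
   Context: Fourier transform: $\mathcal{F}(g)(\xi)=\int_{\mathbb{R}^d}g(\varphi)e^{i\langle\xi,\varphi\rangle}d\varphi$, extended to tempered distributions $\mathcal{S}'(\mathbb{R}^d)$. Symbol: $\xi\mapsto\Psi(-i\xi)$ is a smooth function $\mathbb{R}^d\to\mathbb{C}$ with $\Psi(0)=0$ such that (P1) it is analytic in a neighbourhood of $0$; (P2) $\Re\Psi(-i\xi)\le c\log(1+\|\xi\|)$ for all $\xi\in\mathbb{R}^d$, for some $c>0$; (P3) for every $\alpha\in\mathbb{N}_0^d$ there are $N_\alpha\in\mathbb{N}$, $b_\alpha>0$ with $|D_\alpha\Psi(-i\xi)|\le b_\alpha(1+\|\xi\|)^{N_\alpha}$ for all $\xi\in\mathbb{R}^d$, $D_\alpha$ being the partial derivative of multi-index $\alpha$.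 The operator $\Psi(\nabla)$ is $\mathcal{F}^{-1}\circ(\text{multiplication by }\Psi(-i\xi))\circ\mathcal{F}$. Put $C^{(n)}_{X_1\cdots X_n}=\frac{\partial^n}{\partial\xi_{X_1}\cdots\partial\xi_{X_n}}\Psi(\xi)|_{\xi=0}$ for $n\ge1$, $X_i\in\{1,\dots,d\}$. Initial condition: $V(\varphi)=\sum_{p=0}^{\bar p}\sum_{X_1,\dots,X_p=1}^d\lambda^{(p)}_{X_1\cdots X_p}\varphi_{X_1}\cdots\varphi_{X_p}$ with real symmetric tensors $\lambda^{(p)}$, $\bar p$ a positive even integer, and $\sum_{X_1,\dots,X_{\bar p}}\lambda^{(\bar p)}_{X_1\cdots X_{\bar p}}\varphi_{X_1}\cdots\varphi_{X_{\bar p}}>0$ for $\varphi\ne0$; $f=e^{-V}$ and $f_\beta=e^{-\beta V}$ for $\beta>0$. Let $\nu_t=\mathcal{F}^{-1}(e^{t\Psi(-i\xi)})\in\mathcal{S}'(\mathbb{R}^d)$. The solution of the Cauchy problem is the convolution $\Phi_t(\phi)=\nu_t*f(\phi)=\langle\nu_t,f_\phi\rangle$, where $f_\phi(\varphi)=f(\varphi-\phi)$; likewise $\Phi_t^\beta=\nu_t*f_\beta$. One has $\Phi_t^\beta(\phi)\to1$ as $\beta\searrow0$, and $\log$ is the principal branch for small $\beta$. Generalized amputated Feynman graphs: let $m\in\mathbb{N}_0$, $p_1,\dots,p_m\in\{0,\dots,\bar p\}$ and $\Omega(p_1,\dots,p_m)=\bigcup_{n=1}^m\{(1,n),\dots,(p_n,n)\}$.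 A graph $G$ has $m$ distinguishable ''inner full'' vertices, the $n$-th one having $p_n$ distinguishable legs labelled $(1,n),\dots,(p_n,n)$; finitely many ''inner empty'' vertices and finitely many ''outer empty'' vertices, which are indistinguishable within each type and have indistinguishable legs; each leg of an inner full vertex is joined by a non-directed edge to exactly one empty vertex and these are all the edges; every inner empty vertex is met by at least one edge and every outer empty vertex by exactly one edge. $\bar F(m)$ is the set of all such graphs with $m$ inner full vertices and arbitrary $p_1,\dots,p_m\le\bar p$ such that $\lambda^{(p_j)}\ne0$ for $j=1,\dots,m$. $\bar F_c(m)\subseteq\bar F(m)$ is the set of connected graphs, i.e. those in which any two vertices (full or empty) are joined by a walk passing through finitely many edges. Feynman rules: for $G\in\bar F(m)$ the number $\mathcal{V}[G](t,\phi)$ is obtained as follows: assign to each leg $a=(s,n)\in\Omega(p_1,\dots,p_m)$ an index $X_a=X^n_s\in\{1,\dots,d\}$; for each outer empty vertex multiply by $(-\phi_{X_b})$, $b$ the leg joined to it; for each inner empty vertex joined to legs $a_1,\dots,a_l$ multiply by $t\,C^{(l)}_{X_{a_1}\cdots X_{a_l}}$; for each $j=1,\dots,m$ multiply by $\lambda^{(p_j)}_{X^j_1\cdots X^j_{p_j}}$; finally sum over all indices $X_a\in\{1,\dots,d\}$, $a\in\Omega(p_1,\dots,p_m)$.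
   Formalization: Signs corrected: Φ_t(φ) is the true convolution ⟨ν_t, f(φ−·)⟩ instead of ⟨ν_t, f(·−φ)⟩, and each outer empty vertex contributes +φ instead of −φ; the printed signs fail, e.g. for d=1, Ψ(z)=z, V=x², and contradict Φ_0=e^{−V}. *)

(* Defs.v *)
From HB Require Import structures.
From mathcomp Require Import all_boot all_order all_algebra.
From mathcomp Require Import all_classical all_reals all_analysis.
From mathcomp Require Import complex.
Set Implicit Arguments.
Unset Strict Implicit.
Unset Printing Implicit Defensive.
Import Order.TTheory GRing.Theory Num.Theory.
Import numFieldNormedType.Exports.
Local Open Scope classical_set_scope.
Local Open Scope ring_scope.
Local Open Scope complex_scope.

Section complex_functions.
Context {R : realType}.
Implicit Types z : R[i].

Definition cabs z : R := complex.Re `|z|.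

Definition cexp z : R[i] := (expR (complex.Re z))%:C * (cos (complex.Im z) +i* sin (complex.Im z)).

(* Principal branch, argument in ]-pi, pi]. *)
Definition cln z : R[i] :=
  let a := acos (complex.Re z / cabs z) in
  ln (cabs z) +i* (if 0 <= complex.Im z then a else - a).

End complex_functions.

(* Lebesgue measure on R^n, as an n-fold product measure on n-tuples. *)
Section lebesgue_measure_n.
Context {R : realType}.
Local Notation T n := (n.-tuple (measurableTypeR R)).

Definition tcons n (x : measurableTypeR R * T n) : T n.+1 :=
  [the T n.+1 of x.1 :: x.2].

Lemma measurable_tcons n : measurable_fun setT (@tcons n).
Proof. exact: measurable_cons. Qed.

Section cons_measure.
Variables (n : nat) (mu : {sigma_finite_measure set (T n) -> \bar R}).

Definition cons_measure : set (T n.+1) -> \bar R :=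
  pushforward (lebesgue_measure \x mu)%E (@tcons n).

Let cons_measureM : {measure set (T n.+1) -> \bar R}.
Proof.
pose mt := @measurable_tcons n.
exact: (pushforward (lebesgue_measure \x mu)%E (@tcons n)).
Defined.

HB.instance Definition _ := isMeasure.Build _ _ _ cons_measure
  (measure0 cons_measureM) (@measure_ge0 _ _ _ cons_measureM)
  (@measure_semi_sigma_additive _ _ _ cons_measureM).

Lemma cons_measure_sigma_finite : sigma_finite setT cons_measure.
Proof.
have /sigma_finiteP[F [TF ndF Foo]] := sigma_finiteT (@lebesgue_measure R).
have /sigma_finiteP[G [TG ndG Goo]] := sigma_finiteT mu.
exists (fun k => [set x | F k (thead x) /\ G k [tuple of behead x]]).
  rewrite predeqE => x; split=> // _.
  have [i _ Fi] : (\bigcup_k F k) (thead x) by rewrite -TF.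
  have [j _ Gj] : (\bigcup_k G k) [tuple of behead x] by rewrite -TG.
  exists (maxn i j) => //; split.
  - by move: Fi; exact/subsetPset/ndF/leq_maxl.
  - by move: Gj; exact/subsetPset/ndG/leq_maxr.
move=> k; have [mF oF] := Foo k; have [mG oG] := Goo k; split.
  apply: measurableI; rewrite -[X in measurable X]setTI.
    exact: (measurable_tnth ord0).
  exact: (measurable_behead measurableT).
rewrite /cons_measure /pushforward (_ : _ @^-1` _ = F k `*` G k).
  by rewrite product_measure1E// lte_mul_pinfty// ge0_fin_numE.
have bK z : [tuple of behead (tcons z)] = z.2 :> T n by exact/val_inj.
by apply/seteqP; split=> -[x y]; rewrite /= bK.
Qed.

HB.instance Definition _ :=
  Measure_isSigmaFinite.Build _ _ _ cons_measure cons_measure_sigma_finite.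

End cons_measure.

Fixpoint lebesgue_measure_n n : {sigma_finite_measure set (T n) -> \bar R} :=
  if n is n'.+1 then cons_measure (lebesgue_measure_n n')
  else \d_([tuple] : T 0).

End lebesgue_measure_n.

Section symbols.
Context {R : realType} {d : nat}.
Local Notation C := R[i].
Local Notation Rd := 'rV[R]_d.
Local Notation Cd := 'rV[R[i]]_d.
Implicit Types (f g u : Rd -> C) (F Psi : Cd -> C) (x xi : Rd).

Definition dot x xi : R := \sum_(j < d) x 0 j * xi 0 j.

(* The library norm on row vectors is the maximum norm. *)
Definition enorm x : R := Num.sqrt (dot x x).

Definition pderiv (j : 'I_d) f : Rd -> C := fun x =>
  'D_(delta_mx 0 j) (fun y => complex.Re (f y) : R^o) x +i*
  'D_(delta_mx 0 j) (fun y => complex.Im (f y) : R^o) x.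

Definition pderivs (s : seq 'I_d) f : Rd -> C := foldr pderiv f s.

Definition multi_deriv (al : {ffun 'I_d -> nat}) f : Rd -> C :=
  pderivs (flatten [seq nseq (al j) j | j <- enum 'I_d]) f.

Definition smooth f := forall s : seq 'I_d,
  [/\ continuous (fun x => complex.Re (pderivs s f x) : R^o),
      continuous (fun x => complex.Im (pderivs s f x) : R^o) &
      forall (j : 'I_d) x,
        derivable (fun y => complex.Re (pderivs s f y) : R^o) x (delta_mx 0 j) /\
        derivable (fun y => complex.Im (pderivs s f y) : R^o) x (delta_mx 0 j)].

(* F is the sum of an absolutely convergent power series in a polydisc
   around a. *)
Definition analytic_at F (a : Cd) :=
  exists (c : {ffun 'I_d -> nat} -> C) (r : R),
  [/\ 0 < r,
      (\esum_(al in [set: {ffun 'I_d -> nat}])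
         (cabs (c al) * r ^+ (\sum_(j < d) al j))%:E < +oo)%E &
      forall z : Cd, (forall j, cabs (z 0 j - a 0 j) < r) ->
        (fun n : nat => cabs
           (\sum_(al : {ffun 'I_d -> 'I_n})
              c [ffun j => nat_of_ord (al j)] *
              \prod_(j < d) (z 0 j - a 0 j) ^+ al j - F z))
          @ \oo --> (0 : R)].

Definition of_real x : Cd := map_mx (real_complex R) x.

Definition symbol Psi : Rd -> C := fun xi => Psi ((- 'i%C) *: of_real xi).

Definition Ccoef Psi (s : seq 'I_d) : C :=
  pderivs s (fun xi => Psi (of_real xi)) 0.

Definition cintegral g : C :=
  (\int[lebesgue_measure_n d]_x complex.Re (g (\row_j tnth x j))) +i*
  (\int[lebesgue_measure_n d]_x complex.Im (g (\row_j tnth x j))).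

(* Inverse of the transform with kernel e^(i <xi, x>) and no prefactor. *)
Definition fourier_inv g : Rd -> C := fun x =>
  ((2 * pi) ^- d)%:C * cintegral (fun xi => g xi * cexp (0 -i* dot xi x)).

(* Tempered distributions are represented by their action on test functions;
   only their values on Schwartz functions are meaningful. *)
Definition distribution := (Rd -> C) -> C.

Definition distribution_of u : distribution :=
  fun g => cintegral (fun xi => u xi * g xi).

Definition distribution_fourier_inv (T : distribution) : distribution :=
  fun g => T (fourier_inv g).

Definition nu Psi (t : R) : distribution :=
  distribution_fourier_inv
    (distribution_of (fun xi => cexp (t%:C * symbol Psi xi))).

(* The convolution nu_t * f: the sign of the argument of f is the one for which
   Phi_0 = f and d/dt Phi_t = Psi(nabla) Phi_t, where Psi(nabla) multiplies the
   transform with kernel e^(i <xi, x>) by Psi(-i xi). *)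
Definition Phi Psi (t : R) f : Rd -> C := fun phi =>
  nu Psi t (fun x => f (phi - x)).

End symbols.

Section potential.
Context {R : realType} {d : nat}.
Variables (pbar : nat) (lam : forall p : nat, p.-tuple 'I_d -> R).
Arguments lam : clear implicits.

Definition tensor_form p (x : 'rV[R]_d) : R :=
  \sum_(X : p.-tuple 'I_d) lam p X * \prod_(i < p) x 0 (tnth X i).

Definition potential (x : 'rV[R]_d) : R := \sum_(p < pbar.+1) tensor_form p x.

Definition boltzmann (beta : R) (x : 'rV[R]_d) : R[i] :=
  (expR (- (beta * potential x)))%:C.

End potential.

(* A leg (s, n) is an element of {n : 'I_m & 'I_(p n)}.  Since the empty
   vertices and their legs are indistinguishable, a graph is determined by the
   sets of legs met by its inner empty vertices and by the legs joined to its
   outer empty vertices. *)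
Section graphs.
Variables (pbar m : nat) (p : {ffun 'I_m -> 'I_pbar.+1}).

Definition leg : finType := {n : 'I_m & 'I_(p n)}.
Definition graph : finType := ({set {set leg}} * {set leg})%type.
Implicit Types G : graph.

Definition inner G : {set {set leg}} := G.1.
Definition outer G : {set leg} := G.2.

Definition is_graph G := finset.partition (inner G) (~: outer G).

Definition vertex : finType := ('I_m + {set leg} + leg)%type.

Definition is_vertex G (v : vertex) : bool :=
  match v with
  | inl (inl _) => true
  | inl (inr B) => B \in inner G
  | inr a => a \in outer G
  end.

(* The edge at leg a is incident to v. *)
Definition incident (a : leg) (v : vertex) : bool :=
  match v with
  | inl (inl n) => tag a == n
  | inl (inr B) => a \in B
  | inr b => a == b
  end.

Definition adjacent G : rel vertex := fun u v =>
  [&& is_vertex G u, is_vertex G v & [exists a, incident a u && incident a v]].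

Definition connected_graph G :=
  [forall u, forall v, is_vertex G u ==> is_vertex G v ==>
    connect (adjacent G) u v].

End graphs.

Section feynman.
Context {R : realType} {d : nat}.
Variables (Psi : 'rV[R[i]]_d -> R[i]) (pbar : nat).
Variable lam : forall p : nat, p.-tuple 'I_d -> R.
Arguments lam : clear implicits.
Variables (t : R) (phi : 'rV[R]_d).

(* An outer empty vertex contributes +phi, in accordance with the sign
   convention in Phi: at t = 0 only the outer empty vertices contribute, and
   log Phi_0 (phi) = - V (phi). *)
Definition feynman_value m (p : {ffun 'I_m -> 'I_pbar.+1}) (G : graph p)
    : R[i] :=
  \sum_(X : {ffun leg p -> 'I_d})
    (\prod_(b in outer G) (phi 0 (X b))%:C) *
    (\prod_(B in inner G) (t%:C * Ccoef Psi [seq X a | a <- enum B])) *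
    (\prod_(j < m)
       (lam (p j) [tuple X (Tagged (fun n => 'I_(p n)) s) | s < p j])%:C).

Definition connected_sum m : R[i] :=
  \sum_(p : {ffun 'I_m -> 'I_pbar.+1} |
        [forall j, [exists X, lam (p j) X != 0]])
    \sum_(G : graph p | is_graph G && connected_graph G) feynman_value G.

End feynman.

(* Main.v *)
Require Import Defs.
From HB Require Import structures.
From mathcomp Require Import all_boot all_order all_algebra.
From mathcomp Require Import all_classical all_reals all_analysis.
From mathcomp Require Import measurable_realfun complex ring lra zify.
Set Implicit Arguments.
Unset Strict Implicit.
Unset Printing Implicit Defensive.
Import Order.TTheory GRing.Theory Num.Theory.
Import numFieldNormedType.Exports.
Local Open Scope classical_set_scope.
Local Open Scope ring_scope.
Local Open Scope complex_scope.

(** The proof has an analytic part, which expands [Phi] in powers of beta, and a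
    combinatorial part, which takes the logarithm of the expansion.

    By definition Phi^beta(phi) pairs the multiplier exp (t Psi (- i xi)) with the
    inverse transform of x |-> exp (- beta V(phi - x)). Write beta = eps ^ pbar.
    As V grows like |x| ^ pbar, each derivative of this function brings out a
    factor eps, uniformly ([boltzmann_tower]); so its transform lives at frequencies of
    order eps. The multiplier agrees to order K at the origin with a polynomial, by
    analyticity of Psi at 0, and grows at most polynomially
    ([multiplier_expansion]). Replacing it by the polynomial therefore costs
    O(eps ^ (K - 2 d)) ([multiplier_estimate]). A polynomial multiplier acts, by
    Fourier inversion, as a differential operator L with constant coefficients, and
    expanding the exponential under L gives
      Phi^beta(phi) = sum_(m <= N) (- beta) ^ m / m! z_m + O(beta ^ (N + 1)),
    where z_m = L(V ^ m)(phi) ([Phi_expansion]). Fourier inversion itself is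
    obtained from the regularizing weights exp (- d |x|), whose transforms, the
    Poisson kernels, have elementary primitives ([fourier_inversion]).

    The operator L is a truncation of exp (t Psi), where the truncation is beyond
    the degree of V ^ N. Applied to a product of coordinates, one for each leg, a
    derivative of order l contracts l legs into an inner empty vertex of weight
    t C^(l), the 1 / k! of the exponential forgets the order of the k contractions,
    and the legs that are left take the value phi: L of a monomial is the sum over
    all graphs with these legs ([op_at_multiplier]). Cutting a graph along the
    connected component of its first full vertex ([cluster_expansion]) and summing
    over labels shows that the sums k_m over connected graphs satisfy
      z_(s + 1) = sum_(i <= s) binom(s, i) k_(i + 1) z_(s - i)
    ([connected_sum_recursion]). This is the equation Z' = K' Z for exponential
    generating series, so that Z = exp K up to order N ([coef_epoly]). The principal
    logarithm is Lipschitz near 1, and log Phi^beta(phi) = K(- beta) up to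
    O(beta ^ (N + 1)) ([cln_cumulant_sum]). *)

(** * Complex exponential and principal logarithm *)

Lemma is_derive_bigsum (R : realType) (V : normedModType R) (I : Type)
    (r : seq I) (P : pred I) (F : I -> V -> R) (F' : I -> R) (x v : V) :
  (forall i, P i -> is_derive x v (F i : V -> R^o) (F' i)) ->
  is_derive x v ((fun y => \sum_(i <- r | P i) F i y) : V -> R^o)
    (\sum_(i <- r | P i) F' i).
Proof.
move=> dF; elim: r => [|i r IH].
  rewrite big_nil; under eq_fun do rewrite big_nil; exact: is_derive_cst.
rewrite big_cons; under eq_fun do rewrite big_cons.
case: ifPn => // Pi.
exact: (@is_deriveD _ _ _ (F i : V -> R^o) _ x v _ _ (dF i Pi) IH).
Qed.

Lemma is_derive_mul (R : realType) (V : normedModType R) (f g : V -> R)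
    (x v : V) (df dg : R) :
  is_derive x v (f : V -> R^o) df -> is_derive x v (g : V -> R^o) dg ->
  is_derive x v ((fun y => f y * g y) : V -> R^o) (df * g x + f x * dg).
Proof.
move=> hf hg; have H := is_deriveM hf hg; apply: is_derive_eq.
by rewrite /GRing.scale /= addrC [g x * _]mulrC.
Qed.

Lemma is_derive_add (R : realType) (V : normedModType R) (f g : V -> R)
    (x v : V) (df dg : R) :
  is_derive x v (f : V -> R^o) df -> is_derive x v (g : V -> R^o) dg ->
  is_derive x v ((fun y => f y + g y) : V -> R^o) (df + dg).
Proof. by move=> hf hg; exact: (is_deriveD hf hg). Qed.

Lemma is_derive_pow (R : realType) (V : normedModType R) (f : V -> R) n
    (x v : V) (df : R) :
  is_derive x v (f : V -> R^o) df ->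
  is_derive x v ((fun y => f y ^+ n) : V -> R^o) (n%:R * f x ^+ n.-1 * df).
Proof.
move=> hf; have := is_deriveX n hf.
rewrite (_ : (f : V -> R^o) ^+ n = (fun y => f y ^+ n)) //.
by apply/funext => y; rewrite exprfctE.
Qed.

Section complex_numbers.
Context {R : realType}.
Implicit Types (z w : R[i]) (r s : R).

Lemma cabsE z : cabs z = Num.sqrt (complex.Re z ^+ 2 + complex.Im z ^+ 2).
Proof. by rewrite /cabs normc_def. Qed.

Lemma normr_cabs z : `|z| = (cabs z)%:C.
Proof. by rewrite /cabs normc_def. Qed.

Lemma cabs_ge0 z : 0 <= cabs z.
Proof. by rewrite cabsE sqrtr_ge0. Qed.

Lemma cabs0 : cabs (0 : R[i]) = 0.
Proof. by rewrite /cabs normr0. Qed.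

Lemma cabsM z w : cabs (z * w) = cabs z * cabs w.
Proof. by apply/complexI; rewrite -normr_cabs normrM !normr_cabs rmorphM. Qed.

Lemma cabs1 : cabs (1 : R[i]) = 1.
Proof. by rewrite /cabs normr1. Qed.

Lemma cabsX z n : cabs (z ^+ n) = cabs z ^+ n.
Proof. by elim: n => [|n IH]; rewrite ?expr0 ?cabs1 // !exprS cabsM IH. Qed.

Lemma cabsD z w : cabs (z + w) <= cabs z + cabs w.
Proof. by rewrite -lecR rmorphD /= -!normr_cabs ler_normD. Qed.

Lemma cabsN z : cabs (- z) = cabs z.
Proof. by rewrite /cabs normrN. Qed.

Lemma cabsB z w : cabs (z - w) <= cabs z + cabs w.
Proof. by rewrite -(cabsN w) cabsD. Qed.

Lemma cabs_distC z w : cabs (z - w) = cabs (w - z).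
Proof. by rewrite -cabsN opprB. Qed.

Lemma cabs_real r : cabs r%:C = `|r|.
Proof. by rewrite cabsE /= expr0n addr0 sqrtr_sqr. Qed.

Lemma cabs_eq0 z : (cabs z == 0) = (z == 0).
Proof.
apply/eqP/eqP => [z0|->]; last exact: cabs0.
by apply/eqP; rewrite -normr_eq0 normr_cabs z0.
Qed.

Lemma cabs_sum (I : Type) (r : seq I) (P : pred I) (F : I -> R[i]) :
  cabs (\sum_(i <- r | P i) F i) <= \sum_(i <- r | P i) cabs (F i).
Proof.
elim/big_rec2: _ => [|i y x _ xy]; first by rewrite cabs0.
by rewrite (le_trans (cabsD _ _))// lerD2l.
Qed.

Lemma cabs_prod (I : Type) (r : seq I) (P : pred I) (F : I -> R[i]) :
  cabs (\prod_(i <- r | P i) F i) = \prod_(i <- r | P i) cabs (F i).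
Proof. by elim/big_rec2: _ => [|i y x _ <-]; rewrite ?cabs1 // cabsM. Qed.

Lemma normr_Re_le z : `|complex.Re z| <= cabs z.
Proof. by rewrite cabsE -sqrtr_sqr ler_wsqrtr// lerDl sqr_ge0. Qed.

Lemma normr_Im_le z : `|complex.Im z| <= cabs z.
Proof. by rewrite cabsE -sqrtr_sqr ler_wsqrtr// lerDr sqr_ge0. Qed.

Lemma cabs_le_ReIm z : cabs z <= `|complex.Re z| + `|complex.Im z|.
Proof.
rewrite cabsE -[leRHS]ger0_norm ?addr_ge0// -sqrtr_sqr ler_wsqrtr//.
by rewrite sqrrD !real_normK ?num_real// -addrA lerD2l lerDr mulrn_wge0 ?mulr_ge0.
Qed.

Lemma cReD z w : complex.Re (z + w) = complex.Re z + complex.Re w.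
Proof. by case: z w => [? ?] [? ?]. Qed.
Lemma cImD z w : complex.Im (z + w) = complex.Im z + complex.Im w.
Proof. by case: z w => [? ?] [? ?]. Qed.
Lemma cReN z : complex.Re (- z) = - complex.Re z. Proof. by case: z. Qed.
Lemma cImN z : complex.Im (- z) = - complex.Im z. Proof. by case: z. Qed.
Lemma cReM z w : complex.Re (z * w) =
  complex.Re z * complex.Re w - complex.Im z * complex.Im w.
Proof. by case: z w => [? ?] [? ?]. Qed.
Lemma cImM z w : complex.Im (z * w) =
  complex.Re z * complex.Im w + complex.Im z * complex.Re w.
Proof. by case: z w => [? ?] [? ?]. Qed.

Lemma Re_sum (I : Type) (r : seq I) (P : pred I) (F : I -> R[i]) :
  complex.Re (\sum_(i <- r | P i) F i) = \sum_(i <- r | P i) complex.Re (F i).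
Proof. by elim/big_rec2: _ => [|i y x _ <-]; rewrite ?cReD. Qed.

Lemma eq_ReIm z w : complex.Re z = complex.Re w ->
  complex.Im z = complex.Im w -> z = w.
Proof. by case: z w => [? ?] [? ?] /= -> ->. Qed.

Lemma cexp0 : cexp (0 : R[i]) = 1.
Proof. by rewrite /cexp /= expR0 cos0 sin0 mul1r. Qed.

Lemma Re_cexp z :
  complex.Re (cexp z) = expR (complex.Re z) * cos (complex.Im z).
Proof. by rewrite /cexp cReM /= mul0r subr0. Qed.

Lemma Im_cexp z :
  complex.Im (cexp z) = expR (complex.Re z) * sin (complex.Im z).
Proof. by rewrite /cexp cImM /= mul0r addr0. Qed.

Lemma cexpD z w : cexp (z + w) = cexp z * cexp w.
Proof.
apply: eq_ReIm.
  by rewrite [RHS]cReM !Re_cexp !Im_cexp cReD cImD expRD cosD; ring.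
by rewrite [RHS]cImM !Re_cexp !Im_cexp cReD cImD expRD sinD; ring.
Qed.

Lemma cabs_cexp z : cabs (cexp z) = expR (complex.Re z).
Proof.
rewrite cabsE Re_cexp Im_cexp !exprMn -mulrDr cos2Dsin2 mulr1 sqrtr_sqr.
by rewrite ger0_norm// expR_ge0.
Qed.

Lemma cexpN z : cexp z * cexp (- z) = 1.
Proof. by rewrite -cexpD subrr cexp0. Qed.

(** The mean value theorem holds for the real and the imaginary part
    separately: hence the factor 2. *)
Lemma complex_mean_value (f g : R -> R[i]) (M : R) :
  (forall s, is_derive s (1:R) (fun s => complex.Re (f s) : R^o) (complex.Re (g s))) ->
  (forall s, is_derive s (1:R) (fun s => complex.Im (f s) : R^o) (complex.Im (g s))) ->
  (forall s, 0 <= s <= 1 -> cabs (g s) <= M) ->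
  f 0 = 0 ->
  forall s, 0 <= s <= 1 -> cabs (f s) <= 2 * M.
Proof.
move=> df1 df2 gM f0 s /andP[s0 s1].
have M0 : 0 <= M by apply: le_trans (gM 0 _); rewrite ?cabs_ge0// lexx ler01.
have key (h h' : R -> R) : (forall s, is_derive s (1:R) (h : R -> R^o) (h' s)) ->
    (forall s, 0 <= s <= 1 -> `|h' s| <= M) -> h 0 = 0 -> `|h s| <= M.
  move=> dh hM h0.
  have hc : {within `[0, s], continuous h}.
    by apply: derivable_within_continuous => x _; case: (dh x).
  have [c] := @MVT_segment R h h' 0 s s0 (fun x _ => dh x) hc.
  rewrite in_itv /= h0 !subr0 => /andP[c0 cs] ->.
  rewrite normrM -[leRHS]mulr1 ler_pM// ?hM//.
    by rewrite c0 (le_trans cs).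
  by rewrite ger0_norm.
rewrite (le_trans (cabs_le_ReIm _))// mulrDl mul1r lerD//.
  apply: (key _ (fun s => complex.Re (g s))) => //; last by rewrite f0.
  by move=> x x01; rewrite (le_trans (normr_Re_le _))// gM.
apply: (key _ (fun s => complex.Im (g s))) => //; last by rewrite f0.
by move=> x x01; rewrite (le_trans (normr_Im_le _))// gM.
Qed.

Definition exp_trunc (k : nat) z : R[i] := \sum_(i < k) (i`!%:R)^-1 * z ^+ i.

Lemma complex_natV n : (n%:R^-1 : R[i]) = ((n%:R : R)^-1)%:C.
Proof. by rewrite fmorphV rmorph_nat. Qed.

Lemma exp_trunc_real k z s : exp_trunc k (s%:C * z) =
  \sum_(i < k) (s ^+ i / i`!%:R)%:C * z ^+ i.
Proof.
apply: eq_bigr => i _; rewrite exprMn complex_natV.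
by rewrite -rmorphXn mulrA -rmorphM /= [_ * s ^+ i]mulrC.
Qed.

Lemma is_derive_exp_trunc k z s (p : R[i] -> R) :
  (forall r w, p (r%:C * w) = r * p w) -> (forall a b, p (a + b) = p a + p b) ->
  is_derive s (1:R) (fun s => p (exp_trunc k (s%:C * z)) : R^o)
    (p (z * exp_trunc k.-1 (s%:C * z))).
Proof.
move=> pZ pD; have p0 : p 0 = 0 by rewrite -(mul0r 0) -[X in X * _]/(0%:C) pZ mul0r.
have psum n (F : 'I_n -> R[i]) : p (\sum_i F i) = \sum_i p (F i).
  by apply: (big_morph p pD p0).
have -> : p (z * exp_trunc k.-1 (s%:C * z)) =
   \sum_(i < k) i%:R * s ^+ i.-1 * (p (z ^+ i) / i`!%:R).
  rewrite exp_trunc_real mulr_sumr psum; case: k => [|k]; first by rewrite !big_ord0.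
  rewrite [RHS]big_ord_recl /= !mul0r add0r; apply: eq_bigr => i _.
  rewrite mulrCA -exprS pZ factS natrM /= invfM -mulrA.
  rewrite /bump add1n /=.
  have n0 : (i.+1%:R : R) != 0 by rewrite pnatr_eq0.
  have n1 : (i`!%:R : R) != 0 by rewrite pnatr_eq0 -lt0n fact_gt0.
  by field; rewrite n1 nat1r n0.
under eq_fun do rewrite exp_trunc_real psum.
apply: is_derive_bigsum => i _.
under eq_fun do rewrite pZ.
apply: (is_derive_eq (is_derive_mul (is_derive_mul
  (is_derive_pow i (is_derive_id s 1)) (is_derive_cst _ s 1)) (is_derive_cst _ s 1))).
by rewrite !mulr0 !addr0 mulr1 -mulrA [_^-1 * _]mulrC.
Qed.

Lemma cexp_real_line z s (p : R[i] -> R) :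
  p = @complex.Re R \/ p = @complex.Im R ->
  is_derive s (1:R) (fun s => p (cexp (s%:C * z)) : R^o) (p (z * cexp (s%:C * z))).
Proof.
have ds (a : R) : is_derive s (1:R) (fun s => s * a : R^o) a.
  apply: (is_derive_eq (is_derive_mul (is_derive_id s 1) (is_derive_cst _ s 1))).
  by rewrite mulr0 addr0 mul1r.
have dE (a : R) : is_derive s (1:R) (fun s => expR (s * a) : R^o) (expR (s * a) * a).
  by have := is_derive1_comp (f := expR) (is_derive_expR _) (ds a).
have dC (a : R) : is_derive s (1:R) (fun s => cos (s * a) : R^o) (- sin (s * a) * a).
  by have := is_derive1_comp (f := cos) (is_derive_cos _) (ds a).
have dS (a : R) : is_derive s (1:R) (fun s => sin (s * a) : R^o) (cos (s * a) * a).
  by have := is_derive1_comp (f := sin) (is_derive_sin _) (ds a).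
have eR w u : complex.Re (u%:C * w) = u * complex.Re w by rewrite cReM /= mul0r subr0.
have eI w u : complex.Im (u%:C * w) = u * complex.Im w by rewrite cImM /= mul0r addr0.
case=> ->; under eq_fun do rewrite ?Re_cexp ?Im_cexp eR eI.
  apply: (is_derive_eq (is_derive_mul (dE _) (dC _))).
  by rewrite [RHS]cReM Re_cexp Im_cexp eR eI; ring.
apply: (is_derive_eq (is_derive_mul (dE _) (dS _))).
by rewrite [RHS]cImM Re_cexp Im_cexp eR eI; ring.
Qed.

(** Induction on k: along the segment from 0 to z the remainder of order k + 1
    has z times the remainder of order k as its derivative. The factor 2 ^ k is
    that of the mean value inequality. *)
Lemma cexp_taylor k z :
  cabs (cexp z - exp_trunc k z) <= (2 * cabs z) ^+ k * expR (cabs z).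
Proof.
suff H s : 0 <= s <= 1 -> cabs (cexp (s%:C * z) - exp_trunc k (s%:C * z)) <=
    (2 * cabs z) ^+ k * expR (cabs z).
  by have := H 1; rewrite mul1r; apply; rewrite ler01 lexx.
elim: k s => [|k IH] s s01.
  rewrite expr0 mul1r /exp_trunc big_ord0 subr0 cabs_cexp ler_expR.
  rewrite cReM /= mul0r subr0; case/andP: s01 => s0 s1.
  rewrite (le_trans (ler_norm _))// normrM (ger0_norm s0) -[leRHS]mul1r ler_pM//.
  exact: normr_Re_le.
rewrite exprS -!mulrA.
pose f s := cexp (s%:C * z) - exp_trunc k.+1 (s%:C * z).
pose g s := z * (cexp (s%:C * z) - exp_trunc k (s%:C * z)).
apply: (@complex_mean_value f g) => // [x|x|x x01|].
- rewrite /f /g mulrBr; under eq_fun do rewrite cReD cReN; rewrite cReD cReN.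
  apply: (@is_deriveB _ _ _ (fun s => complex.Re (cexp (s%:C * z)) : R^o)
    (fun s => complex.Re (exp_trunc k.+1 (s%:C * z)) : R^o)).
    by apply: cexp_real_line; left.
  apply: (@is_derive_exp_trunc k.+1 z x (@complex.Re R)) => [r w|a b].
    by rewrite cReM /= mul0r subr0.
  exact: cReD.
- rewrite /f /g mulrBr; under eq_fun do rewrite cImD cImN; rewrite cImD cImN.
  apply: (@is_deriveB _ _ _ (fun s => complex.Im (cexp (s%:C * z)) : R^o)
    (fun s => complex.Im (exp_trunc k.+1 (s%:C * z)) : R^o)).
    by apply: cexp_real_line; right.
  apply: (@is_derive_exp_trunc k.+1 z x (@complex.Im R)) => [r w|a b].
    by rewrite cImM /= mul0r addr0.
  exact: cImD.
- rewrite /g cabsM ler_wpM2l ?cabs_ge0//; exact: IH.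
- rewrite /f mul0r cexp0 /exp_trunc big_ord_recl expr0 fact0 invr1 mulr1.
  rewrite big1 ?addr0 ?subrr// => i _.
  by rewrite expr0n /= mulr0.
Qed.

Lemma cexp_lipschitz z w :
  cabs (cexp z - cexp w) <= expR (cabs w) * (2 * cabs (z - w) * expR (cabs (z - w))).
Proof.
have -> : cexp z - cexp w = cexp w * (cexp (z - w) - 1).
  by rewrite mulrBr mulr1 -cexpD addrCA subrr addr0.
rewrite cabsM ler_pM ?cabs_ge0//.
  by rewrite cabs_cexp ler_expR (le_trans (ler_norm _))// normr_Re_le.
have := cexp_taylor 1 (z - w).
by rewrite /exp_trunc big_ord1 expr0 fact0 invr1 mulr1 expr1.
Qed.

Lemma cln_cexp w : - pi < complex.Im w < pi -> cln (cexp w) = w.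
Proof.
case: w => a th /= /andP[th1 th2]; rewrite /cln cabs_cexp Re_cexp Im_cexp /= expRK.
rewrite mulrAC mulfV ?gt_eqF ?expR_gt0// mul1r pmulr_rge0 ?expR_gt0//.
congr (_ +i* _); have [th0|th0] := leP 0 th.
  by rewrite sin_ge0_pi ?th0 ?(ltW th2)// cosK// in_itv /= th0 ltW.
have sth : sin th < 0.
  by rewrite -oppr_gt0 -sinN sin_gt0_pi// oppr_gt0 th0 ltrNl.
by rewrite leNgt sth /= cosKN ?opprK// ltW//= ltW.
Qed.

Lemma normr_atan_le (x : R) : `|atan x| <= `|x|.
Proof.
wlog x0 : x / 0 <= x.
  move=> H; have [|x0] := leP 0 x; first exact: H.
  by rewrite -(normrN x) -[`|atan x|]normrN -atanN; apply: H; rewrite oppr_ge0 ltW.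
have [c] := @MVT_segment R atan (fun x => (1 + x ^+ 2)^-1) 0 x x0
   (fun y _ => is_derive1_atan y) (continuous_subspaceT (@continuous_atan R)).
rewrite atan0 !subr0 => _ ->; rewrite normrM -[leRHS]mul1r ler_wpM2r//.
have c1 : 1 <= 1 + c ^+ 2 by rewrite lerDl sqr_ge0.
by rewrite ger0_norm ?invr_ge0 ?invf_le1 ?(lt_le_trans ltr01 c1)// (le_trans ler01).
Qed.

(** In the half-plane Re z > 0 the argument is the arc tangent of Im z / Re z,
    and ln and atan are Lipschitz on the relevant range. *)
Lemma cexp_onto_near1 z : cabs (z - 1) <= 2^-1 ->
  exists w, [/\ cexp w = z, cabs w <= 4 * cabs (z - 1) & `|complex.Im w| <= 2^-1 * pi].
Proof.
move=> z1; pose e := cabs (z - 1).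
have x1 : `|complex.Re z - 1| <= e by have := normr_Re_le (z - 1); rewrite cReD.
have y1 : `|complex.Im z| <= e by have := normr_Im_le (z - 1); rewrite cImD /= oppr0 addr0.
set x := complex.Re z in x1 *; set y := complex.Im z in y1 *.
have x2 : 2^-1 <= x.
  by move: x1; rewrite ler_distl => /andP[x1 _]; rewrite (le_trans _ x1)//; move: z1; rewrite -/e; lra.
have x0 : 0 < x by lra.
have a1 : `|cabs z - 1| <= e.
  rewrite ler_distl; apply/andP; split.
    by have := cabsD (1 - z) z; rewrite subrK cabs1 cabs_distC -/e; lra.
  by have := cabsD (z - 1) 1; rewrite subrK cabs1 addrC.
have a2 : 2^-1 <= cabs z by rewrite (le_trans x2)// (le_trans (ler_norm _))// normr_Re_le.
have a0 : 0 < cabs z by lra.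
exists (ln (cabs z) +i* atan (y / x)).
have sq : Num.sqrt (1 + (y / x) ^+ 2) = cabs z / x.
  have -> : 1 + (y / x) ^+ 2 = (x ^+ 2 + y ^+ 2) / x ^+ 2.
    by field; rewrite gt_eqF.
  by rewrite sqrtrM ?addr_ge0 ?sqr_ge0// sqrtrV ?sqr_ge0// sqrtr_sqr (gtr0_norm x0) cabsE.
have c0 : cos (atan (y / x)) = x / cabs z by rewrite cos_atan sq invf_div.
have s0 : sin (atan (y / x)) = y / cabs z.
  have c0' : cos (atan (y / x)) != 0 by rewrite c0 gt_eqF// divr_gt0.
  have := atanK (y / x); rewrite {1}/tan => /eqP; rewrite eqr_div ?(lt0r_neq0 x0)// c0 => /eqP.
  by move=> H; apply: (mulIf (lt0r_neq0 x0)); rewrite H; field; rewrite gt_eqF.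
split.
- apply: eq_ReIm; rewrite ?Re_cexp ?Im_cexp /= lnK ?posrE// ?c0 ?s0.
    by rewrite mulrCA mulfV ?mulr1// gt_eqF.
  by rewrite mulrCA mulfV ?mulr1// gt_eqF.
- rewrite (le_trans (cabs_le_ReIm _))//= -/e.
  have -> : 4 * e = 2 * e + 2 * e by ring.
  apply: lerD.
    move: a1; rewrite ler_distl => /andP[b1 b2]; rewrite ler_norml.
    have e0 : 0 <= e by exact: cabs_ge0.
    apply/andP; split.
      rewrite -(opprK (ln _)) lerN2 -lnV ?posrE//.
      rewrite -[X in ln X](subrK 1) addrC (le_trans (le_ln1Dx _))//.
        by rewrite ltrBrDr addrC subrr invr_gt0.
      rewrite -(ler_pM2r a0) mulrBl mulVf ?gt_eqF// mul1r.
      have : e * 2^-1 <= e * cabs z by rewrite ler_wpM2l.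
      by lra.
    rewrite -[X in ln X](subrK 1) addrC (le_trans (le_ln1Dx _))//; lra.
  rewrite (le_trans (normr_atan_le _))// normrM normfV (gtr0_norm x0).
  rewrite ler_pdivrMr// (le_trans y1)//.
  have e0 : 0 <= e by exact: cabs_ge0.
  have : e * 2^-1 <= e * x by rewrite ler_wpM2l.
  by lra.
- rewrite /= ler_norml mulrC -/(pi / 2) (ltW (atan_ltpi2 _)) ltW//.
  exact: atan_gtNpi2.
Qed.

(** If z = e^w (1 + delta) then log z = w + log (1 + delta), because the sum of
    the two arguments stays in the range of the principal branch: it is at most
    1/2 + pi/2 < pi in absolute value. *)
Lemma cln_near z w : `|complex.Im w| <= 2^-1 -> cabs (z * cexp (- w) - 1) <= 2^-1 ->
  cabs (cln z - w) <= 4 * cabs (z * cexp (- w) - 1).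
Proof.
move=> w1 /cexp_onto_near1[v [ve vb vi]].
have -> : z = cexp (w + v).
  by rewrite cexpD ve mulrCA cexpN mulr1.
rewrite cln_cexp; first by rewrite -cexpD [w + v - w]addrAC subrr add0r ve.
have := @pi_ge2 R; rewrite cImD; move: w1 vi; rewrite !ler_norml.
by move=> /andP[? ?] /andP[? ?] ?; apply/andP; split; lra.
Qed.

End complex_numbers.

(** * Integration over R^n *)

Section integration.
Context {R : realType}.
Local Notation T n := (n.-tuple (measurableTypeR R)).
Local Notation mu := (@lebesgue_measure R).
Local Notation mun := (@lebesgue_measure_n R).

Lemma ge0_integral_cons n (f : T n.+1 -> \bar R) :
  measurable_fun setT f -> (forall x, 0 <= f x)%E ->
  (\int[mun n.+1]_x f x = \int[mu]_x \int[mun n]_y f (tcons (x, y)))%E.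
Proof.
move=> mf f0.
rewrite -[LHS]/(integral (pushforward (mu \x mun n)%E (@tcons R n)) setT f).
rewrite ge0_integral_pushforward//=; last exact: measurable_tcons.
rewrite fubini_tonelli1//.
by apply: measurableT_comp => //; exact: measurable_tcons.
Qed.

Lemma integral_cons n (f : T n.+1 -> \bar R) :
  (mun n.+1).-integrable setT f ->
  (mu \x mun n)%E.-integrable setT (f \o @tcons R n) /\
  (\int[mun n.+1]_x f x = \int[(mu \x mun n)%E]_z f (tcons z))%E.
Proof.
move=> /integrableP[mf intf].
have mft : measurable_fun setT (f \o @tcons R n).
  by apply: measurableT_comp => //; exact: measurable_tcons.
have intf' : (mu \x mun n)%E.-integrable setT (f \o @tcons R n).
  apply/integrableP; split => //.
  rewrite ge0_integral_cons// in intf; last exact: measurableT_comp.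
  by rewrite fubini_tonelli1//; exact: measurableT_comp.
split => //.
rewrite -[LHS]/(integral (pushforward (mu \x mun n)%E (@tcons R n)) setT f).
by rewrite integral_pushforward//; exact: measurable_tcons.
Qed.

Lemma tnth_tcons0 n x (y : T n) : tnth (tcons (x, y)) ord0 = x.
Proof. by []. Qed.

Lemma tnth_tconsS n x (y : T n) i : tnth (tcons (x, y)) (lift ord0 i) = tnth y i.
Proof. by rewrite !(tnth_nth 0). Qed.

Lemma tconsK n (x : T n.+1) : tcons (thead x, [tuple of behead x]) = x.
Proof. by rewrite [RHS]tuple_eta; apply/val_inj. Qed.

Lemma prod_tcons n (k : nat -> R -> R) x (y : T n) :
  \prod_(i < n.+1) k i (tnth (tcons (x, y)) i) =
  k 0%N x * \prod_(i < n) k i.+1 (tnth y i).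
Proof.
rewrite big_ord_recl tnth_tcons0; congr (_ * _).
by apply: eq_bigr => i _; rewrite tnth_tconsS lift0.
Qed.

Lemma measurable_prod_tuple n (k : nat -> R -> R) :
  (forall i, measurable_fun setT (k i)) ->
  measurable_fun setT (fun x : T n => \prod_(i < n) k i (tnth x i)).
Proof.
move=> mk; apply: measurable_prod => i _.
by apply: (measurableT_comp (mk i)); exact: measurable_tnth.
Qed.

Lemma integral_prod_tuple n (k : nat -> R -> R) (c : nat -> R) :
  (forall i, measurable_fun setT (k i)) -> (forall i x, 0 <= k i x) ->
  (forall i, (\int[mu]_x (k i x)%:E = (c i)%:E)%E) ->
  (\int[mun n]_x (\prod_(i < n) k i (tnth x i))%:E = (\prod_(i < n) c i)%:E)%E.
Proof.
elim: n k c => [|n IH] k c mk k0 kc.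
  rewrite /= big_ord0 integral_dirac//=; first by rewrite diracT mul1e big_ord0.
  by apply/measurable_EFinP; apply: measurable_prod_tuple.
rewrite ge0_integral_cons; first last.
- by move=> x; rewrite lee_fin prodr_ge0.
- by apply/measurable_EFinP; apply: measurable_prod_tuple.
have c0 i : 0 <= c i.
  by rewrite -lee_fin -kc integral_ge0// => x _; rewrite lee_fin.
transitivity (\int[mu]_x ((k 0%N x)%:E * (\prod_(i < n) c i.+1)%:E))%E.
  apply: eq_integral => x _.
  rewrite -(IH (fun i => k i.+1) (fun i => c i.+1))//.
  rewrite -ge0_integralZl_EFin//; first last.
  - by apply/measurable_EFinP; apply: (measurable_prod_tuple (k := fun i => k i.+1)).
  - by move=> y _; rewrite lee_fin prodr_ge0.
  by apply: eq_integral => y _; rewrite prod_tcons EFinM.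
rewrite ge0_integralZr//; first last.
- by rewrite lee_fin prodr_ge0.
- by move=> y _; rewrite lee_fin.
- by apply/measurable_EFinP; exact: mk.
by rewrite kc -EFinM big_ord_recl.
Qed.

(** The weight against which all the functions are dominated: it is integrable
    with an elementary primitive, and it factors over the coordinates. *)
Definition wt1 (x : R) : R := (1 + x ^+ 2)^-1.

Definition wt n (x : T n) : R := \prod_(i < n) wt1 (tnth x i).

Lemma onesq_gt0 (x : R) : 0 < 1 + x ^+ 2.
Proof. by rewrite ltr_pwDl// sqr_ge0. Qed.

Lemma wt1_gt0 x : 0 < wt1 x.
Proof. by rewrite invr_gt0 onesq_gt0. Qed.

Lemma wt_gt0 n (x : T n) : 0 < wt x.
Proof. by apply: prodr_gt0 => i _; exact: wt1_gt0. Qed.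

Lemma wt1_le1 x : wt1 x <= 1.
Proof. by rewrite invf_le1 ?onesq_gt0// lerDl sqr_ge0. Qed.

Lemma continuous_wt1 : continuous wt1.
Proof. exact: continuous_oneDsqrV. Qed.

Lemma measurable_wt1 : measurable_fun setT wt1.
Proof. by apply: continuous_measurable_fun; exact: continuous_wt1. Qed.

Lemma measurable_wt n : measurable_fun setT (@wt n).
Proof. by apply: (@measurable_prod_tuple n (fun _ => wt1)) => _; exact: measurable_wt1. Qed.

Lemma wt_tcons n x (y : T n) : wt (tcons (x, y)) = wt1 x * wt y.
Proof. exact: (prod_tcons (fun _ => wt1)). Qed.

Lemma integral_wt1 : (\int[mu]_x (wt1 x)%:E = (pi : R)%:E)%E.
Proof.
rewrite ge0_symfun_integralT//; first last.
- by move=> x; rewrite /wt1 /= sqrrN.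
- exact: continuous_wt1.
- by move=> x; exact/ltW/wt1_gt0.
rewrite -set_itvcy integral0y_oneDsqr -EFinM mulrCA mulfV ?mulr1//.
Qed.

Lemma integral_wt n : (\int[mun n]_x (wt x)%:E = (pi ^+ n : R)%:E)%E.
Proof.
rewrite (@integral_prod_tuple n (fun _ => wt1) (fun _ => pi)) => [|_|_ x|_].
- by rewrite big_const_ord iter_mulr_1.
- exact: measurable_wt1.
- exact/ltW/wt1_gt0.
- exact: integral_wt1.
Qed.

Lemma integrable_wt n : (mun n).-integrable setT (EFin \o @wt n).
Proof.
apply/integrableP; split; first by apply/measurable_EFinP; exact: measurable_wt.
under eq_integral do rewrite /= ger0_norm ?(ltW (wt_gt0 _))//.
by rewrite integral_wt ltry.
Qed.

(** A class of integrands stable under sections, so that no integrability has to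
    be checked when an iterated integral is reordered. *)
Definition dominated n (f : T n -> R) :=
  measurable_fun setT f /\ exists C, forall x, `|f x| <= C * wt x.

Lemma integrable_dominated n (f : T n -> R) : dominated f ->
  (mun n).-integrable setT (EFin \o f).
Proof.
move=> [mf [C fC]].
apply: (@le_integrable _ _ _ _ _ _ _ (EFin \o (fun x => C * wt x))) => //.
- by apply/measurable_EFinP; exact: mf.
- by move=> x _; rewrite /= lee_fin (le_trans (fC x))// ler_norm.
- exact: integrableZl (integrable_wt n).
Qed.

Lemma le_Rintegral_wt n (f : T n -> R) C : measurable_fun setT f ->
  (forall x, `|f x| <= C * wt x) -> `| \int[mun n]_x f x | <= C * pi ^+ n.
Proof.
move=> mf fC; have intf : (mun n).-integrable setT (EFin \o f).
  by apply: integrable_dominated; split => //; exists C.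
rewrite (le_trans (le_normr_Rintegral _ intf))//.
have -> : C * pi ^+ n = \int[mun n]_x (C * wt x).
  by rewrite RintegralZl//; [rewrite /Rintegral integral_wt|exact: integrable_wt].
apply: le_Rintegral => //.
  exact: integrable_norm.
exact: integrableZl (integrable_wt n).
Qed.

End integration.

(** * Integrals over the line *)

Section line_integrals.
Context {R : realType}.
Local Notation mu := (@lebesgue_measure R).

Lemma Rdominated_cvg dd (T : measurableType dd) (m : {measure set T -> \bar R})
    (fn : nat -> T -> R) (f g : T -> R) :
  (forall n, measurable_fun setT (fn n)) ->
  (forall x, fn ^~ x @ \oo --> f x) ->
  m.-integrable setT (EFin \o g) -> (forall n x, `|fn n x| <= g x) ->
  (fun n => \int[m]_x fn n x) @ \oo --> \int[m]_x f x.
Proof.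
move=> mfn cf ig fg.
have := @dominated_cvg _ _ _ m setT measurableT (fun n => EFin \o fn n) (EFin \o f)
  (EFin \o g).
have mE n : measurable_fun setT (EFin \o fn n).
  by apply/measurable_EFinP; exact: mfn.
have cE x : [set: T] x -> (EFin \o fn n) x @[n --> \oo] --> (EFin \o f) x.
  by move=> _; apply: cvg_EFin; [exact: nearW|exact: cf].
move=> /(_ mE cE (fun _ _ => erefl) ig) H.
have iE n : m.-integrable setT (EFin \o fn n).
  apply: le_integrable ig => // x _.
  by rewrite /= lee_fin (le_trans (fg n x))// ler_norm.
have ifE : m.-integrable setT (EFin \o f).
  apply: le_integrable ig => //.
    exact: (emeasurable_fun_cvg _ _ mE cE).
  move=> x _; rewrite /= lee_fin (le_trans _ (ler_norm _))//.
  apply: (cvgr_to_le (cvg_norm (cf x))).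
  by apply: nearW => n; exact: fg.
apply: fine_cvg; rewrite fineK.
  by apply: H => n x _; rewrite /= lee_fin.
exact: integrable_fin_num.
Qed.

Lemma FTC_segment (F f : R -> R) a b : a < b -> continuous f ->
  (forall x, is_derive x (1:R) (F : R -> R^o) (f x)) ->
  \int[mu]_(x in `[a, b]) f x = F b - F a.
Proof.
move=> ab cf dF.
have cF : continuous F.
  by move=> x; apply: differentiable_continuous; apply/derivable1_diffP; case: (dF x).
rewrite /Rintegral (@continuous_FTC2 _ f F)//.
- exact: continuous_subspaceT.
- split=> [x _||]; first by case: (dF x).
    by apply: cvg_at_right_filter; exact: cF.
  by apply: cvg_at_left_filter; exact: cF.
- by move=> x _; rewrite derive1E; case: (dF x).
Qed.

Lemma cvg_integral_segments (f : R -> R) : mu.-integrable setT (EFin \o f) ->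
  (fun n => \int[mu]_(x in `[- n%:R, n%:R]) f x) @ \oo --> \int[mu]_x f x.
Proof.
move=> intf.
have mf : measurable_fun setT f by apply/measurable_EFinP; exact: measurable_int intf.
under eq_fun do rewrite Rintegral_mkcond.
apply: (@Rdominated_cvg _ _ mu (fun n => f \_ `[- n%:R, n%:R]) f (fun x => `|f x|)).
- by move=> n; apply/measurable_restrict => //; rewrite setTI; exact: measurable_funTS.
- move=> x; apply: cvg_near_cst.
  exists (Num.truncn `|x|).+1 => // n /= nx.
  rewrite patchE mem_set//= in_itv /= -ler_norml.
  rewrite ltW// (lt_le_trans (truncnS_gt _))// ler_nat//.
- exact: (integrable_norm intf).
- by move=> n x; rewrite patchE; case: ifPn => // _; rewrite normr0.
Qed.

Lemma integral_line (F f : R -> R) (l l' : R) : continuous f ->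
  mu.-integrable setT (EFin \o f) ->
  (forall x, is_derive x (1:R) (F : R -> R^o) (f x)) ->
  (fun n => F n%:R) @ \oo --> l -> (fun n => F (- n%:R)) @ \oo --> l' ->
  \int[mu]_x f x = l - l'.
Proof.
move=> cf intf dF Fl Fl'.
have c1 := cvg_integral_segments intf.
have c2 : (fun n => \int[mu]_(x in `[- n%:R, n%:R]) f x) @ \oo --> l - l'.
  have H : (fun n => F n%:R - F (- n%:R)) @ \oo --> l - l' by exact: cvgB.
  rewrite -cvg_shiftS in H; rewrite -cvg_shiftS; apply: cvg_trans H.
  apply: near_eq_cvg; apply: nearW => n; rewrite /= -(FTC_segment _ cf)//.
  by rewrite gtrN// ltr0n.
exact: (cvg_unique _ c1 c2).
Qed.

(** The weight exp (- d |x|) has a corner at the origin, so that its primitives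
    on the two half-lines are different functions. *)
Lemma integral_two_sided (f fr fl Fr Fl : R -> R) :
  mu.-integrable setT (EFin \o f) -> continuous fr -> continuous fl ->
  (forall x, is_derive x (1:R) (Fr : R -> R^o) (fr x)) ->
  (forall x, is_derive x (1:R) (Fl : R -> R^o) (fl x)) ->
  (forall x, 0 <= x -> f x = fr x) -> (forall x, x <= 0 -> f x = fl x) ->
  (fun n => Fr n%:R) @ \oo --> (0:R) -> (fun n => Fl (- n%:R)) @ \oo --> (0:R) ->
  \int[mu]_x f x = Fl 0 - Fr 0.
Proof.
move=> intf cr cl dr dl er el Fr0 Fl0.
have c1 := cvg_integral_segments intf.
have c2 : (fun n => \int[mu]_(x in `[- n%:R, n%:R]) f x) @ \oo --> Fl 0 - Fr 0.
  have H : (fun n => (Fl 0 - Fl (- n%:R)) + (Fr n%:R - Fr 0)) @ \oo -->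
     (Fl 0 - 0) + (0 - Fr 0).
    by apply: cvgD; apply: cvgB => //; exact: cvg_cst.
  rewrite subr0 sub0r in H.
  rewrite -cvg_shiftS in H; rewrite -cvg_shiftS; apply: cvg_trans H.
  apply: near_eq_cvg; apply: nearW => n /=.
  have n0 : (0:R) < n.+1%:R by rewrite ltr0n.
  have intI : mu.-integrable `[- n.+1%:R, n.+1%:R] (EFin \o f).
    exact: (integrableS _ _ _ intf).
  have := @Rintegral_itvB R f (BLeft (- n.+1%:R)) (BRight n.+1%:R) 0 intI.
  rewrite !bnd_simp oppr_le0 (ltW n0) => /(_ erefl erefl) /eqP.
  rewrite subr_eq => /eqP ->.
  rewrite Rintegral_itv_obnd_cbnd; last first.
    by apply: (integrableS _ _ _ intf) => //.
  rewrite (@eq_Rintegral _ _ _ mu `[0, n.+1%:R] fr f); last first.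
    by move=> x; rewrite inE /= in_itv /= => /andP[x0 _]; exact: er.
  rewrite (@eq_Rintegral _ _ _ mu `[- n.+1%:R, 0] fl f); last first.
    by move=> x; rewrite inE /= in_itv /= => /andP[_ x0]; exact: el.
  rewrite (FTC_segment _ cr dr)// (FTC_segment _ cl dl) ?oppr_lt0//.
  by rewrite addrC.
exact: (cvg_unique _ c1 c2).
Qed.

Lemma cvg_expN (d : R) : 0 < d -> (fun n : nat => expR (- (d * n%:R))) @ \oo --> (0:R).
Proof.
move=> d0; have -> : (fun n : nat => expR (- (d * n%:R))) = (fun n => expR (- d) ^+ n).
  by apply/funext => n; rewrite -mulNr mulrC expRM_natl.
apply: cvg_expr; rewrite ger0_norm ?expR_ge0//.
by rewrite -expR0 ltr_expR oppr_lt0.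
Qed.

Lemma cvg_norm_le0 (u v : nat -> R) : (forall n, `|u n| <= v n) ->
  v @ \oo --> (0:R) -> u @ \oo --> (0:R).
Proof.
move=> uv v0; apply/cvgr0Pnorm_lt => e e0.
move/cvgr0Pnorm_lt : v0 => /(_ e e0); apply: filterS => n vn.
by rewrite (le_lt_trans (uv n))// (le_lt_trans (ler_norm _)).
Qed.

(** Regularizing factor for Fourier inversion. Its transform is computed by an
    explicit primitive, and is the Poisson kernel. *)
Definition poisson_weight (d x : R) : R := expR (- (d * `|x|)).

Definition poisson_kernel (d x : R) : R := 2 * d / (d ^+ 2 + x ^+ 2).

Lemma continuous_poisson_weight d : continuous (poisson_weight d).
Proof.
move=> x; rewrite /poisson_weight.
apply: (@continuous_comp _ _ _ (fun x => - (d * `|x|)) (@expR R)); last exact: continuous_expR.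
by apply: cvgN; apply: cvgM; [exact: cvg_cst|exact: norm_continuous].
Qed.

Lemma poisson_weight_le (d x : R) : 0 < d ->
  poisson_weight d x <= (1 + 2 / d ^+ 2) * wt1 x.
Proof.
move=> d0; rewrite /poisson_weight /wt1 expRN ler_pdivlMr ?onesq_gt0// mulrC.
rewrite ler_pdivrMr ?expR_gt0// mulrDl mul1r lerD//.
  by rewrite -expR0 ler_expR mulr_ge0// ltW.
have := @expR_ge1Dxn R (d * `|x|) 1 (mulr_ge0 (ltW d0) (normr_ge0 _)).
rewrite exprMn real_normK ?num_real// => H.
have : (d ^+ 2 * x ^+ 2) / 2%:R <= expR (d * `|x|) by rewrite (le_trans _ H)// lerDr.
move=> {}H; rewrite -[X in X <= _](_ : (2 / d ^+ 2) * (d ^+ 2 * x ^+ 2 / 2%:R) = _).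
  by apply: ler_wpM2l => //; rewrite divr_ge0// sqr_ge0.
by field; rewrite gt_eqF.
Qed.

Lemma integrable_le_wt1 (f : R -> R) C : measurable_fun setT f ->
  (forall x, `|f x| <= C * wt1 x) -> mu.-integrable setT (EFin \o f).
Proof.
move=> mf fC.
apply: (@le_integrable _ (measurableTypeR R) R mu setT measurableT (EFin \o f)
  (EFin \o (fun x => C * wt1 x))) => //.
- by apply/measurable_EFinP; exact: mf.
- by move=> x _; rewrite /= lee_fin (le_trans (fC x))// ler_norm.
have iw : mu.-integrable setT (EFin \o @wt1 R).
  apply/integrableP; split.
    by apply/measurable_EFinP; exact: measurable_wt1.
  under eq_integral do rewrite /= ger0_norm ?(ltW (wt1_gt0 _))//.
  by rewrite integral_wt1 ltry.
exact: (@integrableZl _ _ _ mu setT measurableT C _ iw).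
Qed.

Lemma is_derive_lin (a s : R) : is_derive s (1:R) (fun s => s * a : R^o) a.
Proof.
apply: (is_derive_eq (is_derive_mul (is_derive_id s 1) (is_derive_cst _ s 1))).
by rewrite mulr0 addr0 mul1r.
Qed.

Lemma continuous_derivable (f f' : R -> R) :
  (forall x, is_derive x (1:R) (f : R -> R^o) (f' x)) -> continuous f.
Proof.
by move=> df x; apply: differentiable_continuous; apply/derivable1_diffP; case: (df x).
Qed.

(** The span of the two functions is stable under differentiation, so that
    primitives are found by solving a linear system of size 2. *)
Lemma is_derive_exp_trig (c x a b s : R) :
  is_derive s (1:R) (fun s => expR (s * c) * (a * sin (s * x) + b * cos (s * x)) : R^o)
   (expR (s * c) * ((c * a - b * x) * sin (s * x) + (c * b + a * x) * cos (s * x))).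
Proof.
have dE : is_derive s (1:R) (fun s => expR (s * c) : R^o) (expR (s * c) * c).
  by have := is_derive1_comp (f := expR) (is_derive_expR _) (is_derive_lin c s).
have dC : is_derive s (1:R) (fun s => cos (s * x) : R^o) (- sin (s * x) * x).
  by have := is_derive1_comp (f := cos) (is_derive_cos _) (is_derive_lin x s).
have dS : is_derive s (1:R) (fun s => sin (s * x) : R^o) (cos (s * x) * x).
  by have := is_derive1_comp (f := sin) (is_derive_sin _) (is_derive_lin x s).
apply: (is_derive_eq (is_derive_mul dE (is_derive_add
  (is_derive_mul (is_derive_cst a s 1) dS) (is_derive_mul (is_derive_cst b s 1) dC)))).
by rewrite /=; ring.
Qed.

Lemma cvg_exp_trig (d x a b e : R) : 0 < d -> e ^+ 2 = 1 ->
  (fun n : nat => expR (e * n%:R * - (e * d)) * (a * sin (e * n%:R * x) + b * cos (e * n%:R * x))) @ \oo --> (0 : R).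
Proof.
move=> d0 e2.
apply: (@cvg_norm_le0 _ (fun n => expR (- (d * n%:R)) * (`|a| + `|b|))) => [n|].
  have -> : e * n%:R * - (e * d) = - (d * n%:R) * e ^+ 2 by ring.
  rewrite e2 mulr1 normrM ger0_norm ?expR_ge0// ler_wpM2l ?expR_ge0//.
  rewrite (le_trans (ler_normD _ _))// !normrM lerD// -[leRHS]mulr1 ler_wpM2l//.
    by rewrite ler_norml sin_geN1 sin_le1.
  by rewrite ler_norml cos_geN1 cos_le1.
rewrite -[X in _ --> X](mul0r (`|a| + `|b|)); apply: cvgM; last exact: cvg_cst.
exact: cvg_expN.
Qed.

(** The primitives on the two half-lines vanish at infinity, and their values at
    the corner of the weight differ by the right-hand side. *)
Lemma integral_poisson_trig (d x p q : R) : 0 < d ->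
  \int[mu]_y (poisson_weight d y * (p * sin (y * x) + q * cos (y * x))) =
  q * poisson_kernel d x.
Proof.
move=> d0; pose D := d ^+ 2 + x ^+ 2.
have D0 : 0 < D by rewrite ltr_pwDl ?sqr_ge0// exprn_gt0.
have ct (c a b : R) : continuous (fun s : R => expR (s * c) * (a * sin (s * x) + b * cos (s * x))).
  exact: (continuous_derivable (is_derive_exp_trig c x a b)).
have mt : measurable_fun setT
    (fun y => poisson_weight d y * (p * sin (y * x) + q * cos (y * x))).
  apply: measurable_funM.
    by apply: continuous_measurable_fun; exact: continuous_poisson_weight.
  apply: continuous_measurable_fun => y.
  by have := ct 0 p q y; under eq_fun do rewrite mulr0 expR0 mul1r.
pose ar := (q * x - d * p) / D; pose br := - (p * x + d * q) / D.
pose al := (q * x + d * p) / D; pose bl := (d * q - p * x) / D.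
have intf : mu.-integrable setT
    (EFin \o (fun y => poisson_weight d y * (p * sin (y * x) + q * cos (y * x)))).
  apply: (@integrable_le_wt1 _ ((1 + 2 / d ^+ 2) * (`|p| + `|q|))) => // y.
  rewrite normrM (ger0_norm (expR_ge0 _)) mulrAC.
  apply: ler_pM => //; first exact: poisson_weight_le.
  rewrite (le_trans (ler_normD _ _))// !normrM lerD// -[leRHS]mulr1 ler_wpM2l//.
    by rewrite ler_norml sin_geN1 sin_le1.
  by rewrite ler_norml cos_geN1 cos_le1.
have dr (s : R) : is_derive s (1:R)
    (fun s : R => expR (s * - d) * (ar * sin (s * x) + br * cos (s * x)) : R^o)
    (expR (s * - d) * (p * sin (s * x) + q * cos (s * x))).
  apply: (is_derive_eq (is_derive_exp_trig _ _ _ _ _)).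
  by congr (_ * (_ * _ + _ * _)); rewrite /ar /br /D; field; rewrite gt_eqF.
have dl (s : R) : is_derive s (1:R)
    (fun s : R => expR (s * d) * (al * sin (s * x) + bl * cos (s * x)) : R^o)
    (expR (s * d) * (p * sin (s * x) + q * cos (s * x))).
  apply: (is_derive_eq (is_derive_exp_trig _ _ _ _ _)).
  by congr (_ * (_ * _ + _ * _)); rewrite /al /bl /D; field; rewrite gt_eqF.
rewrite (integral_two_sided intf (ct (- d) p q) (ct d p q) dr dl).
- rewrite !mul0r expR0 sin0 cos0 !mul1r !mulr0 !mulr1 !add0r.
  by rewrite /poisson_kernel -/D /bl /br; field; rewrite gt_eqF.
- by move=> y y0; rewrite /poisson_weight ger0_norm// mulrN [y * d]mulrC.
- by move=> y y0; rewrite /poisson_weight ler0_norm// mulrN opprK [y * d]mulrC.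
- have := @cvg_exp_trig d x ar br 1 d0 (expr1n _ _).
  by under eq_fun do rewrite !mul1r.
- have e2 : (-1 : R) ^+ 2 = 1 by rewrite sqrrN expr1n.
  have := @cvg_exp_trig d x al bl (-1) d0 e2.
  by under eq_fun do rewrite !mulN1r opprK.
Qed.

End line_integrals.

(** * Integration one coordinate at a time, and the Poisson kernel *)

Section real_fubini.
Context d1 d2 (T1 : measurableType d1) (T2 : measurableType d2) (R : realType).
Variables (m1 : {sigma_finite_measure set T1 -> \bar R})
          (m2 : {sigma_finite_measure set T2 -> \bar R}) (f : T1 * T2 -> R).
Hypothesis intf : (m1 \x m2)%E.-integrable setT (EFin \o f).
Hypothesis int1 : forall x, m2.-integrable setT (fun y => (f (x, y))%:E).
Hypothesis int2 : forall y, m1.-integrable setT (fun x => (f (x, y))%:E).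

Let FE : (fun x => \int[m2]_y (f (x, y))%:E)%E =
  EFin \o (fun x => \int[m2]_y f (x, y)).
Proof.
by apply/funext => x; rewrite /= /Rintegral fineK//; apply: integrable_fin_num.
Qed.

Let GE : (fun y => \int[m1]_x (f (x, y))%:E)%E =
  EFin \o (fun y => \int[m1]_x f (x, y)).
Proof.
by apply/funext => x; rewrite /= /Rintegral fineK//; apply: integrable_fin_num.
Qed.

Lemma integrable_section_integral1 :
  m1.-integrable setT (EFin \o (fun x => \int[m2]_y f (x, y))).
Proof. by rewrite -FE; exact: (integrable_fubini_F intf). Qed.

Lemma Rintegral_prod1 : \int[(m1 \x m2)%E]_z f z = \int[m1]_x \int[m2]_y f (x, y).
Proof.
rewrite [RHS]/Rintegral; congr fine.
transitivity (\int[m1]_x (\int[m2]_y (f (x, y))%:E))%E; last by rewrite FE.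
by rewrite -(integral12_prod_meas1 intf).
Qed.

Lemma Rintegral_prod2 : \int[(m1 \x m2)%E]_z f z = \int[m2]_y \int[m1]_x f (x, y).
Proof.
rewrite [RHS]/Rintegral; congr fine.
transitivity (\int[m2]_y (\int[m1]_x (f (x, y))%:E))%E; last by rewrite GE.
by rewrite -(integral21_prod_meas1 intf).
Qed.

End real_fubini.

Section integration_Rn.
Context {R : realType}.
Local Notation T n := (n.-tuple (measurableTypeR R)).
Local Notation mu := (@lebesgue_measure R).
Local Notation mun := (@lebesgue_measure_n R).

Lemma dominated_section n (G : T n.+1 -> R) x : dominated G ->
  dominated (fun y : T n => G (tcons (x, y))).
Proof.
move=> [mG [C GC]]; split.
  exact: (measurableT_comp mG (measurableT_comp (@measurable_tcons R n)
    (pair1_measurable (x : measurableTypeR R)))).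
exists (C * wt1 x) => y; rewrite (le_trans (GC _))// wt_tcons mulrA//.
Qed.

Lemma integrable_line_section n (G : T n.+1 -> R) y : dominated G ->
  mu.-integrable setT (fun x => (G (tcons (x, y)))%:E).
Proof.
move=> [mG [C GC]].
apply: (@integrable_le_wt1 _ (fun x => G (tcons (x, y))) (C * wt y)).
  exact: (measurableT_comp mG (measurableT_comp (@measurable_tcons R n)
    (pair2_measurable y))).
by move=> x; rewrite (le_trans (GC _))// wt_tcons mulrA mulrAC.
Qed.

Lemma Rintegral_cons1 n (G : T n.+1 -> R) : dominated G ->
  \int[mun n.+1]_x G x = \int[mu]_x \int[mun n]_y G (tcons (x, y)).
Proof.
move=> dG; have [iG eG] := integral_cons (integrable_dominated dG).
rewrite /Rintegral eG -[LHS]/(\int[(mu \x mun n)%E]_z (G \o @tcons R n) z).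
apply: (@Rintegral_prod1 _ _ _ _ _ mu (mun n) (G \o @tcons R n)) => // x.
exact: (integrable_dominated (dominated_section x dG)).
Qed.

Lemma Rintegral_cons2 n (G : T n.+1 -> R) : dominated G ->
  \int[mun n.+1]_x G x = \int[mun n]_y \int[mu]_x G (tcons (x, y)).
Proof.
move=> dG; have [iG eG] := integral_cons (integrable_dominated dG).
rewrite /Rintegral eG -[LHS]/(\int[(mu \x mun n)%E]_z (G \o @tcons R n) z).
apply: (@Rintegral_prod2 _ _ _ _ _ mu (mun n) (G \o @tcons R n)) => // x.
exact: integrable_line_section.
Qed.

Definition upd n (x : T n) (j : 'I_n) (s : R) : T n :=
  [tuple if i == j then s else tnth x i | i < n].

Lemma upd_tcons0 n x (y : T n) s : upd (tcons (x, y)) ord0 s = tcons (s, y).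
Proof.
apply: eq_from_tnth => i; rewrite tnth_mktuple.
by case: (unliftP ord0 i) => [k|] ->; rewrite ?tnth_tconsS ?eqxx.
Qed.

Lemma upd_tconsS n x (y : T n) j s :
  upd (tcons (x, y)) (lift ord0 j) s = tcons (x, upd y j s).
Proof.
apply: eq_from_tnth => i; rewrite tnth_mktuple.
case: (unliftP ord0 i) => [k|] ->; last by [].
by rewrite !tnth_tconsS tnth_mktuple (inj_eq lift_inj).
Qed.

(** Whichever coordinate is singled out, it can be integrated first. *)
Lemma integral_coordinate0 n (G : T n -> R) (j : 'I_n) : dominated G ->
  (forall x, \int[mu]_s G (upd x j s) = 0) -> \int[mun n]_x G x = 0.
Proof.
elim: n G j => [|n IH] G j dG G0; first by case: j G0.
have R0 dd (TT : measurableType dd) (m : {measure set TT -> \bar R}) (h : TT -> R) :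
    (forall x, h x = 0) -> \int[m]_x h x = 0.
  by move=> h0; under eq_Rintegral do rewrite h0; rewrite /Rintegral integral0.
case: (unliftP ord0 j) G0 => [k|] -> G0.
  rewrite Rintegral_cons1//; apply: (R0) => x.
  apply: (IH _ k (dominated_section x dG)) => y.
  by rewrite -(G0 (tcons (x, y))); apply: eq_Rintegral => s _; rewrite upd_tconsS.
rewrite Rintegral_cons2//; apply: (R0) => y.
rewrite -(G0 (tcons (0, y))); apply: eq_Rintegral => s _.
by rewrite upd_tcons0.
Qed.

(** The primitive decays at infinity: integration by parts is free of boundary
    terms. *)
Lemma integral_derivative0 (F f : R -> R) C : measurable_fun setT f -> continuous f ->
  (forall x, is_derive x (1:R) (F : R -> R^o) (f x)) ->
  (forall x, `|F x| <= C * wt1 x) -> (forall x, `|f x| <= C * wt1 x) ->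
  \int[mu]_x f x = 0.
Proof.
move=> mf cf dF FC fC; rewrite -(subrr 0).
have C0 : 0 <= C.
  by have := le_trans (normr_ge0 _) (FC 0); rewrite pmulr_lge0// wt1_gt0.
have H (u : nat -> R) : (forall n, u n ^+ 2 = n%:R ^+ 2) -> (fun n => F (u n)) @ \oo --> (0:R).
  move=> u2; apply: (@cvg_norm_le0 _ _ (fun n => C * (2 * harmonic n))).
    move=> n; rewrite (le_trans (FC _))// ler_wpM2l// /wt1 u2 /harmonic /=.
    rewrite -[leRHS]invf_div lef_pV2 ?posrE ?divr_gt0 ?onesq_gt0//.
    rewrite ler_pdivrMr// mulrDl mul1r -natr1.
    by have := sqr_ge0 (n%:R - 1 :> R); rewrite sqrrB1; nra.
  rewrite -[X in _ --> X](mulr0 C); apply: cvgM; first exact: cvg_cst.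
  rewrite -[X in _ --> X](mulr0 2); apply: cvgM; first exact: cvg_cst.
  exact: cvg_harmonic.
apply: (integral_line cf _ dF) => //.
- exact: (integrable_le_wt1 mf fC).
- exact: H.
- by apply: H => n; rewrite sqrrN.
Qed.


Lemma poisson_kernel_ge0 d x : 0 <= d -> 0 <= poisson_kernel d x :> R.
Proof. by move=> d0; rewrite /poisson_kernel divr_ge0 ?mulr_ge0 ?addr_ge0 ?sqr_ge0. Qed.

Lemma measurable_poisson_kernel d : 0 < d -> measurable_fun setT (@poisson_kernel R d).
Proof.
move=> d0; apply: continuous_measurable_fun => x; apply: cvgM; first exact: cvg_cst.
apply: cvgV.
  by rewrite gt_eqF// ltr_pwDl ?sqr_ge0// exprn_gt0.
by apply: cvgD; [exact: cvg_cst|exact: exprn_continuous].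
Qed.

Lemma is_derive_2atan (d x : R) : 0 < d ->
  is_derive x (1:R) (fun x => 2 * atan (x * d^-1) : R^o) (poisson_kernel d x).
Proof.
move=> d0; have H := is_derive1_comp (f := atan) (is_derive1_atan _) (is_derive_lin d^-1 x).
apply: (is_derive_eq (is_derive_mul (is_derive_cst (2:R) x 1) H)).
have D0 : 0 < d ^+ 2 + x ^+ 2 by rewrite ltr_pwDl ?sqr_ge0// exprn_gt0.
have -> : 1 + (x * d^-1) ^+ 2 = (d ^+ 2 + x ^+ 2) / d ^+ 2 by field; rewrite gt_eqF.
rewrite mul0r add0r /poisson_kernel invf_div; field.
by rewrite !gt_eqF.
Qed.

Lemma integral_poisson_kernel d : 0 < d ->
  (\int[mu]_x (poisson_kernel d x)%:E = (2 * pi : R)%:E)%E.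
Proof.
move=> d0.
have D0 x : 0 < d ^+ 2 + x ^+ 2 by rewrite ltr_pwDl ?sqr_ge0// exprn_gt0.
have intP : mu.-integrable setT (EFin \o @poisson_kernel R d).
  apply: (@integrable_le_wt1 _ _ (2 * d * (1 + d ^- 2))); first exact: measurable_poisson_kernel.
  move=> x; rewrite ger0_norm ?(poisson_kernel_ge0 _ (ltW d0))// /poisson_kernel /wt1.
  rewrite -[leRHS]mulrA; apply: ler_wpM2l; first by rewrite mulr_ge0// ltW.
  rewrite ler_pdivlMr ?onesq_gt0// ler_pdivrMl//.
  rewrite mulrDr mulr1 mulrDl mulfV ?expf_neq0 ?gt_eqF//.
  have : 0 <= x ^+ 2 / d ^+ 2 by rewrite divr_ge0 ?sqr_ge0.
  by have := sqr_ge0 d; lra.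
have cny : (n%:R * d^-1 : R) @[n --> \oo] --> +oo%R.
  have di0 : 0 < d^-1 by rewrite invr_gt0.
  have H : (r * d^-1)%R @[r --> +oo%R] --> +oo%R.
    exact: (@gt0_cvgMly R _ _ d^-1 id di0 (@cvg_id _ _)).
  exact: (@cvg_comp _ _ _ (fun n : nat => n%:R : R) (fun r => r * d^-1) _ _ _ (@cvgr_idn R) H).
have -> : 2 * pi = pi - (- pi) :> R by ring.
rewrite -(@integral_line _ _ _ _ _ _ intP (fun x => is_derive_2atan x d0)).
- by rewrite /Rintegral fineK//; exact: integrable_fin_num.
- move=> x; apply: cvgM; first exact: cvg_cst.
  apply: cvgV; first by rewrite gt_eqF.
  by apply: cvgD; [exact: cvg_cst|exact: exprn_continuous].
- rewrite (_ : pi = 2 * (pi / 2)); last by rewrite mulrCA mulfV ?mulr1.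
  apply: cvgM; first exact: cvg_cst.
  exact: (@cvg_comp _ _ _ (fun n : nat => n%:R * d^-1) (@atan R) _ _ _ cny (@cvgy_atan R)).
- rewrite (_ : - pi = - (2 * (pi / 2))); last by rewrite mulrCA mulfV ?mulr1.
  under eq_fun do rewrite mulNr atanN mulrN.
  apply: cvgN; apply: cvgM; first exact: cvg_cst.
  exact: (@cvg_comp _ _ _ (fun n : nat => n%:R * d^-1) (@atan R) _ _ _ cny (@cvgy_atan R)).
Qed.

(** A bounded substitute for the absolute value, which is not integrable against
    the Poisson kernel. *)
Definition minn1 (x : R) : R := Num.min 1 `|x|.

Lemma minn1_ge0 x : 0 <= minn1 x.
Proof. by rewrite /minn1 le_min ler01 normr_ge0. Qed.

Lemma measurable_minn1 : measurable_fun setT minn1.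
Proof. by apply: measurable_minr => //; apply: measurableT_comp. Qed.

(** Mass away from 0 disappears as the width tends to 0: pointwise convergence to
    0, dominated by a multiple of the reference weight because
    min(1, |x|) 2 d (1 + x^2) <= 4 (d^2 + x^2) for d <= 1. *)
Lemma poisson_concentration :
  (fun n => \int[mu]_x (minn1 x * poisson_kernel (harmonic n) x)) @ \oo --> (0:R).
Proof.
rewrite -[X in _ --> X](_ : \int[mu]_x (fun _ => 0 : R) x = 0); last first.
  by rewrite /Rintegral integral0.
have h0 n : 0 < harmonic n :> R by rewrite /harmonic /= invr_gt0 ltr0n.
have h1 n : harmonic n <= 1 :> R by rewrite /harmonic /= invf_le1 ?ltr0n// ler1n.
have D0 n x : 0 < (harmonic n) ^+ 2 + x ^+ 2 :> R by rewrite ltr_pwDl ?sqr_ge0// exprn_gt0.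
apply: (@Rdominated_cvg _ _ _ mu _ _ (fun x => 4 * wt1 x)).
- move=> n; apply: measurable_funM; first exact: measurable_minn1.
  exact: measurable_poisson_kernel.
- move=> x; have [->|x0] := eqVneq x 0.
    rewrite /minn1 normr0 min_r//; under eq_fun do rewrite mul0r; exact: cvg_cst.
  apply: (@cvg_norm_le0 _ _ (fun n => 2 / x ^+ 2 * harmonic n)).
    move=> n; rewrite ger0_norm; last by rewrite mulr_ge0 ?minn1_ge0 ?poisson_kernel_ge0 ?ltW.
    rewrite -[leRHS]mul1r ler_pM ?minn1_ge0 ?(poisson_kernel_ge0 _ (ltW (h0 n)))//.
      by rewrite /minn1 ge_min lexx.
    rewrite /poisson_kernel [leRHS]mulrAC ler_wpM2l ?mulr_ge0 ?(ltW (h0 n))//.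
    by rewrite lef_pV2 ?posrE// ?lerDr ?sqr_ge0// lt_neqAle eq_sym sqrf_eq0 x0 sqr_ge0.
  rewrite -[X in _ --> X](mulr0 (2 / x ^+ 2)); apply: cvgM; first exact: cvg_cst.
  exact: cvg_harmonic.
- by apply: (@integrable_le_wt1 _ _ 4) => [|x];
    [apply: measurable_funM => //; exact: measurable_wt1|
     rewrite ger0_norm// mulr_ge0// ltW// wt1_gt0].
- move=> n x; rewrite ger0_norm; last by rewrite mulr_ge0 ?minn1_ge0 ?poisson_kernel_ge0 ?ltW.
  rewrite /wt1 /poisson_kernel mulrA ler_pdivrMr// mulrAC ler_pdivlMr ?onesq_gt0//.
  rewrite /minn1; have := h0 n; have := h1 n; move: (harmonic n) => e e1 e0.
  have [x1|x1] := leP 1 `|x|.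
    have : 1 <= x ^+ 2 by rewrite -(real_normK (num_real x)) exprn_ege1.
    move=> x2; have : e * (1 + x ^+ 2) <= 1 * (1 + x ^+ 2) by rewrite ler_wpM2r// addr_ge0 ?sqr_ge0.
    by have := sqr_ge0 e; lra.
  have xx : `|x| ^+ 2 = x ^+ 2 by rewrite real_normK// num_real.
  have := sqr_ge0 (e - `|x|); rewrite -xx; have := normr_ge0 x.
  move: `|x| x1 => y y1 y0 h.
have y2 : y ^+ 2 <= 1 by rewrite exprn_ile1// ltW.
have : 2 * e * y * (1 + y ^+ 2) <= 2 * e * y * 2.
  by apply: ler_wpM2l; [rewrite !mulr_ge0// ltW|lra].
move: h; rewrite sqrrB -mulr_natl; have := sqr_ge0 e; have := sqr_ge0 y; lra.
Qed.

End integration_Rn.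

(** * Fourier inversion for real trigonometric transforms *)

Section fourier_tuples.
Context {R : realType} {n : nat}.
Local Notation T := (n.-tuple (measurableTypeR R)).
Local Notation mu := (@lebesgue_measure R).
Local Notation mun := (@lebesgue_measure_n R n).

Definition tdot (m : nat) (x y : m.-tuple (measurableTypeR R)) : R :=
  \sum_(i < m) tnth x i * tnth y i.

(** Sines and cosines are carried together: integration by parts exchanges
    them, and the product formula for the Poisson weights mixes them. *)
Definition trig (p q s : R) : R := p * sin s + q * cos s.

Lemma trig_le p q s : `|trig p q s| <= `|p| + `|q|.
Proof.
rewrite (le_trans (ler_normD _ _))// !normrM lerD// -[leRHS]mulr1 ler_wpM2l//.
  by rewrite ler_norml sin_geN1 sin_le1.
by rewrite ler_norml cos_geN1 cos_le1.
Qed.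

Lemma trigD p q a b :
  trig p q (a + b) = trig (trig (- q) p b) (trig p q b) a.
Proof. by rewrite /trig sinD cosD; ring. Qed.

Lemma continuous_trig p q : continuous (trig p q).
Proof.
move=> s; apply: cvgD; apply: cvgM; try exact: cvg_cst.
  exact: continuous_sin.
exact: continuous_cos.
Qed.

Lemma measurable_trig p q : measurable_fun setT (trig p q).
Proof. by apply: continuous_measurable_fun; exact: continuous_trig. Qed.

Lemma is_derive_trig p q a b s : is_derive s (1:R)
  (fun s => trig p q (s * a + b) : R^o) (a * trig (- q) p (s * a + b)).
Proof.
have dl : is_derive s (1:R) (fun s => s * a + b : R^o) a.
  apply: (is_derive_eq (is_derive_add (is_derive_lin a s) (is_derive_cst b s 1))).
  by rewrite addr0.
have dC := is_derive1_comp (f := cos) (is_derive_cos _) dl.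
have dS := is_derive1_comp (f := sin) (is_derive_sin _) dl.
apply: (is_derive_eq (is_derive_add (is_derive_mul (is_derive_cst p s 1) dS)
  (is_derive_mul (is_derive_cst q s 1) dC))).
by rewrite /trig /=; ring.
Qed.

Lemma measurable_tdot m :
  measurable_fun setT (fun z : m.-tuple (measurableTypeR R) * m.-tuple (measurableTypeR R) =>
    tdot z.1 z.2).
Proof.
apply: measurable_sum => i; apply: measurable_funM.
  exact: (measurableT_comp (measurable_tnth i) measurable_fst).
exact: (measurableT_comp (measurable_tnth i) measurable_snd).
Qed.

Lemma tdotC m (x y : m.-tuple (measurableTypeR R)) : tdot x y = tdot y x.
Proof. by apply: eq_bigr => i _; rewrite mulrC. Qed.

Lemma tdot_tcons m a b (x y : m.-tuple (measurableTypeR R)) :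
  tdot (tcons (a, x)) (tcons (b, y)) = a * b + tdot x y.
Proof.
rewrite /tdot big_ord_recl; congr (_ + _).
by apply: eq_bigr => i _; rewrite !tnth_tconsS.
Qed.

Lemma measurable_tdotr m (y : m.-tuple (measurableTypeR R)) :
  measurable_fun setT (fun x => tdot x y).
Proof. exact: (measurableT_comp (@measurable_tdot m) (pair2_measurable y)). Qed.

Definition poisson_weights m (d : R) (x : m.-tuple (measurableTypeR R)) : R :=
  \prod_(i < m) poisson_weight d (tnth x i).

Lemma poisson_weights_gt0 m d (x : m.-tuple (measurableTypeR R)) :
  0 < poisson_weights d x.
Proof. by apply: prodr_gt0 => i _; exact: expR_gt0. Qed.

Lemma measurable_poisson_weights m d :
  measurable_fun setT (@poisson_weights m d).
Proof.
apply: (@measurable_prod_tuple R m (fun _ => poisson_weight d)) => _.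
by apply: continuous_measurable_fun; exact: continuous_poisson_weight.
Qed.

Lemma poisson_weights_le m d (x : m.-tuple (measurableTypeR R)) : 0 < d ->
  poisson_weights d x <= (1 + 2 / d ^+ 2) ^+ m * wt x.
Proof.
move=> d0; rewrite -[X in _ ^+ X]card_ord -prodr_const -big_split /=.
apply: ler_prod => i _; rewrite expR_ge0 /=; exact: poisson_weight_le.
Qed.

Lemma poisson_weights_le1 m d (x : m.-tuple (measurableTypeR R)) : 0 <= d ->
  poisson_weights d x <= 1.
Proof.
move=> d0; apply: prodr_ile1 => i _; rewrite expR_ge0 /=.
by rewrite -expR0 ler_expR oppr_le0 mulr_ge0.
Qed.

Lemma dominated_mul_bounded m (f g : m.-tuple (measurableTypeR R) -> R) C :
  dominated f -> measurable_fun setT g -> (forall x, `|g x| <= C) ->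
  dominated (fun x => f x * g x).
Proof.
move=> [mf [D fD]] mg gC; split; first exact: measurable_funM.
exists (D * C) => x; rewrite normrM mulrAC ler_pM//.
Qed.

Lemma dominated_poisson_trig m d p q (x : m.-tuple (measurableTypeR R)) : 0 < d ->
  dominated (fun y => poisson_weights d y * trig p q (tdot y x)).
Proof.
move=> d0; apply: (@dominated_mul_bounded _ _ _ (`|p| + `|q|)).
- split; first exact: measurable_poisson_weights.
  exists ((1 + 2 / d ^+ 2) ^+ m) => y.
  by rewrite ger0_norm ?poisson_weights_le// ltW// poisson_weights_gt0.
- exact: (measurableT_comp (measurable_trig p q) (measurable_tdotr x)).
- by move=> y; exact: trig_le.
Qed.

Lemma integral_poisson_weights_trig m d p q (x : m.-tuple (measurableTypeR R)) :
  0 < d ->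
  \int[lebesgue_measure_n m]_y (poisson_weights d y * trig p q (tdot y x)) =
  q * \prod_(i < m) poisson_kernel d (tnth x i).
Proof.
move=> d0; elim: m p q x => [|m IH] p q x.
  rewrite big_ord0 mulr1 /Rintegral /= integral_dirac//=; last first.
    apply/measurable_EFinP.
    by have [] := dominated_poisson_trig p q x d0.
  by rewrite indicE in_setT mul1r /poisson_weights /tdot !big_ord0 /trig sin0 cos0; ring.
rewrite Rintegral_cons2; last exact: dominated_poisson_trig.
rewrite -(tconsK x); set x0 := thead x; set x' := [tuple of behead x].
have E y z : poisson_weights d (tcons (y, z)) * trig p q (tdot (tcons (y, z)) (tcons (x0, x')))
   = poisson_weights d z * (poisson_weight d y *
     trig (trig (- q) p (tdot z x')) (trig p q (tdot z x')) (y * x0)).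
  rewrite /poisson_weights (prod_tcons (fun _ => poisson_weight d)).
  by rewrite tdot_tcons trigD; ring.
transitivity (\int[lebesgue_measure_n m]_z
   (poisson_kernel d x0 * (poisson_weights d z * trig p q (tdot z x')))).
  apply: eq_Rintegral => z _; under eq_Rintegral do rewrite E.
  rewrite RintegralZl//; last first.
    apply: (@integrable_le_wt1 _ _ ((1 + 2 / d ^+ 2) *
      (`|trig (- q) p (tdot z x')| + `|trig p q (tdot z x')|))).
      apply: measurable_funM.
        by apply: continuous_measurable_fun; exact: continuous_poisson_weight.
      apply: (measurableT_comp (measurable_trig _ _)).
      by apply: measurable_funM.
    move=> y; rewrite normrM (ger0_norm (expR_ge0 _)) mulrAC.
    by apply: ler_pM => //; [exact: poisson_weight_le|exact: trig_le].
  by rewrite /trig integral_poisson_trig//; ring.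
rewrite RintegralZl//; last first.
  by apply: integrable_dominated; exact: dominated_poisson_trig.
by rewrite IH mulrCA (prod_tcons (fun _ => poisson_kernel d)).
Qed.

Definition fourier_trig (p q : R) (F : T -> R) (xi : T) : R :=
  \int[mun]_x (F x * trig p q (tdot xi x)).

Lemma integrable_wt_pair (f : T * T -> R) C : measurable_fun setT f ->
  (forall x y, `|f (x, y)| <= C * (wt x * wt y)) ->
  (mun \x mun)%E.-integrable setT (EFin \o f).
Proof.
move=> mf fC; apply: (@le_integrable _ _ _ _ _ _ _ (EFin \o (fun z => C * (wt z.1 * wt z.2)))) => //.
- by apply/measurable_EFinP; exact: mf.
- by move=> [x y] _; rewrite /= lee_fin (le_trans (fC x y))// ler_norm.
have mw : measurable_fun setT (fun z : T * T => wt z.1 * wt z.2).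
  apply: measurable_funM.
    exact: (measurableT_comp (@measurable_wt R n) measurable_fst).
  exact: (measurableT_comp (@measurable_wt R n) measurable_snd).
have w0 (x y : T) : 0 <= wt x * wt y by rewrite mulr_ge0 ?ltW ?wt_gt0.
have iw : (mun \x mun)%E.-integrable setT (EFin \o (fun z => wt z.1 * wt z.2)).
  apply/integrable12ltyP; first by apply/measurable_EFinP; exact: mw.
  under eq_integral => x _.
    under eq_integral => y _ do rewrite /= ger0_norm// EFinM.
    rewrite ge0_integralZl_EFin//; first last.
    - by rewrite ltW// wt_gt0.
    - by apply/measurable_EFinP; exact: measurable_wt.
    - by move=> y _; rewrite lee_fin ltW// wt_gt0.
    rewrite integral_wt; over.
  rewrite ge0_integralZr//; first last.
  - by rewrite lee_fin exprn_ge0// pi_ge0.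
  - by move=> y _; rewrite lee_fin ltW// wt_gt0.
  - by apply/measurable_EFinP; exact: measurable_wt.
  by rewrite integral_wt -EFinM ltry.
exact: (integrableZl measurableT C iw).
Qed.

Section inversion.
Variables (F : T -> R) (p q : R).
Hypothesis dF : dominated F.

Let mker d : measurable_fun setT
  (fun z : T * T => poisson_weights d z.1 * (F z.2 * trig p q (tdot z.1 z.2))).
Proof.
have [mF _] := dF.
apply: measurable_funM.
  exact: (measurableT_comp (@measurable_poisson_weights n d) measurable_fst).
apply: measurable_funM; first exact: (measurableT_comp mF measurable_snd).
exact: (measurableT_comp (measurable_trig p q) (@measurable_tdot n)).
Qed.

Lemma dominated_fourier_integrand xi : dominated (fun x => F x * trig p q (tdot xi x)).
Proof.
apply: (@dominated_mul_bounded _ _ _ (`|p| + `|q|)) => //.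
  apply: (measurableT_comp (measurable_trig p q)).
  exact: (measurableT_comp (@measurable_tdot n) (pair1_measurable xi)).
by move=> x; exact: trig_le.
Qed.

Let ker_bound d : 0 < d -> exists C, forall x y : T,
  `|poisson_weights d x * (F y * trig p q (tdot x y))| <= C * (wt x * wt y).
Proof.
move=> d0; have [_ [C FC]] := dF.
exists ((1 + 2 / d ^+ 2) ^+ n * (C * (`|p| + `|q|))) => x y.
rewrite normrM (ger0_norm (ltW (poisson_weights_gt0 _ _))) mulrACA.
apply: ler_pM => //; first exact/ltW/poisson_weights_gt0.
  exact: poisson_weights_le.
by rewrite normrM mulrAC ler_pM// trig_le.
Qed.

Let int_ker d : 0 < d -> (mun \x mun)%E.-integrable setT
  (EFin \o (fun z : T * T => poisson_weights d z.1 * (F z.2 * trig p q (tdot z.1 z.2)))).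
Proof.
move=> d0; have [C HC] := ker_bound d0.
apply: (@integrable_wt_pair _ C); first exact: mker.
by move=> x y; exact: HC.
Qed.

Let section1 d (x : T) : mun.-integrable setT
  (fun y => (poisson_weights d x * (F y * trig p q (tdot x y)))%:E).
Proof.
exact: (integrableZl measurableT _ (integrable_dominated (dominated_fourier_integrand x))).
Qed.

Let section2 d (y : T) : 0 < d -> mun.-integrable setT
  (fun x => (poisson_weights d x * (F y * trig p q (tdot x y)))%:E).
Proof.
move=> d0; have := integrable_dominated (dominated_poisson_trig p q y d0).
move=> /(integrableZl measurableT (F y)); apply: eq_integrable => // x _ /=.
by rewrite -EFinM mulrCA.
Qed.

Let weight_fourier d (x : T) :
  \int[mun]_y (poisson_weights d x * (F y * trig p q (tdot x y))) =
  poisson_weights d x * fourier_trig p q F x.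
Proof.
by rewrite RintegralZl//; apply: integrable_dominated; exact: dominated_fourier_integrand.
Qed.

Lemma measurable_fourier_trig : measurable_fun setT (fourier_trig p q F).
Proof.
have := integrable_section_integral1 (int_ker ltr01) (section1 1).
move/measurable_int; move/measurable_EFinP.
under eq_fun do rewrite weight_fourier.
move=> H; have -> : fourier_trig p q F = (fun x => (poisson_weights 1 x)^-1 *
   (poisson_weights 1 x * fourier_trig p q F x)).
  by apply/funext => x; rewrite mulKf// gt_eqF// poisson_weights_gt0.
apply: measurable_funM => //.
under eq_fun do rewrite -prodfV.
apply: (@measurable_prod_tuple R n (fun _ x => (poisson_weight 1 x)^-1)) => _.
apply: continuous_measurable_fun => x; apply: cvgV; first by rewrite gt_eqF ?expR_gt0.
exact: continuous_poisson_weight.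
Qed.

(** Fubini moves the transform from F to the regularizing weight. *)
Lemma fourier_regularized d : 0 < d ->
  \int[mun]_x (poisson_weights d x * fourier_trig p q F x) =
  q * \int[mun]_y (F y * \prod_(i < n) poisson_kernel d (tnth y i)).
Proof.
move=> d0; under eq_Rintegral do rewrite -weight_fourier.
rewrite -(Rintegral_prod1 (int_ker d0) (section1 d)).
rewrite (Rintegral_prod2 (int_ker d0) (fun y => section2 y d0)).
have [mF [C FC]] := dF.
have dFk : dominated (fun y => F y * \prod_(i < n) poisson_kernel d (tnth y i)).
  apply: (@dominated_mul_bounded _ _ _ ((2 / d) ^+ n)) => //.
    apply: (@measurable_prod_tuple R n (fun _ => poisson_kernel d)) => _.
    exact: measurable_poisson_kernel.
  move=> y; rewrite normr_prod -[X in _ <= _ ^+ X]card_ord -prodr_const.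
  apply: ler_prod => i _; rewrite normr_ge0 /= ger0_norm ?poisson_kernel_ge0 ?(ltW d0)//.
  have D0 : 0 < d ^+ 2 + tnth y i ^+ 2 by rewrite ltr_pwDl ?sqr_ge0// exprn_gt0.
  rewrite /poisson_kernel ler_pdivrMr// mulrDr.
  rewrite (_ : 2 / d * d ^+ 2 = 2 * d); last by field; rewrite gt_eqF.
  by rewrite lerDl mulr_ge0 ?sqr_ge0// divr_ge0// ltW.
rewrite -RintegralZl//; last exact: integrable_dominated.
apply: eq_Rintegral => y _.
transitivity (\int[mun]_x (F y * (poisson_weights d x * trig p q (tdot x y)))).
  by apply: eq_Rintegral => x _; rewrite mulrCA.
rewrite RintegralZl//; last by apply: integrable_dominated; exact: dominated_poisson_trig.
by rewrite integral_poisson_weights_trig// mulrCA.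
Qed.

Let P k (y : T) : R := \prod_(i < n) poisson_kernel (harmonic k) (tnth y i).
Let kappa k : R := \int[mu]_x (@minn1 R x * @poisson_kernel R (harmonic k) x).

Let h0 k : 0 < harmonic k :> R.
Proof. by rewrite /harmonic /= invr_gt0 ltr0n. Qed.

Let P0 k y : 0 <= P k y.
Proof. by apply: prodr_ge0 => i _; rewrite poisson_kernel_ge0// ltW. Qed.

Let mP k : measurable_fun setT (P k).
Proof.
apply: (@measurable_prod_tuple R n (fun _ => poisson_kernel (harmonic k))) => _.
exact: measurable_poisson_kernel.
Qed.

Let intP k : (\int[mun]_y (P k y)%:E = ((2 * pi) ^+ n)%:E)%E.
Proof.
rewrite (@integral_prod_tuple R n (fun _ => poisson_kernel (harmonic k)) (fun _ => 2 * pi)).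
- by rewrite prodr_const card_ord.
- by move=> _; exact: measurable_poisson_kernel.
- by move=> _ x; rewrite poisson_kernel_ge0// ltW.
- by move=> _; exact: integral_poisson_kernel.
Qed.

Let intmP k (j : 'I_n) : (\int[mun]_y (minn1 (tnth y j) * P k y)%:E =
  (kappa k * (2 * pi) ^+ n.-1)%:E)%E.
Proof.
pose K (i : nat) (x : R) := (if i == j :> nat then minn1 x else 1) * poisson_kernel (harmonic k) x.
transitivity (\int[mun]_y (\prod_(i < n) K i (tnth y i))%:E)%E.
  apply: eq_integral => y _; rewrite big_split /=; congr (_ * _)%:E.
  by rewrite (bigD1 j)//= eqxx big1 ?mulr1// => i ij; rewrite -val_eqE /= in ij; rewrite (negPf ij).
have mK i : measurable_fun setT (K i).
  apply: measurable_funM; last exact: measurable_poisson_kernel.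
  by case: (i == j :> nat) => //; exact: measurable_minn1.
rewrite (@integral_prod_tuple R n K (fun i => if i == j :> nat then kappa k else 2 * pi)) //.
- rewrite (bigD1 j)//= eqxx (eq_bigr (fun=> 2 * pi)); last first.
    by move=> i ij; rewrite -val_eqE /= in ij; rewrite (negPf ij).
  by rewrite prodr_const cardC1 card_ord.
- move=> i x; rewrite mulr_ge0// ?poisson_kernel_ge0 ?(ltW (h0 _))//.
  by case: ifP => // _; exact: minn1_ge0.
- move=> i; rewrite /K; case: ifP => _; last first.
    by under eq_integral do rewrite mul1r; exact: integral_poisson_kernel.
  rewrite /kappa /Rintegral fineK//; apply: integrable_fin_num => //.
  have iP : mu.-integrable setT (EFin \o poisson_kernel (harmonic k)).
    apply/integrableP; split.
      by apply/measurable_EFinP; exact: measurable_poisson_kernel.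
    under eq_integral do rewrite /= ger0_norm ?(poisson_kernel_ge0 _ (ltW (h0 _)))//.
    by rewrite integral_poisson_kernel// ltry.
  apply: (le_integrable _ _ _ iP) => //.
    apply/measurable_EFinP; apply: measurable_funM; first exact: measurable_minn1.
    exact: measurable_poisson_kernel.
  move=> x _; rewrite /= lee_fin normrM -[leRHS]mul1r ler_wpM2r//.
  by rewrite ger0_norm ?minn1_ge0// /minn1 ge_min lexx.
Qed.

Let finite_intP (f : T -> R) c : measurable_fun setT f -> (forall x, 0 <= f x) ->
  (\int[mun]_y (f y)%:E = c%:E)%E -> mun.-integrable setT (EFin \o f).
Proof.
move=> mf f0 fc; apply/integrableP; split.
  by apply/measurable_EFinP; exact: mf.
by under eq_integral do rewrite /= ger0_norm//; rewrite fc ltry.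
Qed.

Variables (F0 L : R).
Hypothesis FL : forall x, `|F x - F0| <= L * \sum_(j < n) minn1 (tnth x j).

Let approx_identity : (fun k => \int[mun]_y (F y * P k y)) @ \oo --> F0 * (2 * pi) ^+ n.
Proof.
have [mF _] := dF.
have L0 : 0 <= L \/ n = 0%N.
  have [n0|n0] := eqVneq n 0%N; [by right|left].
  have S1 : 0 < \sum_(j < n) minn1 (tnth [tuple (1 : R) | i < n] j).
    under eq_bigr do rewrite tnth_mktuple.
    rewrite /minn1 normr1 minxx sumr_const card_ord ltr0n lt0n//.
  by have := le_trans (normr_ge0 _) (FL [tuple (1 : R) | i < n]); rewrite pmulr_lge0.
have imP k (j : 'I_n) : mun.-integrable setT (EFin \o (fun y => minn1 (tnth y j) * P k y)).
  apply: (finite_intP _ _ (intmP k j)).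
    apply: measurable_funM => //.
    exact: (measurableT_comp measurable_minn1 (measurable_tnth j)).
  by move=> x; rewrite mulr_ge0// minn1_ge0.
have iP k := finite_intP (mP k) (P0 k) (intP k).
have iS k : mun.-integrable setT
    (EFin \o (fun y => \sum_(j < n) minn1 (tnth y j) * P k y)).
  have := @integrable_sum _ _ _ mun setT measurableT _ (index_enum 'I_n) xpredT
   (fun j y => (minn1 (tnth y j) * P k y)%:E) (fun j _ => imP k j).
  by apply: eq_integrable => // y _; rewrite /= sumEFin.
have iD k : mun.-integrable setT (EFin \o (fun y => (F y - F0) * P k y)).
  apply: (le_integrable _ _ _ (integrableZl measurableT L (iS k))) => //.
    apply/measurable_EFinP; apply: measurable_funM => //.
    exact: measurable_funB.
  move=> y _; rewrite /= lee_fin normrM (ger0_norm (P0 k y)) (le_trans _ (ler_norm _))//.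
  by rewrite -mulr_suml mulrA ler_wpM2r.
have -> : (fun k => \int[mun]_y (F y * P k y)) =
   (fun k => \int[mun]_y ((F y - F0) * P k y) + F0 * (2 * pi) ^+ n).
  apply/funext => k.
  have -> : F0 * (2 * pi) ^+ n = \int[mun]_y (F0 * P k y).
    by rewrite RintegralZl// /Rintegral intP.
  rewrite -RintegralD//; last exact: (integrableZl measurableT F0 (iP k)).
  by apply: eq_Rintegral => y _; rewrite -mulrDl subrK.
rewrite -[X in _ --> X]add0r; apply: cvgD; last exact: cvg_cst.
apply: (@cvg_norm_le0 _ _ (fun k => L * (n%:R * (kappa k * (2 * pi) ^+ n.-1)))).
  move=> k; rewrite (le_trans (le_normr_Rintegral _ (iD k)))//.
  have -> : L * (n%:R * (kappa k * (2 * pi) ^+ n.-1)) =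
    \int[mun]_y (L * (\sum_(j < n) minn1 (tnth y j) * P k y)).
    rewrite RintegralZl//; congr (_ * _).
    rewrite /Rintegral; under eq_integral do rewrite -sumEFin.
    rewrite integral_sum//; last by move=> j; exact: imP.
    under eq_bigr do rewrite intmP.
    by rewrite sumEFin sumr_const card_ord /= mulr_natl.
  apply: le_Rintegral => //.
  - exact: integrable_norm (iD k).
  - exact: (integrableZl measurableT L (iS k)).
  - move=> y _; rewrite normrM (ger0_norm (P0 k y)) -mulr_suml mulrA ler_wpM2r//.
rewrite -[X in _ --> X](mulr0 L); apply: cvgM; first exact: cvg_cst.
rewrite -[X in _ --> X](mulr0 n%:R); apply: cvgM; first exact: cvg_cst.
rewrite -[X in _ --> X](mul0r ((2 * pi) ^+ n.-1)); apply: cvgM; last exact: cvg_cst.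
exact: poisson_concentration.
Qed.

(** Two limits of the regularized integral: dominated convergence on the side of
    the transform, and concentration of the Poisson kernels at the origin on the
    other side, where F differs from its value at 0 by at most a multiple of
    the sum of the truncated coordinates. *)
Lemma fourier_inversion C : (forall xi, `|fourier_trig p q F xi| <= C * wt xi) ->
  \int[mun]_xi fourier_trig p q F xi = q * (F0 * (2 * pi) ^+ n).
Proof.
move=> FC.
have c1 : (fun k => \int[mun]_x (poisson_weights (harmonic k) x * fourier_trig p q F x))
   @ \oo --> \int[mun]_xi fourier_trig p q F xi.
  apply: (@Rdominated_cvg _ _ _ mun _ _ (fun x => C * wt x)).
  - move=> k; apply: measurable_funM; first exact: measurable_poisson_weights.
    exact: measurable_fourier_trig.
  - move=> x; rewrite -[X in _ --> X]mul1r; apply: cvgM; last exact: cvg_cst.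
    have -> : (fun k => poisson_weights (harmonic k) x) =
        (fun k => expR (- (harmonic k * \sum_(i < n) `|tnth x i|))).
      by apply/funext => k; rewrite /poisson_weights -expR_sum sumrN -mulr_sumr.
    rewrite -expR0; apply: continuous_cvg; first exact: continuous_expR.
    rewrite -[X in _ --> X]oppr0; apply: cvgN.
    rewrite -[X in _ --> X](mul0r (\sum_(i < n) `|tnth x i|)); apply: cvgM; last exact: cvg_cst.
    exact: cvg_harmonic.
  - exact: (integrableZl measurableT C (integrable_wt n)).
  - move=> k x; rewrite normrM (ger0_norm (ltW (poisson_weights_gt0 _ _))).
    rewrite -[leRHS]mul1r ler_pM//; first exact/ltW/poisson_weights_gt0.
    by rewrite poisson_weights_le1// ltW.
have c2 : (fun k => \int[mun]_x (poisson_weights (harmonic k) x * fourier_trig p q F x))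
   @ \oo --> q * (F0 * (2 * pi) ^+ n).
  under eq_fun do rewrite fourier_regularized//.
  by apply: cvgM; [exact: cvg_cst|exact: approx_identity].
exact: (cvg_unique _ c1 c2).
Qed.
End inversion.

(** Integration by parts in the j-th variable; the derivative turns the
    trigonometric polynomial (p, q) into (-q, p). *)
Lemma fourier_derivative (j : 'I_n) (p q : R) (G G' : T -> R) (xi : T) :
  dominated G -> dominated G' ->
  (forall x, continuous (fun s => G' (upd x j s))) ->
  (forall x s, is_derive s (1:R) (fun s => G (upd x j s) : R^o) (G' (upd x j s))) ->
  fourier_trig p q G' xi = - (tnth xi j * fourier_trig (- q) p G xi).
Proof.
move=> dG dG' cG' dGG'.
have d1 := dominated_fourier_integrand p q dG' xi.
have d2 := dominated_fourier_integrand (- q) p dG xi.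
apply/eqP; rewrite -addr_eq0 /fourier_trig -RintegralZl//; last exact: integrable_dominated.
rewrite -RintegralD//; [|exact: integrable_dominated|
  exact: (integrableZl measurableT _ (integrable_dominated d2))].
apply/eqP.
have [m1 [C1 H1]] := d1; have [m2 [C2 H2]] := d2.
have C10 : 0 <= C1 by have := le_trans (normr_ge0 _) (H1 [tuple 0 | i < n]); rewrite pmulr_lge0// wt_gt0.
have C20 : 0 <= C2 by have := le_trans (normr_ge0 _) (H2 [tuple 0 | i < n]); rewrite pmulr_lge0// wt_gt0.
have d3 := dominated_fourier_integrand p q dG xi.
have [m3 [C3 H3]] := d3.
have C30 : 0 <= C3 by have := le_trans (normr_ge0 _) (H3 [tuple 0 | i < n]); rewrite pmulr_lge0// wt_gt0.
have dH : dominated (fun x => G' x * trig p q (tdot xi x) +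
   tnth xi j * (G x * trig (- q) p (tdot xi x))).
  split; first by apply: measurable_funD => //; apply: measurable_funM.
  exists (C1 + `|tnth xi j| * C2) => x.
  rewrite (le_trans (ler_normD _ _))// mulrDl lerD//.
  by rewrite normrM -mulrA ler_wpM2l.
apply: (integral_coordinate0 dH (j := j)) => x.
have wu s : wt (upd x j s) <= wt1 s.
  rewrite /wt (bigD1 j)//= tnth_mktuple eqxx -[leRHS]mulr1.
  apply: ler_wpM2l; first exact/ltW/wt1_gt0.
  by apply: prodr_ile1 => i _; by rewrite ltW ?wt1_gt0//= wt1_le1.
have [_ [C4 H4]] := dH.
have C40 : 0 <= C4 by have := le_trans (normr_ge0 _) (H4 [tuple 0 | i < n]); rewrite pmulr_lge0// wt_gt0.
pose b := \sum_(i < n | i != j) tnth xi i * tnth x i.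
have tE s : tdot xi (upd x j s) = s * tnth xi j + b.
  rewrite /tdot (bigD1 j)//= tnth_mktuple eqxx mulrC; congr (_ + _).
  by apply: eq_bigr => i /negPf ij; rewrite tnth_mktuple ij.
have dd s : is_derive s (1:R)
   (fun s => G (upd x j s) * trig p q (tdot xi (upd x j s)) : R^o)
   (G' (upd x j s) * trig p q (tdot xi (upd x j s)) +
   tnth xi j * (G (upd x j s) * trig (- q) p (tdot xi (upd x j s)))).
  under eq_fun do rewrite tE; rewrite tE.
  apply: (is_derive_eq (is_derive_mul (dGG' x s) (is_derive_trig p q (tnth xi j) b s))).
  by ring.
have cc : continuous (fun s => G' (upd x j s) * trig p q (tdot xi (upd x j s)) +
   tnth xi j * (G (upd x j s) * trig (- q) p (tdot xi (upd x j s)))).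
  have ct p' q' : continuous (fun s => trig p' q' (tdot xi (upd x j s))).
    under eq_fun do rewrite tE.
    exact: (continuous_derivable (is_derive_trig p' q' (tnth xi j) b)).
  move=> s; apply: cvgD; first by apply: cvgM; [exact: cG'|exact: ct].
  apply: cvgM; first exact: cvg_cst.
  apply: cvgM; last exact: ct.
  exact: (continuous_derivable (dGG' x)).
apply: (@integral_derivative0 _ _ _ (C3 + C4) _ cc dd).
- exact: continuous_measurable_fun.
- move=> s; rewrite (le_trans (H3 _))//; apply: ler_pM => //; [exact/ltW/wt_gt0|by rewrite lerDl].
- move=> s; rewrite (le_trans (H4 _))//; apply: ler_pM => //; [exact/ltW/wt_gt0|by rewrite lerDr].
Qed.

End fourier_tuples.

(** * Fourier transforms of scaled families, and polynomial multipliers *)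

Section complex_integral.
Context {R : realType} {n : nat}.
Local Notation T := (n.-tuple (measurableTypeR R)).
Local Notation mun := (@lebesgue_measure_n R n).
Implicit Types (f g : 'rV[R]_n -> R[i]).

Definition trow (x : T) : 'rV[R]_n := \row_j tnth x j.

Definition cmeasurable f :=
  measurable_fun setT (fun x => complex.Re (f (trow x))) /\
  measurable_fun setT (fun x => complex.Im (f (trow x))).

Definition cdominated f :=
  cmeasurable f /\ exists C, forall x, cabs (f (trow x)) <= C * wt x.

Lemma cmeasurableD f g : cmeasurable f -> cmeasurable g ->
  cmeasurable (fun x => f x + g x).
Proof.
move=> [f1 f2] [g1 g2]; split.
  by under eq_fun do rewrite cReD; exact: measurable_funD.
by under eq_fun do rewrite cImD; exact: measurable_funD.
Qed.

Lemma cmeasurableM f g : cmeasurable f -> cmeasurable g ->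
  cmeasurable (fun x => f x * g x).
Proof.
move=> [f1 f2] [g1 g2]; split.
  by under eq_fun do rewrite cReM; apply: measurable_funB; exact: measurable_funM.
by under eq_fun do rewrite cImM; apply: measurable_funD; exact: measurable_funM.
Qed.

Lemma cmeasurable_cst c : cmeasurable (fun=> c).
Proof. by split; exact: measurable_cst. Qed.

Lemma cdominatedD f g : cdominated f -> cdominated g ->
  cdominated (fun x => f x + g x).
Proof.
move=> [mf [C fC]] [mg [D gD]]; split; first exact: cmeasurableD.
by exists (C + D) => x; rewrite (le_trans (cabsD _ _))// mulrDl lerD.
Qed.

Lemma cdominatedZ c f : cdominated f -> cdominated (fun x => c * f x).
Proof.
move=> [mf [C fC]]; split.
  by apply: cmeasurableM => //; exact: cmeasurable_cst.
by exists (cabs c * C) => x; rewrite cabsM -mulrA ler_wpM2l ?cabs_ge0.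
Qed.

Lemma cdominated_ReIm f : cdominated f ->
  mun.-integrable setT (EFin \o (fun x => complex.Re (f (trow x)))) /\
  mun.-integrable setT (EFin \o (fun x => complex.Im (f (trow x)))).
Proof.
move=> [[m1 m2] [C fC]]; split; apply: integrable_dominated; split => //;
  exists C => x; rewrite (le_trans _ (fC x))//.
  exact: normr_Re_le.
exact: normr_Im_le.
Qed.

Lemma cintegralD f g : cdominated f -> cdominated g ->
  cintegral (fun x => f x + g x) = cintegral f + cintegral g.
Proof.
move=> /cdominated_ReIm[f1 f2] /cdominated_ReIm[g1 g2]; rewrite /cintegral.
apply: eq_ReIm => /=.
  by under eq_Rintegral do rewrite cReD; rewrite RintegralD.
by under eq_Rintegral do rewrite cImD; rewrite RintegralD.
Qed.

Lemma cintegralZ c f : cdominated f ->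
  cintegral (fun x => c * f x) = c * cintegral f.
Proof.
move=> /cdominated_ReIm[f1 f2]; rewrite /cintegral.
have Z1 r := integrableZl measurableT r f1.
have Z2 r := integrableZl measurableT r f2.
apply: eq_ReIm; rewrite ?cReM ?cImM /=.
  under eq_Rintegral do rewrite cReM.
  rewrite RintegralB ?RintegralZl//; [exact: Z1|exact: Z2].
under eq_Rintegral do rewrite cImM.
rewrite RintegralD ?RintegralZl//; [exact: Z2|exact: Z1].
Qed.

Lemma cdominated0 : cdominated (fun=> 0).
Proof.
split; first exact: cmeasurable_cst.
by exists 0 => x; rewrite cabs0 mul0r.
Qed.

Lemma cintegral0 : cintegral (fun _ : 'rV[R]_n => 0 : R[i]) = 0.
Proof. by rewrite /cintegral; apply: eq_ReIm; rewrite /= /Rintegral integral0. Qed.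

Lemma cdominated_sum (I : Type) (r : seq I) (F : I -> 'rV[R]_n -> R[i]) :
  (forall i, cdominated (F i)) -> cdominated (fun x => \sum_(i <- r) F i x).
Proof.
move=> dF; elim: r => [|i r IH].
  by under eq_fun do rewrite big_nil; exact: cdominated0.
by under eq_fun do rewrite big_cons; exact: cdominatedD.
Qed.

Lemma cintegral_sum (I : Type) (r : seq I) (F : I -> 'rV[R]_n -> R[i]) :
  (forall i, cdominated (F i)) ->
  cintegral (fun x => \sum_(i <- r) F i x) = \sum_(i <- r) cintegral (F i).
Proof.
move=> dF; elim: r => [|i r IH].
  by under eq_fun do rewrite big_nil; rewrite big_nil cintegral0.
under eq_fun do rewrite big_cons; rewrite big_cons cintegralD ?IH//.
exact: cdominated_sum.
Qed.

Lemma cintegral_le f C : cmeasurable f ->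
  (forall x, cabs (f (trow x)) <= C * wt x) -> cabs (cintegral f) <= 2 * (C * pi ^+ n).
Proof.
move=> [m1 m2] fC; rewrite (le_trans (cabs_le_ReIm _))//= mulrDl mul1r lerD//.
  by apply: le_Rintegral_wt => // x; rewrite (le_trans _ (fC x))// normr_Re_le.
by apply: le_Rintegral_wt => // x; rewrite (le_trans _ (fC x))// normr_Im_le.
Qed.

End complex_integral.

Section towers.
Context {R : realType} {n : nat}.
Local Notation T := (n.-tuple (measurableTypeR R)).
Local Notation mun := (@lebesgue_measure_n R n).
Local Notation e_ := (delta_mx 0).

(** A smooth function together with explicit expressions for all its iterated
    partial derivatives. *)
Definition tower (G : seq 'I_n -> 'rV[R]_n -> R) :=
  forall s j x, is_derive x (e_ j : 'rV[R]_n) (G s : 'rV[R]_n -> R^o) (G (j :: s) x).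

Lemma is_derive_line (f : 'rV[R]_n -> R) (y v : 'rV[R]_n) (t df : R) :
  is_derive (y + t *: v) v (f : 'rV[R]_n -> R^o) df ->
  is_derive t (1:R) (fun s => f (y + s *: v) : R^o) df.
Proof.
have E : (fun h : R => h^-1 *: ((f (y + (h *: (1:R) + t) *: v) : R^o) - f (y + t *: v))) =
    (fun h : R => h^-1 *: ((f (h *: v + (y + t *: v)) : R^o) - f (y + t *: v))).
  apply/funext => h; congr (_ *: (f _ - _)).
  by rewrite -[h *: _]/(h * 1) mulr1 scalerDl addrCA.
by case=> d1 d2; split; rewrite /derivable /derive E.
Qed.

Lemma is_derive_of_line (f : 'rV[R]_n -> R) (x v : 'rV[R]_n) (df : R) :
  is_derive (0:R) (1:R) (fun s => f (x + s *: v) : R^o) df ->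
  is_derive x v (f : 'rV[R]_n -> R^o) df.
Proof.
have E : (fun h : R => h^-1 *: ((f (x + (h *: (1:R) + 0) *: v) : R^o) - f (x + 0 *: v))) =
    (fun h : R => h^-1 *: ((f (h *: v + x) : R^o) - f x)).
  apply/funext => h; congr (_ *: (f _ - f _)).
    by rewrite -[h *: _]/(h * 1) mulr1 addr0 addrC.
  by rewrite scale0r addr0.
by case=> d1 d2; split; rewrite /derivable /derive -E.
Qed.

Lemma is_derive_comp1 (h f : R -> R) (F : 'rV[R]_n -> R) (x v : 'rV[R]_n) (dF : R) :
  (forall s, is_derive s (1:R) (h : R -> R^o) (f s)) ->
  is_derive x v (F : 'rV[R]_n -> R^o) dF ->
  is_derive x v ((fun y => h (F y)) : 'rV[R]_n -> R^o) (f (F x) * dF).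
Proof.
move=> dh dF1; apply: is_derive_of_line.
have d0 : is_derive (0:R) (1:R) (fun s => F (x + s *: v) : R^o) dF.
  by apply: is_derive_line; rewrite scale0r addr0.
have := is_derive1_comp (f := h) (dh _) d0.
by rewrite scale0r addr0.
Qed.

Lemma trow_upd (x : T) j s : trow (upd x j s) = trow x + (s - tnth x j) *: e_ j.
Proof.
apply/rowP => k; rewrite !mxE tnth_mktuple eqxx /= eq_sym.
by have [->|jk] := eqVneq k j; rewrite ?mulr1 ?mulr0 ?addr0// addrC subrK.
Qed.

Lemma tower_line G (x : T) j s t : tower G ->
  is_derive t (1:R) (fun t => G s (trow (upd x j t)) : R^o) (G (j :: s) (trow (upd x j t))).
Proof.
move=> tG; pose y := trow x - tnth x j *: e_ j.
have E t' : trow (upd x j t') = y + t' *: e_ j.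
  by rewrite trow_upd /y scalerBl addrAC addrA.
under eq_fun do rewrite E; rewrite E.
by apply: is_derive_line; exact: tG.
Qed.

Lemma trow_dot (x y : T) : dot (trow x) (trow y) = tdot x y.
Proof. by apply: eq_bigr => i _; rewrite !mxE. Qed.

(** The transform inside [fourier_inv], without its prefactor. *)
Definition fhat (F : 'rV[R]_n -> R) (xi : 'rV[R]_n) : R[i] :=
  cintegral (fun x => (F x)%:C * cexp (0 -i* dot x xi)).

Lemma cexp_imag s : cexp (0 -i* s) = cos s -i* sin s :> R[i].
Proof. by apply: eq_ReIm; rewrite ?Re_cexp ?Im_cexp /= expR0 mul1r ?cosN ?sinN. Qed.

Lemma fhatE (F : 'rV[R]_n -> R) (xi : T) :
  fhat F (trow xi) = fourier_trig 0 1 (F \o trow) xi +i*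
                     fourier_trig (-1) 0 (F \o trow) xi.
Proof.
rewrite /fhat /fourier_trig /cintegral; congr (_ +i* _); apply: eq_Rintegral => x _;
  rewrite cexp_imag ?cReM ?cImM /= trow_dot tdotC /trig /=; ring.
Qed.

Lemma fhat_derivative G s j (xi : T) : tower G ->
  (forall s, dominated (G s \o trow)) ->
  - 'i%C * (tnth xi j)%:C * fhat (G s) (trow xi) = - fhat (G (j :: s)) (trow xi).
Proof.
move=> tG dG.
have H p q : fourier_trig p q (G (j :: s) \o trow) xi =
    - (tnth xi j * fourier_trig (- q) p (G s \o trow) xi).
  apply: fourier_derivative => // x.
  - exact: (continuous_derivable (fun t => tower_line x j (j :: s) t tG)).
  - by move=> t; exact: tower_line.
have N : fourier_trig 0 (-1) (G s \o trow) xi = - fourier_trig 0 1 (G s \o trow) xi.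
  rewrite -[RHS]mulN1r /fourier_trig -RintegralZl//.
    by apply: eq_Rintegral => x _; rewrite /trig; ring.
  by apply: integrable_dominated; exact: dominated_fourier_integrand.
rewrite !fhatE !H oppr0 N.
by apply: eq_ReIm; rewrite !(cReM, cImM, cReN, cImN) /=; ring.
Qed.

(** Under the transform a monomial in the frequencies becomes an iterated
    derivative; this is how the multiplier turns into a differential operator
    and how powers of the frequencies are paid for. *)
Lemma fhat_derivatives G s s' (xi : T) : tower G ->
  (forall s, dominated (G s \o trow)) ->
  (\prod_(j <- s) (- 'i%C * (tnth xi j)%:C)) * fhat (G s') (trow xi) =
  (-1) ^+ size s * fhat (G (s ++ s')) (trow xi).
Proof.
move=> tG dG; elim: s => [|j s IH]; first by rewrite /= big_nil expr0 !mul1r.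
rewrite big_cons -mulrA IH /= exprS mulrCA fhat_derivative// mulrN.
by rewrite mulN1r mulNr.
Qed.

Lemma cmeasurable_fhat (F : 'rV[R]_n -> R) : dominated (F \o trow) ->
  cmeasurable (fhat F).
Proof.
move=> dF; split; under eq_fun do rewrite fhatE /=; exact: measurable_fourier_trig.
Qed.

Lemma fhat_le (F : 'rV[R]_n -> R) C (xi : T) :
  measurable_fun setT (F \o trow) -> (forall x : T, `|F (trow x)| <= C * wt x) ->
  cabs (fhat F (trow xi)) <= 2 * (C * pi ^+ n).
Proof.
move=> mF FC.
have dF : dominated (F \o trow) by split => //; exists C.
rewrite fhatE (le_trans (cabs_le_ReIm _))//= mulrDl mul1r; apply: lerD.
  have [mf _] := dominated_fourier_integrand 0 1 dF xi.
  apply: le_Rintegral_wt => // x; rewrite normrM -[leRHS]mulr1 ler_pM//.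
    exact: FC.
  by rewrite (le_trans (trig_le _ _ _))// normr0 normr1 add0r.
have [mf _] := dominated_fourier_integrand (-1) 0 dF xi.
apply: le_Rintegral_wt => // x; rewrite normrM -[leRHS]mulr1 ler_pM//.
  exact: FC.
by rewrite (le_trans (trig_le _ _ _))// normr0 normrN1 addr0.
Qed.


(** Only one coordinate moves at each step of the telescoping sum, so bounds on
    the partial derivatives suffice. *)
Lemma tower_lipschitz G s M (x : T) : tower G ->
  (forall y : T, `|G s (trow y)| <= M) ->
  (forall j (y : T), `|G (j :: s) (trow y)| <= M) ->
  `|G s (trow x) - G s 0| <= 2 * M * \sum_(j < n) minn1 (tnth x j).
Proof.
move=> tG GM dGM.
pose y k : T := [tuple if (i < k)%N then tnth x i else 0 | i < n].
have y0 : trow (y 0%N) = 0 by apply/rowP => i; rewrite !mxE tnth_mktuple.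
have yn : trow (y n) = trow x by apply/rowP => i; rewrite !mxE tnth_mktuple ltn_ord.
rewrite -yn -y0 -(telescope_sumr (fun k => G s (trow (y k)))) // big_mkord.
rewrite mulr_sumr (le_trans (ler_norm_sum _ _ _))//; apply: ler_sum => j _.
have yE : y j.+1 = upd (y j) j (tnth x j).
  apply: eq_from_tnth => i; rewrite !tnth_mktuple ltnS leq_eqVlt.
  by have [->|ij] := eqVneq i j; rewrite ?eqxx// (negPf (_ : (i : nat) != j)).
have yE0 : y j = upd (y j) j 0.
  apply: eq_from_tnth => i; rewrite !tnth_mktuple.
  by have [->|ij] := eqVneq i j; rewrite ?ltnn.
have M0 : 0 <= M := le_trans (normr_ge0 _) (GM x).
rewrite /minn1; have [x1|x1] := leP 1 `|tnth x j|.
  by rewrite mulr1 (le_trans (ler_normB _ _))// mulrDl mul1r lerD.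
have dh t := tower_line (y j) j s t tG.
have hc a b : {within `[a, b], continuous (fun t => G s (trow (upd (y j) j t)))}.
  exact: (continuous_subspaceT (continuous_derivable dh)).
have mv a b : a <= b -> `|G s (trow (upd (y j) j b)) - G s (trow (upd (y j) j a))| <=
    M * `|b - a|.
  move=> ab; have [c _ ->] := @MVT_segment R _ _ a b ab (fun t _ => dh t) (@hc a b).
  by rewrite normrM ler_wpM2r.
rewrite yE {2}yE0; apply: (@le_trans _ _ (M * `|tnth x j|)); last first.
  by rewrite ler_wpM2r// ler_peMl// ler1n.
have [t0|t0] := leP 0 (tnth x j).
  by have := mv _ _ t0; rewrite subr0.
by have := mv _ _ (ltW t0); rewrite distrC sub0r normrN.
Qed.

(** The reciprocal of the integrable weight measures polynomial growth in the
    frequency: a factor [bw xi] more than needed makes a bound integrable. *)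
Definition bw (xi : T) : R := \prod_(j < n) (1 + tnth xi j ^+ 2).

Lemma bw_wt xi : bw xi * wt xi = 1.
Proof.
rewrite /bw /wt -big_split big1//= => i _.
by rewrite /wt1 mulfV// gt_eqF// onesq_gt0.
Qed.

Lemma bw_ge1 xi : 1 <= bw xi.
Proof.
rewrite /bw; elim/big_rec: _ => // i x _ x1.
by rewrite (le_trans x1)// ler_peMl ?(le_trans ler01)// lerDl sqr_ge0.
Qed.

Lemma fhat_inversion G s C : tower G -> (forall s, dominated (G s \o trow)) ->
  (forall xi : T, cabs (fhat (G s) (trow xi)) <= C * wt xi) ->
  cintegral (fhat (G s)) = (G s 0 * (2 * pi) ^+ n)%:C.
Proof.
move=> tG dG FC.
have bd s' : exists M, forall y : T, `|G s' (trow y)| <= M.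
  have [_ [D H]] := dG s'; exists `|D| => y; rewrite (le_trans (H y))//.
  rewrite (le_trans (ler_norm _))// normrM -[leRHS]mulr1 ler_wpM2l//.
  rewrite gtr0_norm ?wt_gt0//; apply: prodr_ile1 => i _.
  by rewrite ltW ?wt1_gt0//= wt1_le1.
have [M0 HM0] := bd s.
have [M HM] : exists M, forall j (y : T), `|G (j :: s) (trow y)| <= M.
  have /choice[f Hf] : forall j, exists M, forall y : T, `|G (j :: s) (trow y)| <= M.
    by move=> j; exact: bd.
  exists (\sum_j `|f j|) => j y; rewrite (le_trans (Hf j y))//.
  rewrite (le_trans (ler_norm _))// (bigD1 j)//= lerDl sumr_ge0//.
have h0 : M0 <= Num.max M0 M by rewrite le_max lexx.
have h1 : M <= Num.max M0 M by rewrite le_max lexx orbT.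
have L x := @tower_lipschitz G s (Num.max M0 M) x tG
  (fun y => le_trans (HM0 y) h0) (fun j y => le_trans (HM j y) h1).
have I p q : (forall xi, `|fourier_trig p q (G s \o trow) xi| <= C * wt xi) ->
    \int[mun]_xi fourier_trig p q (G s \o trow) xi = q * (G s 0 * (2 * pi) ^+ n).
  exact: (fourier_inversion (dG s) L).
rewrite /cintegral; apply: eq_ReIm => /=.
  rewrite (@eq_Rintegral _ _ _ _ _ (fourier_trig 0 1 (G s \o trow))); last first.
    by move=> x _; exact: (congr1 (@complex.Re R) (fhatE (G s) x)).
  rewrite I ?mul1r// => xi; rewrite (le_trans _ (FC xi))// fhatE.
  by have := normr_Re_le (fourier_trig 0 1 (G s \o trow) xi +i* fourier_trig (-1) 0 (G s \o trow) xi).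
rewrite (@eq_Rintegral _ _ _ _ _ (fourier_trig (-1) 0 (G s \o trow))); last first.
  by move=> x _; exact: (congr1 (@complex.Im R) (fhatE (G s) x)).
rewrite I ?mul0r// => xi; rewrite (le_trans _ (FC xi))// fhatE.
by have := normr_Im_le (fourier_trig 0 1 (G s \o trow) xi +i* fourier_trig (-1) 0 (G s \o trow) xi).
Qed.

End towers.

Section scaled_family.
Context {R : realType} {n : nat}.
Local Notation T := (n.-tuple (measurableTypeR R)).
Local Notation mun := (@lebesgue_measure_n R n).

(** [A] absorbs the powers of [eps] that are lost when the weight at the scale
    [eps] is replaced by the weight at scale one. *)
Variables (G : R -> seq 'I_n -> 'rV[R]_n -> R) (A : R -> R).
Hypothesis tG : forall eps, 0 < eps <= 1 -> tower (G eps).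
Hypothesis mG : forall eps s, 0 < eps <= 1 -> measurable_fun setT (G eps s \o trow).
Hypothesis A0 : forall eps, 0 < eps <= 1 -> 0 <= A eps.
Hypothesis GB : forall s, exists C, forall eps (x : T), 0 < eps <= 1 ->
  `|G eps s (trow x)| <= C * eps ^+ size s * A eps * wt x.

Lemma dominated_family eps s : 0 < eps <= 1 -> dominated (G eps s \o trow).
Proof.
move=> e01; split; first exact: mG.
by have [C H] := GB s; eexists => x; exact: H.
Qed.

(** Each factor 1 + xi_j^2 costs two derivatives, which only improves the power
    of [eps]. *)
Lemma fhat_decay (l s : seq 'I_n) : exists2 C, 0 <= C & forall eps (xi : T),
  0 < eps <= 1 -> (\prod_(j <- l) (1 + tnth xi j ^+ 2)) * cabs (fhat (G eps s) (trow xi)) <=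
  C * (eps ^+ size s * A eps).
Proof.
elim: l s => [|j l IH] s.
  have [C H] := GB s; exists (2 * (`|C| * pi ^+ n)).
    by rewrite !mulr_ge0// exprn_ge0// pi_ge0.
  move=> eps xi e01; rewrite big_nil mul1r.
  have [e0 e1] := andP e01.
  have -> : 2 * (`|C| * pi ^+ n) * (eps ^+ size s * A eps) =
     2 * (`|C| * eps ^+ size s * A eps * pi ^+ n) by ring.
  apply: fhat_le; first exact: mG.
  move=> x; rewrite (le_trans (H eps x e01))// !ler_wpM2r ?ler_norm//.
  - exact/ltW/wt_gt0.
  - exact: A0.
  - by rewrite exprn_ge0// ltW.
have [C C0 HC] := IH s; have [D D0 HD] := IH [:: j, j & s].
exists (C + D); first exact: addr_ge0.
move=> eps xi e01; rewrite big_cons mulrDl mul1r !mulrDl lerD//; first exact: HC.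
have tGe := tG e01; have dGe s' := dominated_family s' e01.
have -> : tnth xi j ^+ 2 * \prod_(j0 <- l) (1 + tnth xi j0 ^+ 2) * cabs (fhat (G eps s) (trow xi))
  = (\prod_(j0 <- l) (1 + tnth xi j0 ^+ 2)) * cabs (fhat (G eps [:: j, j & s]) (trow xi)).
  have := congr1 cabs (@fhat_derivatives _ _ _ [:: j; j] s xi tGe dGe).
  have ci : cabs ('i%C : R[i]) = 1 by rewrite cabsE /= expr0n add0r expr1n sqrtr1.
  rewrite !big_cons big_nil mulr1 [size _]/= sqrrN expr1n mul1r.
  rewrite !cabsM !cabsN ci cabs_real !mul1r -expr2 real_normK ?num_real// /= => <-.
  by ring.
rewrite (le_trans (HD eps xi e01))// ler_wpM2l// ler_wpM2r ?A0// /=.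
have [e0 e1] := andP e01.
by apply: ler_wiXn2l => //; [exact: ltW|exact: leqW (leqnSn _)].
Qed.

Lemma fhat_decay_bw s k : exists2 C, 0 <= C & forall eps (xi : T),
  0 < eps <= 1 -> bw xi ^+ k * cabs (fhat (G eps s) (trow xi)) <=
  C * (eps ^+ size s * A eps).
Proof.
have [C C0 HC] := fhat_decay (flatten (nseq k (enum 'I_n))) s; exists C => // eps xi e01.
rewrite (le_trans _ (HC eps xi e01))// le_eqVlt; apply/orP; left; apply/eqP.
congr (_ * _); elim: k {C C0 HC} => [|k IH]; first by rewrite big_nil expr0.
by rewrite /= big_cat /= -IH exprS big_enum.
Qed.

(** The symbol of the operator with constant coefficients given by the list:
    an entry (c, s) stands for c times the iterated derivative along s. *)
Definition op_poly (tau : seq (R[i] * seq 'I_n)) (xi : 'rV[R]_n) : R[i] :=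
  \sum_(cs <- tau) cs.1 * \prod_(j <- cs.2) (- 'i%C * (xi 0 j)%:C).

(** The transform of [G eps] lives at frequencies of order [eps]: a factor
    xi_j ^ K is worth K derivatives, hence [eps ^+ K]. So the multiplier [u] may
    be replaced by a polynomial that agrees with it to order [K] at the origin,
    and for a polynomial the integral is computed by Fourier inversion. *)
Lemma multiplier_estimate (u : 'rV[R]_n -> R[i]) tau (K M : nat) C :
  cmeasurable u -> 0 <= C ->
  (forall xi : T, cabs (u (trow xi) - op_poly tau (trow xi)) <=
     C * (\sum_(j < n) `|tnth xi j| ^+ K) * bw xi ^+ M) ->
  exists C', forall eps, 0 < eps <= 1 ->
    cabs (cintegral (fun xi => u xi * fourier_inv (fun x => (G eps [::] x)%:C) xi) -
      \sum_(cs <- tau) cs.1 * ((-1) ^+ size cs.2 * (G eps cs.2 0)%:C)) <=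
    C' * (eps ^+ K * A eps).
Proof.
move=> mu_ C0 uC.
pose pn : R[i] := ((2 * pi) ^- n)%:C.
have dhat s eps : 0 < eps <= 1 -> cdominated (fhat (G eps s)) /\
    cintegral (fhat (G eps s)) = (G eps s 0 * (2 * pi) ^+ n)%:C.
  move=> e01; have [D D0 HD] := fhat_decay_bw s 1.
  have B (xi : T) : cabs (fhat (G eps s) (trow xi)) <= D * (eps ^+ size s * A eps) * wt xi.
    have := HD eps xi e01; rewrite expr1 => H.
    rewrite -[leLHS]mul1r -(bw_wt xi) mulrAC ler_wpM2r//.
    exact/ltW/wt_gt0.
  have dGe s' := dominated_family s' e01.
  split; first by split; [exact: cmeasurable_fhat|eexists; exact: B].
  exact: (fhat_inversion (tG e01) dGe B).
have /choice[D HD] : forall j : 'I_n, exists D, 0 <= D /\ forall eps (xi : T),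
  0 < eps <= 1 -> bw xi ^+ M.+1 * cabs (fhat (G eps (nseq K j)) (trow xi)) <=
  D * (eps ^+ K * A eps).
  move=> j; have [D D0 H] := fhat_decay_bw (nseq K j) M.+1.
  by exists D; split => // eps xi e01; have := H eps xi e01; rewrite size_nseq.
exists (cabs pn * (2 * (C * (\sum_j D j) * pi ^+ n))) => eps e01.
have tGe := tG e01; have dGe s' := dominated_family s' e01.
have fE : (fun xi => u xi * fourier_inv (fun x => (G eps [::] x)%:C) xi) =
   (fun xi => pn * ((u xi - op_poly tau xi) * fhat (G eps [::]) xi +
     op_poly tau xi * fhat (G eps [::]) xi)).
  by apply/funext => xi; rewrite -mulrDl subrK /fourier_inv -/(fhat _ _) -/pn mulrCA.
have opE (xi : T) : op_poly tau (trow xi) * fhat (G eps [::]) (trow xi) =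
  \sum_(cs <- tau) cs.1 * (-1) ^+ size cs.2 * fhat (G eps cs.2) (trow xi).
  rewrite /op_poly mulr_suml; apply: eq_bigr => -[c s] _ /=.
  rewrite -mulrA; under eq_bigr do rewrite mxE.
  by rewrite (fhat_derivatives s [::] xi tGe dGe) cats0 mulrA.
have mE f g : (forall xi : T, f (trow xi) = g (trow xi)) -> f = g.
  move=> fg; apply/funext => x.
  suff -> : x = trow [tuple x 0 i | i < n] by exact: fg.
  by apply/rowP => i; rewrite !mxE tnth_mktuple.
pose f2 xi := \sum_(cs <- tau) cs.1 * (-1) ^+ size cs.2 * fhat (G eps cs.2) xi.
have op2 : (fun xi => op_poly tau xi * fhat (G eps [::]) xi) = f2 by exact: mE.
pose f1 xi := (u xi - op_poly tau xi) * fhat (G eps [::]) xi.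
have d2 : cdominated f2.
  by apply: cdominated_sum => -[c s]; apply: cdominatedZ; case: (dhat s eps e01).
(* one factor bw is given up for integrability, M factors for the growth of u *)
have B1 (xi : T) : cabs (f1 (trow xi)) <= C * (\sum_j D j) * (eps ^+ K * A eps) * wt xi.
  rewrite -[leLHS]mul1r -(bw_wt xi) mulrAC ler_wpM2r//; first exact/ltW/wt_gt0.
  rewrite /f1 cabsM.
  apply: (@le_trans _ _ (bw xi * (C * (\sum_(j < n) `|tnth xi j| ^+ K) * bw xi ^+ M *
     cabs (fhat (G eps [::]) (trow xi))))).
    rewrite ler_wpM2l ?(le_trans ler01 (bw_ge1 xi))//.
    by rewrite ler_wpM2r ?cabs_ge0//; exact: uC.
  have -> : bw xi * (C * (\sum_(j < n) `|tnth xi j| ^+ K) * bw xi ^+ M *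
     cabs (fhat (G eps [::]) (trow xi))) =
     C * \sum_(j < n) bw xi ^+ M.+1 * cabs (fhat (G eps (nseq K j)) (trow xi)).
    transitivity (C * ((\sum_(j < n) `|tnth xi j| ^+ K) *
      (bw xi ^+ M.+1 * cabs (fhat (G eps [::]) (trow xi))))).
      by rewrite exprS; ring.
    congr (C * _); rewrite mulr_suml; apply: eq_bigr => j _.
    have := congr1 cabs (@fhat_derivatives _ _ _ (nseq K j) [::] xi tGe dGe).
    rewrite big_nseq iter_mulr_1 !cabsM !cabsX cats0 !cabsM !cabsN cabs1 expr1n mul1r => <-.
    have ci : cabs ('i%C : R[i]) = 1 by rewrite cabsE /= expr0n add0r expr1n sqrtr1.
    by rewrite ci mul1r cabs_real mulrCA.
  rewrite -!mulrA ler_wpM2l// mulr_suml; apply: ler_sum => j _.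
  by have [_ H] := HD j; exact: H.
have m1 : cmeasurable f1.
  have -> : f1 = (fun xi => u xi * fhat (G eps [::]) xi + (-1) * f2 xi).
    by rewrite -op2; apply/funext => xi; rewrite /f1 mulrBl mulN1r.
  apply: cmeasurableD.
    by apply: cmeasurableM => //; exact: cmeasurable_fhat.
  by apply: cmeasurableM; [exact: cmeasurable_cst|case: d2].
have d1 : cdominated f1 by split => //; eexists; exact: B1.
have -> : cintegral (fun xi => u xi * fourier_inv (fun x => (G eps [::] x)%:C) xi) =
    pn * (cintegral f1 + cintegral f2).
  rewrite fE -cintegralD// -cintegralZ; last exact: cdominatedD.
  by congr cintegral; apply/funext => xi; rewrite -op2.
have -> : cintegral f2 =
    \sum_(cs <- tau) cs.1 * ((-1) ^+ size cs.2 * (G eps cs.2 0 * (2 * pi) ^+ n)%:C).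
  rewrite cintegral_sum; last first.
    by move=> -[c s]; apply: cdominatedZ; case: (dhat s eps e01).
  apply: eq_bigr => -[c s] _ /=.
  by rewrite cintegralZ ?(dhat s eps e01).2 -?mulrA//; case: (dhat s eps e01).
rewrite mulrDr mulr_sumr.
have -> : \sum_(cs <- tau) pn * (cs.1 * ((-1) ^+ size cs.2 * (G eps cs.2 0 * (2 * pi) ^+ n)%:C))
    = \sum_(cs <- tau) cs.1 * ((-1) ^+ size cs.2 * (G eps cs.2 0)%:C).
  apply: eq_bigr => -[c s] _ /=; rewrite mulrCA; congr (_ * _).
  rewrite mulrCA; congr (_ * _); rewrite /pn -rmorphM /=; congr (_%:C).
  by rewrite mulrCA mulVf ?mulr1// expf_neq0// mulf_neq0 ?pnatr_eq0// gt_eqF// pi_gt0.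
rewrite addrK cabsM -[leRHS]mulrA; apply: ler_wpM2l; first exact: cabs_ge0.
rewrite (le_trans (cintegral_le m1 B1))//.
by rewrite le_eqVlt; apply/orP; left; apply/eqP; ring.
Qed.

End scaled_family.

(** * Coercivity of the potential *)

Lemma continuous_mulr (R : realType) (V : topologicalType) (f g : V -> R) :
  continuous f -> continuous g -> continuous (fun x => f x * g x).
Proof. by move=> cf cg x; apply: cvgM; [exact: cf|exact: cg]. Qed.

Lemma continuous_addr (R : realType) (V : topologicalType) (f g : V -> R) :
  continuous f -> continuous g -> continuous (fun x => f x + g x).
Proof. by move=> cf cg x; apply: cvgD; [exact: cf|exact: cg]. Qed.

Section coercivity.
Context {R : realType} {n : nat}.
Local Notation T := (n.-tuple (measurableTypeR R)).

Lemma norm_coord_le (x : 'rV[R]_n) j : `|x 0 j| <= `|x|.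
Proof.
rewrite [leRHS]/Num.Def.normr /= mx_normrE.
exact: (le_bigmax 0 (fun ij : 'I_1 * 'I_n => `|x ij.1 ij.2|) (0, j)).
Qed.

Variable lam : forall p : nat, p.-tuple 'I_n -> R.
Arguments lam : clear implicits.

Lemma tensor_formZ p (a : R) (x : 'rV[R]_n) :
  tensor_form lam p (a *: x) = a ^+ p * tensor_form lam p x.
Proof.
rewrite /tensor_form mulr_sumr; apply: eq_bigr => X _.
under eq_bigr do rewrite mxE.
by rewrite big_split /= prodr_const card_ord mulrCA.
Qed.

Lemma tensor_form_le p : exists2 L, 0 <= L & forall x : 'rV[R]_n,
  `|tensor_form lam p x| <= L * `|x| ^+ p.
Proof.
exists (\sum_(X : p.-tuple 'I_n) `|lam p X|); first by rewrite sumr_ge0.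
move=> x; rewrite (le_trans (ler_norm_sum _ _ _))// mulr_suml ler_sum// => X _.
rewrite normrM ler_wpM2l// normr_prod -[X in _ ^+ X]card_ord -prodr_const.
by apply: ler_prod => i _; rewrite normr_ge0 norm_coord_le.
Qed.

Lemma continuous_tensor_form p : continuous (tensor_form lam p).
Proof.
have cprod (s : seq 'I_n) : continuous (fun x : 'rV[R]_n => \prod_(j <- s) x 0 j).
  elim: s => [|j s IH]; first by under eq_fun do rewrite big_nil; exact: cst_continuous.
  under eq_fun do rewrite big_cons.
  by apply: continuous_mulr => //; exact: coord_continuous.
have cX X : continuous (fun x : 'rV[R]_n => lam p X * \prod_(i < p) x 0 (tnth X i)).
  apply: continuous_mulr; first exact: cst_continuous.
  have := cprod X; under eq_fun do rewrite big_tuple; exact.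
rewrite /tensor_form; elim: (index_enum _) => [|X s IH].
  by under eq_fun do rewrite big_nil; exact: cst_continuous.
under eq_fun do rewrite big_cons.
by apply: continuous_addr => //; exact: cX.
Qed.

(** Homogeneity and compactness of the unit sphere. *)
Lemma tensor_form_coercive p : (0 < n)%N ->
  (forall x : 'rV[R]_n, x != 0 -> 0 < tensor_form lam p x) ->
  exists2 c, 0 < c & forall x : 'rV[R]_n, c * `|x| ^+ p <= tensor_form lam p x.
Proof.
move=> n0 pos; pose S := [set x : 'rV[R]_n | `|x| = 1].
have S0 : S !=set0.
  have x0 : (const_mx 1 : 'rV[R]_n) != 0.
    by apply/eqP => /rowP/(_ (Ordinal n0)); rewrite !mxE => /eqP; rewrite oner_eq0.
  exists (`|const_mx 1 : 'rV[R]_n|^-1 *: const_mx 1); rewrite /S /= normrZ.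
  by rewrite ger0_norm ?invr_ge0// mulVf// normr_eq0.
have cS : compact S.
  apply: bounded_closed_compact.
    by exists 1; split => // M M1 x /= ->; exact: ltW.
  have -> : S = (fun x : 'rV[R]_n => `|x|) @^-1` [set 1] by [].
  by apply: closed_comp => // x _; exact: norm_continuous.
have [x0 x0S x0m] := EVT_min_rV S0 cS (continuous_subspaceT (@continuous_tensor_form p)).
have x01 : `|x0| = 1 by move: x0S; rewrite inE.
exists (tensor_form lam p x0).
  by apply: pos; rewrite -normr_eq0 x01 oner_eq0.
move=> x; have [->|x_neq0] := eqVneq x 0.
  case: p pos x0m {cS} => [|p] pos x0m.
    rewrite expr0 mulr1; have := x0m x0 x0S.
    by rewrite /tensor_form; under eq_bigr do rewrite big_ord0; under [X in _ -> _ <= X]eq_bigr do rewrite big_ord0.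
  rewrite normr0 expr0n mulr0 -(scale0r (0 : 'rV[R]_n)) tensor_formZ expr0n mul0r//.
have nx : `|x| != 0 by rewrite normr_eq0.
have -> : tensor_form lam p x = `|x| ^+ p * tensor_form lam p (`|x|^-1 *: x).
  by rewrite -tensor_formZ scalerA mulfV// scale1r.
rewrite mulrC ler_wpM2l ?exprn_ge0//; apply: x0m.
by rewrite inE /S /= normrZ ger0_norm ?invr_ge0// mulVf.
Qed.

(** The leading power beats the lower ones, with room for a linear term. *)
Lemma leading_power_dominates p (c D : R) : (1 < p)%N -> 0 < c -> 0 <= D ->
  exists E, forall r, 0 <= r -> r - E <= c * r ^+ p - D * (1 + r) ^+ p.-1.
Proof.
move=> p1 c0 D0; pose r0 := Num.max 1 ((D * 2 ^+ p.-1 + 1) / c).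
exists (r0 + D * (1 + r0) ^+ p.-1) => r r_ge0.
have r01 : 1 <= r0 by rewrite /r0 le_max lexx.
have [rr|rr] := leP r0 r; last first.
  have h1 : D * (1 + r) ^+ p.-1 <= D * (1 + r0) ^+ p.-1.
    by rewrite ler_wpM2l// lerXn2r ?nnegrE ?addr_ge0// ?(le_trans ler01)// lerD2l ltW.
  have h2 : 0 <= c * r ^+ p by rewrite mulr_ge0 ?exprn_ge0// ltW.
  by move: h1 h2; lra.
have r1 : 1 <= r by exact: le_trans r01 rr.
have h0 : 0 <= D * (1 + r0) ^+ p.-1 by rewrite mulr_ge0// exprn_ge0// addr_ge0// (le_trans ler01).
have h1 : D * (1 + r) ^+ p.-1 <= D * (2 ^+ p.-1 * r ^+ p.-1).
  rewrite ler_wpM2l// -exprMn lerXn2r ?nnegrE ?addr_ge0 ?mulr_ge0//; lra.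
have h2 : D * 2 ^+ p.-1 + 1 <= c * r.
  by rewrite [leRHS]mulrC -ler_pdivrMr// (le_trans _ rr)// /r0 le_max lexx orbT.
have h3 : r <= r ^+ p.-1.
  by rewrite -{1}(expr1 r) ler_weXn2l// -ltnS prednK// ltnW.
have h4 : c * r ^+ p = r ^+ p.-1 * (c * r).
  by rewrite -{1}(prednK (ltnW p1)) exprS; ring.
have h5 : r ^+ p.-1 * (D * 2 ^+ p.-1 + 1) <= r ^+ p.-1 * (c * r).
  by rewrite ler_wpM2l// exprn_ge0.
by rewrite h4; move: h1 h3 h5 h0 r01; rewrite mulrDr mulr1; nra.
Qed.

Lemma expr_le_fact_expR k (y : R) : 0 <= y -> y ^+ k <= k`!%:R * expR y.
Proof.
move=> y0; case: k => [|k].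
  by rewrite expr0 mul1r -expR0 ler_expR.
have := @expR_ge1Dxn R y k y0 => H.
have f0 : 0 < (k.+1`!)%:R :> R by rewrite ltr0n fact_gt0.
rewrite -[leLHS](mulfVK (lt0r_neq0 f0)) mulrC (ler_wpM2l (ltW f0))//.
by rewrite (le_trans _ H)// lerDr.
Qed.

Variable pbar : nat.

(** With z = eps (phi - x), the leading part of eps ^ pbar V(phi - x) is the leading
    form at z, and the lower ones carry spare powers of eps <= 1. Hence the
    exponent is at least |z| - E uniformly in eps, and the exponential decay
    in |z| beats any polynomial in eps x. *)
Lemma scaled_potential_le k : (0 < n)%N -> (1 < pbar)%N ->
  (forall x : 'rV[R]_n, x != 0 -> 0 < tensor_form lam pbar x) ->
  forall phi : 'rV[R]_n, exists2 C, 0 <= C & forall eps (x : T), 0 < eps <= 1 ->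
  (\prod_(j < n) (1 + (eps * tnth x j) ^+ 2)) ^+ k *
    expR (- (eps ^+ pbar * potential pbar lam (phi - trow x))) <= C.
Proof.
move=> n0 p1 pos phi.
have [c c0 Hc] := tensor_form_coercive n0 pos.
have /choice[L HL] : forall q : nat, exists L, 0 <= L /\ forall x : 'rV[R]_n,
    `|tensor_form lam q x| <= L * `|x| ^+ q.
  by move=> q; have [L L0 H] := tensor_form_le q; exists L.
pose D := \sum_(q < pbar) L q.
have D0 : 0 <= D by rewrite sumr_ge0// => q _; case: (HL q).
have [E HE] := leading_power_dominates p1 c0 D0.
(* m is the degree of the polynomial factor *)
pose a := `|phi|; pose m := (2 * (n * k))%N.
exists (m`!%:R * expR (1 + a + E)); first by rewrite mulr_ge0// expR_ge0.
move=> eps x /andP[e0 e1]; pose z := eps *: (phi - trow x); pose r := `|z|.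
have r0 : 0 <= r by exact: normr_ge0.
have a0 : 0 <= a by exact: normr_ge0.
have hV : r - E <= eps ^+ pbar * potential pbar lam (phi - trow x).
  rewrite (le_trans (HE r r0))//.
  rewrite /potential big_ord_recr /= mulrDr -tensor_formZ -/z addrC lerD ?Hc//.
  rewrite mulr_sumr lerNl -sumrN mulr_suml ler_sum// => q _.
  have -> : eps ^+ pbar * tensor_form lam q (phi - trow x) =
     eps ^+ (pbar - q) * tensor_form lam q z.
    by rewrite tensor_formZ mulrA -exprD subnK// ltnW.
  have [L0 HLq] := HL q.
  rewrite (le_trans (ler_norm _))// normrN normrM (ger0_norm (exprn_ge0 _ (ltW e0))).
  rewrite -[leRHS]mul1r ler_pM// ?exprn_ge0 ?(ltW e0)//.
    by rewrite exprn_ile1// (ltW e0).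
  rewrite (le_trans (HLq z))// ler_wpM2l//.
  rewrite (@le_trans _ _ ((1 + r) ^+ q))//.
    by rewrite lerXn2r ?nnegrE// ?addr_ge0// lerDr.
  rewrite ler_weXn2l ?lerDl// -ltnS prednK// ltnW//.
have hb : (\prod_(j < n) (1 + (eps * tnth x j) ^+ 2)) ^+ k <= (1 + a + r) ^+ m.
  rewrite /m mulnA exprM lerXn2r ?nnegrE ?prodr_ge0 ?exprn_ge0 ?addr_ge0//.
    by move=> j _; rewrite addr_ge0// sqr_ge0.
  rewrite exprM -[X in _ <= _ ^+ X]card_ord -prodr_const.
  apply: ler_prod => j _; rewrite addr_ge0 ?sqr_ge0//=.
  have : `|eps * tnth x j| <= a + r.
    have -> : eps * tnth x j = eps * phi 0 j - z 0 j by rewrite /z !mxE; ring.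
    rewrite (le_trans (ler_normB _ _))// lerD ?norm_coord_le//.
    rewrite normrM (ger0_norm (ltW e0)) -[leRHS]mul1r ler_pM// ?(ltW e0)//.
    exact: norm_coord_le.
  rewrite -(real_normK (num_real (eps * _))); move: `|_| (normr_ge0 (eps * tnth x j)) => y y0 ya.
  by rewrite -addrA sqrrD expr1n mul1r; have : y ^+ 2 <= (a + r) ^+ 2;
    [rewrite lerXn2r ?nnegrE ?addr_ge0|have := addr_ge0 a0 r0; lra].
have y0 : 0 <= 1 + a + r by rewrite !addr_ge0.
apply: (@le_trans _ _ ((1 + a + r) ^+ m * expR (- (r - E)))).
  apply: ler_pM; [|exact: expR_ge0|exact: hb|by rewrite ler_expR lerN2].
  by rewrite exprn_ge0// prodr_ge0// => j _; rewrite addr_ge0// sqr_ge0.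
apply: (@le_trans _ _ (m`!%:R * expR (1 + a + r) * expR (- (r - E)))).
  by rewrite ler_wpM2r ?expR_ge0// expr_le_fact_expR.
rewrite -mulrA -expRD.
by rewrite (_ : 1 + a + r + - (r - E) = 1 + a + E); last by ring.
Qed.

End coercivity.

(** * Derivatives of the Boltzmann weight *)

Section boltzmann_tower.
Context {R : realType} {n : nat}.
Local Notation T := (n.-tuple (measurableTypeR R)).
Local Notation e_ := (delta_mx 0).

(** Polynomials in eps and eps x: each derivative in x brings out a factor
    eps and stays in the class. *)
Inductive scaled_poly : (R -> 'rV[R]_n -> R) -> Prop :=
| sp_cst c : scaled_poly (fun _ _ => c)
| sp_eps : scaled_poly (fun eps _ => eps)
| sp_var j : scaled_poly (fun eps x => eps * x 0 j)
| sp_add h k : scaled_poly h -> scaled_poly k ->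
    scaled_poly (fun eps x => h eps x + k eps x)
| sp_mul h k : scaled_poly h -> scaled_poly k ->
    scaled_poly (fun eps x => h eps x * k eps x).

Lemma sp_sum (I : Type) (r : seq I) (F : I -> R -> 'rV[R]_n -> R) :
  (forall i, scaled_poly (F i)) -> scaled_poly (fun eps x => \sum_(i <- r) F i eps x).
Proof.
move=> sF; elim: r => [|i r IH].
  rewrite (_ : (fun _ _ => _) = fun _ _ => 0); first exact: sp_cst.
  by apply/funext => eps; apply/funext => x; rewrite big_nil.
rewrite (_ : (fun _ _ => _) = fun eps x => F i eps x + \sum_(j <- r) F j eps x).
  exact: (sp_add (sF i) IH).
by apply/funext => eps; apply/funext => x; rewrite big_cons.
Qed.

Lemma sp_prod (I : Type) (r : seq I) (F : I -> R -> 'rV[R]_n -> R) :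
  (forall i, scaled_poly (F i)) -> scaled_poly (fun eps x => \prod_(i <- r) F i eps x).
Proof.
move=> sF; elim: r => [|i r IH].
  rewrite (_ : (fun _ _ => _) = fun _ _ => 1); first exact: sp_cst.
  by apply/funext => eps; apply/funext => x; rewrite big_nil.
rewrite (_ : (fun _ _ => _) = fun eps x => F i eps x * \prod_(j <- r) F j eps x).
  exact: (sp_mul (sF i) IH).
by apply/funext => eps; apply/funext => x; rewrite big_cons.
Qed.

Lemma is_derive_coord (x : 'rV[R]_n) (i j : 'I_n) :
  is_derive x (e_ j : 'rV[R]_n) ((fun x => x 0 i) : 'rV[R]_n -> R^o) (i == j)%:R.
Proof.
have E : (fun h : R => h^-1 *: (((h *: (e_ j : 'rV[R]_n) + x) 0 i : R^o) - x 0 i)) @ 0^' --> ((i == j)%:R : R^o).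
  apply: (@cvg_trans _ ((fun=> (i == j)%:R : R^o) @ (0:R)^')); last exact: cvg_cst.
  apply: near_eq_cvg; near=> h.
  rewrite !mxE eqxx /= addrK /GRing.scale /= mulrA mulVf ?mul1r//.
  by near: h; exact: nbhs_dnbhs_neq.
by split; [apply/cvg_ex; eexists; exact: E|apply: (cvg_lim _ E)].
Unshelve. all: by end_near. Qed.

Lemma sp_derive h j : scaled_poly h -> exists2 h', scaled_poly h' &
  forall eps x, is_derive x (e_ j : 'rV[R]_n) (h eps : 'rV[R]_n -> R^o) (eps * h' eps x).
Proof.
elim=> [c||i|f g _ [f' sf' df] _ [g' sg' dg]|f g sf [f' sf' df] sg [g' sg' dg]].
- exists (fun _ _ => 0); first exact: sp_cst.
  by move=> eps x; rewrite mulr0; exact: is_derive_cst.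
- exists (fun _ _ => 0); first exact: sp_cst.
  by move=> eps x; rewrite mulr0; exact: is_derive_cst.
- exists (fun _ _ => (i == j)%:R); first exact: sp_cst.
  move=> eps x.
  apply: (is_derive_eq (is_derive_mul (is_derive_cst eps x _) (is_derive_coord x i j))).
  by rewrite mul0r add0r.
- exists (fun eps x => f' eps x + g' eps x); first exact: sp_add.
  move=> eps x; rewrite mulrDr.
  exact: (is_derive_add (df eps x) (dg eps x)).
- exists (fun eps x => f' eps x * g eps x + f eps x * g' eps x).
    by apply: sp_add; apply: sp_mul.
  move=> eps x.
  apply: (is_derive_eq (is_derive_mul (df eps x) (dg eps x))).
  by ring.
Qed.

Lemma sp_measurable h eps : scaled_poly h -> measurable_fun setT (h eps \o (@trow R n)).
Proof.
elim=> [c||i|f g _ mf _ mg|f g _ mf _ mg].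
- exact: measurable_cst.
- exact: measurable_cst.
- rewrite (_ : _ \o _ = fun x => eps * tnth x i); last first.
    by apply/funext => x; rewrite /= mxE.
  by apply: measurable_funM => //; exact: measurable_tnth.
- exact: measurable_funD.
- exact: measurable_funM.
Qed.

(** The counterpart of [bw] at the scale eps. *)
Definition bws (eps : R) (x : T) : R := \prod_(j < n) (1 + (eps * tnth x j) ^+ 2).

Lemma bws_ge1 eps x : 1 <= bws eps x.
Proof.
rewrite /bws; elim/big_rec: _ => // i y _ y1.
by rewrite (le_trans y1)// ler_peMl ?(le_trans ler01)// lerDl sqr_ge0.
Qed.

Lemma sp_le h : scaled_poly h -> exists (C : R) (k : nat), 0 <= C /\
  forall eps (x : T), 0 < eps <= 1 -> `|h eps (trow x)| <= C * bws eps x ^+ k.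
Proof.
elim=> [c||j|f g _ [C [k [C0 Hf]]] _ [D [l [D0 Hg]]]|f g _ [C [k [C0 Hf]]] _ [D [l [D0 Hg]]]].
- by exists `|c|, 0%N; split => // eps x _; rewrite expr0 mulr1.
- exists 1, 0%N; split => // eps x /andP[e0 e1].
  by rewrite expr0 mulr1 ger0_norm// ltW.
- exists 1, 1%N; split => // eps x e01; rewrite expr1 mul1r mxE /bws.
  rewrite (bigD1 j)//= -[leLHS]mulr1; apply: ler_pM => //.
    have := sqr_ge0 (`|eps * tnth x j| - 1).
    rewrite -(real_normK (num_real (eps * tnth x j))) sqrrB1.
    by have := normr_ge0 (eps * tnth x j); nra.
  elim/big_rec: _ => // i y _ y1.
  by rewrite (le_trans y1)// ler_peMl ?(le_trans ler01)// lerDl sqr_ge0.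
- exists (C + D), (k + l)%N; split; first exact: addr_ge0.
  move=> eps x e01; have b1 := bws_ge1 eps x.
  rewrite (le_trans (ler_normD _ _))// mulrDl lerD//.
    by rewrite (le_trans (Hf eps x e01))// ler_wpM2l// ler_weXn2l// leq_addr.
  by rewrite (le_trans (Hg eps x e01))// ler_wpM2l// ler_weXn2l// leq_addl.
- exists (C * D), (k + l)%N; split; first exact: mulr_ge0.
  move=> eps x e01; rewrite normrM exprD mulrACA ler_pM//.
    exact: Hf.
  exact: Hg.
Qed.

Variables (pbar : nat) (lam : forall p : nat, p.-tuple 'I_n -> R).
Arguments lam : clear implicits.

Lemma sp_potential phi :
  scaled_poly (fun eps x => eps ^+ pbar * potential pbar lam (phi - x)).
Proof.
have spX k : scaled_poly (fun eps _ => eps ^+ k).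
  elim: k => [|k IH]; first exact: (sp_cst 1).
  rewrite (_ : (fun _ _ => _) = fun eps x => eps * eps ^+ k); first exact: (sp_mul sp_eps IH).
  by apply/funext => eps; apply/funext => x; rewrite exprS.
rewrite (_ : (fun _ _ => _) = fun eps (x : 'rV[R]_n) => \sum_(q < pbar.+1) (eps ^+ (pbar - q) *
   \sum_(X : q.-tuple 'I_n) (lam q X *
      \prod_(i < q) (eps * phi 0 (tnth X i) + -1 * (eps * x 0 (tnth X i)))))).
  apply: sp_sum => q; apply: (sp_mul (spX _)); apply: sp_sum => X.
  apply: (sp_mul (sp_cst _)); apply: sp_prod => i; apply: sp_add.
    exact: (sp_mul sp_eps (sp_cst _)).
  exact: (sp_mul (sp_cst _) (sp_var _)).
apply/funext => eps; apply/funext => x; rewrite /potential mulr_sumr.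
apply: eq_bigr => q _.
have -> : eps ^+ pbar = eps ^+ (pbar - q) * eps ^+ q.
  by rewrite -exprD subnK// -ltnS ltn_ord.
rewrite -mulrA.
rewrite -tensor_formZ; congr (_ * _); apply: eq_bigr => X _; congr (_ * _).
by apply: eq_bigr => i _; rewrite !mxE; ring.
Qed.

(** Each derivative of exp (- eps ^ pbar V(phi - x)) brings out a factor eps and a
    polynomial in eps x, which is absorbed by the exponential. The factor
    eps ^ (- 2 n) is the price of an integrable weight at scale one, because
    1 / (1 + (eps s)^2) <= eps ^ (-2) / (1 + s^2). *)
Lemma boltzmann_tower (phi : 'rV[R]_n) : (0 < n)%N -> (1 < pbar)%N ->
  (forall x : 'rV[R]_n, x != 0 -> 0 < tensor_form lam pbar x) ->
  exists G : R -> seq 'I_n -> 'rV[R]_n -> R,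
  [/\ forall eps, tower (G eps),
      forall eps s, measurable_fun setT (G eps s \o (@trow R n)),
      forall eps x, G eps [::] x = expR (- (eps ^+ pbar * potential pbar lam (phi - x))) &
      forall s, exists C, forall eps (x : T), 0 < eps <= 1 ->
        `|G eps s (trow x)| <= C * eps ^+ size s * eps ^- (2 * n) * wt x].
Proof.
move=> n0 p1 pos; pose P (eps : R) x := eps ^+ pbar * potential pbar lam (phi - x).
have sP : scaled_poly P := sp_potential phi.
have /choice[D HD] : forall hj : (R -> 'rV[R]_n -> R) * 'I_n,
  exists h', scaled_poly hj.1 -> scaled_poly h' /\ forall eps x,
    is_derive x (e_ hj.2 : 'rV[R]_n) (hj.1 eps : 'rV[R]_n -> R^o) (eps * h' eps x).
  move=> [h j] /=; have [sh|nsh] := pselect (scaled_poly h); last by exists h.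
  by have [h' sh' dh] := sp_derive j sh; exists h'.
(* the polynomial in front of the exponential after the derivatives along s *)
pose q := foldr (fun j h eps x => D (h, j) eps x + -1 * (h eps x * D (P, j) eps x))
  (fun (_ : R) (_ : 'rV[R]_n) => 1).
have sq s : scaled_poly (q s).
  elim: s => [|j s IH] /=; first exact: sp_cst.
  apply: sp_add; first by case: (HD (q s, j) IH).
  apply: (sp_mul (sp_cst _)); apply: (sp_mul IH).
  by case: (HD (P, j) sP).
exists (fun eps s x => eps ^+ size s * (q s eps x * expR (- P eps x))).
split.
- move=> eps s j x.
  have [_ d1] := HD (q s, j) (sq s); have [_ d2] := HD (P, j) sP.
  have dE : is_derive x (e_ j : 'rV[R]_n) ((fun x => expR (- P eps x)) : 'rV[R]_n -> R^o)
      (expR (- P eps x) * - (eps * D (P, j) eps x)).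
    have dN : is_derive x (e_ j : 'rV[R]_n) ((fun x => - P eps x) : 'rV[R]_n -> R^o)
        (- (eps * D (P, j) eps x)) by exact: (is_deriveN (d2 eps x)).
    exact: (is_derive_comp1 (f := expR) (h := expR) (fun s => is_derive_expR s) dN).
  apply: (is_derive_eq (is_derive_mul (is_derive_cst (eps ^+ size s) x _)
    (is_derive_mul (d1 eps x) dE))).
  by rewrite /= exprS; ring.
- move=> eps s.
  rewrite (_ : _ \o _ = fun x : T => eps ^+ size s *
     ((q s eps \o (@trow R n)) x * expR (- (P eps \o (@trow R n)) x))) //.
  apply: measurable_funM => //; apply: measurable_funM; first exact: sp_measurable.
  apply: (measurableT_comp (@measurable_expR R)).
  by apply: measurableT_comp => //; exact: sp_measurable.
- by move=> eps x; rewrite /= !mul1r.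
- move=> s; have [C [k [C0 HC]]] := sp_le (sq s).
  have [C' C'0 HC'] := scaled_potential_le k.+1 n0 p1 pos phi.
  exists (C * C') => eps x e01; have [e0 e1] := andP e01.
  rewrite normrM (ger0_norm (exprn_ge0 _ (ltW e0))) normrM (ger0_norm (expR_ge0 _)).
  have b1 := bws_ge1 eps x; have b0 : 0 < bws eps x by exact: lt_le_trans b1.
  have -> : C * C' * eps ^+ size s * eps ^- (2 * n) * wt x =
    eps ^+ size s * (C * (C' * (eps ^- (2 * n) * wt x))) by ring.
  rewrite ler_wpM2l ?exprn_ge0 ?(ltW e0)//.
  apply: (@le_trans _ _ (C * bws eps x ^+ k * expR (- P eps (trow x)))).
    by rewrite ler_wpM2r ?expR_ge0//; exact: HC.
  rewrite -mulrA ler_wpM2l//.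
  apply: (@le_trans _ _ (C' * (bws eps x)^-1)).
    rewrite ler_pdivlMr// mulrAC -exprSr; exact: HC'.
  rewrite ler_wpM2l// /bws -prodfV exprM -[X in (_ ^+ X)^-1]card_ord -prodr_const.
  rewrite -prodfV /wt -big_split; apply: ler_prod => j _ /=.
  have xe : 0 < 1 + (eps * tnth x j) ^+ 2 by exact: onesq_gt0.
  rewrite invr_ge0 (ltW xe) /= /wt1 -invfM lef_pV2 ?posrE// ?mulr_gt0 ?exprn_gt0 ?onesq_gt0//.
  rewrite mulrDr mulr1 exprMn lerD2r exprn_ile1// ltW//.
Qed.

End boltzmann_tower.

(** * Expansion in beta under a differential operator *)

Section iterated_derivatives.
Context {R : realType} {n : nat}.
Local Notation V := ('rV[R]_n).
Local Notation e_ j := (delta_mx 0 j : V).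

Definition pd (s : seq 'I_n) (f : V -> R) : V -> R :=
  foldr (fun j g x => 'D_(e_ j) (g : V -> R^o) x) f s.

(** Infinite differentiability, in the form in which it is used: the iterated
    partial derivatives form a tower. *)
Definition smoothR (f : V -> R) := tower (pd^~ f).

Lemma tower_pd (G : seq 'I_n -> V -> R) s : tower G -> pd s (G [::]) = G s.
Proof.
move=> tG; elim: s => [//|j s IH] /=.
by apply/funext => x; rewrite IH; case: (tG s j x).
Qed.

Lemma tower_smooth (G : seq 'I_n -> V -> R) : tower G -> smoothR (G [::]).
Proof. by move=> tG s j x; rewrite !tower_pd. Qed.

Lemma smooth_sum (I : Type) (r : seq I) (c : I -> R) (F : I -> V -> R) :
  (forall i, smoothR (F i)) -> smoothR (fun x => \sum_(i <- r) c i * F i x) /\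
  forall s x, pd s (fun x => \sum_(i <- r) c i * F i x) x =
    \sum_(i <- r) c i * pd s (F i) x.
Proof.
move=> sF; pose G s x := \sum_(i <- r) c i * pd s (F i) x.
have tG : tower G.
  move=> s j x; apply: is_derive_bigsum => i _.
  apply: (is_derive_eq (is_derive_mul (is_derive_cst (c i) x _) (sF i s j x))).
  by rewrite mul0r add0r.
split; first exact: (tower_smooth tG).
by move=> s x; rewrite (tower_pd s tG).
Qed.

(** Smoothness of explicit families, without a formula for their iterated
    derivatives. *)
Lemma class_smooth (I : Type) (Cl : (I -> V -> R) -> Prop) :
  (forall h j, Cl h -> exists2 h', Cl h' &
     forall b y, is_derive y (e_ j) (h b : V -> R^o) (h' b y)) ->
  forall h, Cl h -> (forall b, smoothR (h b)) /\
    forall s, exists2 h', Cl h' & forall b, pd s (h b) = h' b.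
Proof.
move=> dCl h Ch.
have P s : exists2 h', Cl h' & forall b, pd s (h b) = h' b.
  elim: s => [|j s [h' Ch' E]]; first by exists h.
  have [h2 Ch2 E2] := dCl h' j Ch'; exists h2 => // b /=.
  by apply/funext => x; rewrite E; case: (E2 b x).
split=> // b s j x; have [h' Ch' E] := P s.
have [h2 Ch2 E2] := dCl h' j Ch'.
rewrite /= E; have H := E2 b x.
by apply: (is_derive_eq H); case: H.
Qed.

Inductive polyfun : (V -> R) -> Prop :=
| pf_cst c : polyfun (fun=> c)
| pf_var j : polyfun (fun x => x 0 j)
| pf_add f g : polyfun f -> polyfun g -> polyfun (fun x => f x + g x)
| pf_mul f g : polyfun f -> polyfun g -> polyfun (fun x => f x * g x).

Lemma pf_derive f j : polyfun f -> exists2 f', polyfun f' &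
  forall y, is_derive y (e_ j) (f : V -> R^o) (f' y).
Proof.
elim=> [c|i|h k _ [h' ph dh] _ [k' pk dk]|h k ph0 [h' ph dh] pk0 [k' pk dk]].
- by exists (fun=> 0); [exact: pf_cst|move=> y; exact: is_derive_cst].
- exists (fun=> (i == j)%:R); first exact: pf_cst.
  by move=> y; exact: is_derive_coord.
- exists (fun x => h' x + k' x); first exact: pf_add.
  by move=> y; exact: (is_derive_add (dh y) (dk y)).
- exists (fun x => h' x * k x + h x * k' x); first by apply: pf_add; apply: pf_mul.
  by move=> y; exact: (is_derive_mul (dh y) (dk y)).
Qed.

Lemma polyfun_smooth f : polyfun f -> smoothR f.
Proof.
move=> pf.
have H (h : unit -> V -> R) j : polyfun (h tt) -> exists2 h' : unit -> V -> R, polyfun (h' tt) &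
    forall b y, is_derive y (e_ j) (h b : V -> R^o) (h' b y).
  by move=> /(pf_derive j)[h' ph dh]; exists (fun=> h') => // -[].
by have [s _] := class_smooth H (h := fun=> f) pf; exact: (s tt).
Qed.

Lemma pf_sum (I : Type) (r : seq I) (F : I -> V -> R) :
  (forall i, polyfun (F i)) -> polyfun (fun x => \sum_(i <- r) F i x).
Proof.
move=> sF; elim: r => [|i r IH].
  under eq_fun do rewrite big_nil; exact: pf_cst.
by under eq_fun do rewrite big_cons; exact: pf_add.
Qed.

Lemma pf_prod (I : Type) (r : seq I) (P : pred I) (F : I -> V -> R) :
  (forall i, polyfun (F i)) -> polyfun (fun x => \prod_(i <- r | P i) F i x).
Proof.
move=> sF; elim: r => [|i r IH].
  under eq_fun do rewrite big_nil; exact: pf_cst.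
under eq_fun do rewrite big_cons; case: (P i) => //.
exact: pf_mul.
Qed.

Lemma pf_exp f k : polyfun f -> polyfun (fun x => f x ^+ k).
Proof.
move=> pf; elim: k => [|k IH]; first by under eq_fun do rewrite expr0; exact: pf_cst.
by under eq_fun do rewrite exprS; exact: pf_mul.
Qed.

Lemma pf_potential (pbar : nat) (lam : forall p : nat, p.-tuple 'I_n -> R) :
  polyfun (potential pbar lam).
Proof.
apply: pf_sum => p; apply: pf_sum => X; apply: pf_mul; first exact: pf_cst.
by apply: pf_prod => i; exact: pf_var.
Qed.

Definition exp_rem (k : nat) (s : R) : R := expR s - \sum_(m < k) s ^+ m / m`!%:R.

Lemma exp_remE k s : exp_rem k s = complex.Re (cexp s%:C - exp_trunc k s%:C).
Proof.
rewrite cReD cReN Re_cexp /= cos0 mulr1; congr (_ - _).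
rewrite -[s%:C]mulr1 exp_trunc_real Re_sum; apply: eq_bigr => i _.
by rewrite expr1n mulr1.
Qed.

Lemma is_derive_exp_rem k s : is_derive s (1:R) (exp_rem k : R -> R^o) (exp_rem k.-1 s).
Proof.
rewrite (_ : exp_rem k = fun s => complex.Re (cexp (s%:C * 1)) +
    - complex.Re (exp_trunc k (s%:C * 1))); last first.
  by apply/funext => t; rewrite exp_remE cReD cReN mulr1.
rewrite exp_remE -[X in cexp X]mulr1 -[X in exp_trunc _ X]mulr1.
rewrite cReD cReN -[X in complex.Re X - _]mul1r -[X in _ - complex.Re X]mul1r.
apply: is_derive_add.
  by apply: cexp_real_line; left.
have d : is_derive s (1:R) (fun s => complex.Re (exp_trunc k (s%:C * 1)) : R^o)
    (complex.Re (1 * exp_trunc k.-1 (s%:C * 1))).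
  apply: is_derive_exp_trunc; last exact: cReD.
  by move=> r w; rewrite cReM /= mul0r subr0.
exact: (is_deriveN d).
Qed.

Lemma exp_rem_le k s : `|exp_rem k s| <= (2 * `|s|) ^+ k * expR `|s|.
Proof.
rewrite exp_remE (le_trans (normr_Re_le _))//.
by have := cexp_taylor k s%:C; rewrite cabs_real.
Qed.

Section remainder.
Variable W : V -> R.
Hypothesis pW : polyfun W.

(** Families of order beta ^ k at every point. The class is closed under
    differentiation: the derivative of exp_rem k (- beta W) is
    - beta W' exp_rem (k - 1) (- beta W), and the new factor beta pays for the
    lost order. *)
Inductive rem_class : nat -> (R -> V -> R) -> Prop :=
| rc_base k Q : polyfun Q ->
    rem_class k (fun b y => Q y * exp_rem k (- (b * W y)))
| rc_add k h h' : rem_class k h -> rem_class k h' ->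
    rem_class k (fun b y => h b y + h' b y)
| rc_mul k h : rem_class k.-1 h -> rem_class k (fun b y => b * h b y).

Lemma rc_derive k h j : rem_class k h -> exists2 h', rem_class k h' &
  forall b y, is_derive y (e_ j) (h b : V -> R^o) (h' b y).
Proof.
elim=> {k h} [k Q pQ|k h h' _ [g rg dg] _ [g' rg' dg']|k h _ [g rg dg]].
- have [Q' pQ' dQ] := pf_derive j pQ; have [W' pW' dW] := pf_derive j pW.
  exists (fun b y => Q' y * exp_rem k (- (b * W y)) +
     b * ((-1 * (Q y * W' y)) * exp_rem k.-1 (- (b * W y)))).
    apply: rc_add; first exact: rc_base.
    apply: rc_mul; apply: (@rc_base k.-1 (fun y => -1 * (Q y * W' y))).
    by apply: pf_mul; [exact: pf_cst|exact: pf_mul].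
  move=> b y.
  have dN : is_derive y (e_ j) ((fun y => - (b * W y)) : V -> R^o) (- (b * W' y)).
    have d : is_derive y (e_ j) ((fun y => b * W y) : V -> R^o) (b * W' y).
      apply: (is_derive_eq (is_derive_mul (is_derive_cst b y _) (dW y))).
      by rewrite mul0r add0r.
    exact: (is_deriveN d).
  apply: (is_derive_eq (is_derive_mul (dQ y)
    (is_derive_comp1 (f := exp_rem k.-1) (is_derive_exp_rem k) dN))).
  by ring.
- exists (fun b y => g b y + g' b y); first exact: rc_add.
  by move=> b y; exact: (is_derive_add (dg b y) (dg' b y)).
- exists (fun b y => b * g b y); first exact: rc_mul.
  move=> b y; apply: (is_derive_eq (is_derive_mul (is_derive_cst b y _) (dg b y))).
  by rewrite mul0r add0r.
Qed.

Lemma rc_le k h y : rem_class k h -> exists2 C, 0 <= C & forall b : R, 0 < b <= 1 ->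
  `|h b y| <= C * b ^+ k.
Proof.
elim=> {k h} [k Q pQ|k h h' _ [C C0 HC] _ [D D0 HD]|k h _ [C C0 HC]].
- exists (`|Q y| * ((2 * `|W y|) ^+ k * expR `|W y|)).
    by rewrite !mulr_ge0 ?exprn_ge0 ?mulr_ge0 ?expR_ge0.
  move=> b /andP[b0 b1]; rewrite normrM -mulrA ler_wpM2l//.
  rewrite (le_trans (exp_rem_le _ _))// normrN normrM (ger0_norm (ltW b0)).
  rewrite (_ : 2 * (b * `|W y|) = 2 * `|W y| * b); last by ring.
  rewrite [in leLHS]exprMn mulrAC; apply: ler_wpM2r; first by rewrite exprn_ge0// ltW.
  rewrite ler_wpM2l ?exprn_ge0 ?mulr_ge0// ler_expR.
  by rewrite -[leRHS]mul1r ler_wpM2r.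
- exists (C + D); first exact: addr_ge0.
  by move=> b b01; rewrite (le_trans (ler_normD _ _))// mulrDl lerD ?HC ?HD.
- exists C => // b b01; have [b0 b1] := andP b01.
  rewrite normrM (ger0_norm (ltW b0)).
  case: k HC => [|k] HC; last by rewrite exprS mulrCA ler_wpM2l ?(ltW b0)//; exact: HC.
  by rewrite -[leRHS]mul1r ler_pM ?(ltW b0)//; exact: HC.
Qed.

(** The difference is the iterated derivative of exp_rem (N + 1) (- beta W), which
    stays in the class of remainders of order N + 1. *)
Lemma pd_exp_expansion (s : seq 'I_n) (y : V) N : exists2 C, 0 <= C &
  forall b : R, 0 < b <= 1 ->
  `|pd s (fun x => expR (- (b * W x))) y -
    \sum_(m < N.+1) ((- b) ^+ m / m`!%:R) * pd s (fun x => W x ^+ m) y| <= C * b ^+ N.+1.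
Proof.
have r1 : rem_class N.+1 (fun b y => 1 * exp_rem N.+1 (- (b * W y))).
  exact: (rc_base _ (pf_cst 1)).
have [sm ex] := class_smooth (Cl := rem_class N.+1) (fun h j => @rc_derive N.+1 h j) r1.
have [h' rh' E] := ex s; have [C C0 HC] := rc_le y rh'; exists C => // b b01.
have := HC b b01; rewrite -E; congr (`|_| <= _).
pose F (o : option 'I_N.+1) : V -> R :=
  if o is Some m then fun x => W x ^+ m else fun x => 1 * exp_rem N.+1 (- (b * W x)).
have sF o : smoothR (F o).
  by case: o => [m|]; [exact/polyfun_smooth/pf_exp|exact: sm].
pose c (o : option 'I_N.+1) : R := if o is Some m then (- b) ^+ m / m`!%:R else 1.
have [_ HS] := smooth_sum (None :: [seq Some m | m <- index_enum 'I_N.+1]) c sF.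
have -> : (fun x => expR (- (b * W x))) =
  (fun x => \sum_(i <- None :: [seq Some m | m <- index_enum 'I_N.+1]) c i * F i x).
  apply/funext => x; rewrite big_cons big_map /= !mul1r /exp_rem.
  have -> : \sum_(m < N.+1) (- (b * W x)) ^+ m / m`!%:R =
     \sum_(j <- index_enum 'I_N.+1) (- b) ^+ j / j`!%:R * W x ^+ j.
    by apply: eq_bigr => m _; rewrite -mulNr exprMn mulrAC.
  by rewrite subrK.
by rewrite HS big_cons big_map /= mul1r addrK.
Qed.

End remainder.

(** In [Phi] the potential is evaluated at phi - x. The sign from the reflection
    cancels the sign from the integrations by parts. *)
Lemma pd_reflect (G : seq 'I_n -> V -> R) (phi : V) s : tower G ->
  pd s (fun y => G [::] (phi - y)) phi = (-1) ^+ size s * G s 0.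
Proof.
move=> tG; pose H s y := (-1) ^+ size s * G s (phi - y).
have tH : tower H.
  move=> s' j y; apply: is_derive_of_line.
  have d : is_derive (0 : R) (1 : R) (fun t => G s' ((phi - y) + t *: (- e_ j)) : R^o)
      (- G (j :: s') (phi - y)).
    pose l (t : R) := G s' ((phi - y) + t *: e_ j).
    have dl : is_derive (- (0:R)) (1 : R) (l : R -> R^o) (G (j :: s') (phi - y)).
      apply: is_derive_line; rewrite oppr0 scale0r addr0; exact: tG.
    have := is_derive1_comp (f := l) (g := -%R) dl (is_deriveNid _ _).
    rewrite mulrN1; congr (is_derive _ _ _ _).
    by apply/funext => t; rewrite /l /= scaleNr scalerN.
  have -> : (fun s0 : R => H s' (y + s0 *: e_ j)) =
    (fun t => (-1) ^+ size s' * G s' ((phi - y) + t *: (- e_ j))).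
    by apply/funext => t; rewrite /H opprD addrA scalerN.
  pose c : R := (-1) ^+ size s'.
  apply: (is_derive_eq (is_derive_mul (is_derive_cst (c : R^o) (0:R) 1) d)).
  by rewrite /c /H /= exprS mul0r add0r; ring.
have -> : (fun y => G [::] (phi - y)) = H [::].
  by apply/funext => y; rewrite /H /= mul1r.
by rewrite (tower_pd s tH) /H subrr.
Qed.

End iterated_derivatives.

Section expansion_of_Phi.
Context {R : realType} {n : nat}.
Local Notation T := (n.-tuple (measurableTypeR R)).

Definition op_at (tau : seq (R[i] * seq 'I_n)) (phi : 'rV[R]_n) (f : 'rV[R]_n -> R) : R[i] :=
  \sum_(cs <- tau) cs.1 * (pd cs.2 f phi)%:C.

(** With K derivatives traded for eps ^+ K, where eps ^+ pbar = beta, the error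
    of the multiplier estimate is below beta ^+ N.+1 in spite of the loss
    eps ^- (2 * n). *)
Lemma Phi_expansion (pbar : nat) (lam : forall p : nat, p.-tuple 'I_n -> R)
    (phi : 'rV[R]_n) (u : 'rV[R]_n -> R[i]) tau (M N : nat) C :
  (0 < n)%N -> (1 < pbar)%N ->
  (forall x : 'rV[R]_n, x != 0 -> 0 < tensor_form lam pbar x) ->
  cmeasurable u -> 0 <= C ->
  (forall xi : T, cabs (u (trow xi) - op_poly tau (trow xi)) <=
     C * (\sum_(j < n) `|tnth xi j| ^+ (pbar * N.+1 + 2 * n)) * bw xi ^+ M) ->
  exists2 C', 0 <= C' & forall beta, 0 < beta <= 1 ->
    cabs (cintegral (fun xi => u xi *
        fourier_inv (fun x => boltzmann pbar lam beta (phi - x)) xi) -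
      \sum_(m < N.+1) ((- beta) ^+ m / m`!%:R)%:C *
         op_at tau phi (fun x => potential pbar lam x ^+ m)) <= C' * beta ^+ N.+1.
Proof.
move=> n0 p1 pos mu_ C0 uC.
have [G [tG mG GE GB]] := boltzmann_tower phi n0 p1 pos.
have A0 eps : 0 < eps <= 1 -> (0 : R) <= eps ^- (2 * n).
  by move=> /andP[e0 _]; rewrite invr_ge0 exprn_ge0// ltW.
have [C1 HC1] := multiplier_estimate (G := G) (A := fun eps => eps ^- (2 * n))
  (fun eps _ => tG eps) (fun eps s _ => mG eps s) A0 GB mu_ C0 uC.
pose W := potential pbar lam.
have pW : polyfun W := pf_potential pbar lam.
have /choice[D HD] : forall s : seq 'I_n, exists D, 0 <= D /\ forall b : R, 0 < b <= 1 ->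
  `|pd s (fun x => expR (- (b * W x))) phi -
    \sum_(m < N.+1) ((- b) ^+ m / m`!%:R) * pd s (fun x => W x ^+ m) phi| <= D * b ^+ N.+1.
  by move=> s; have [D D0 H] := pd_exp_expansion pW s phi N; exists D.
exists (`|C1| + \sum_(cs <- tau) cabs cs.1 * D cs.2).
  by rewrite addr_ge0// sumr_ge0// => cs _; rewrite mulr_ge0 ?cabs_ge0//; case: (HD cs.2).
move=> beta b01; have [b0 b1] := andP b01.
have p0 : (0 < pbar)%N := ltnW p1.
have [eps [e01 ep]] : exists eps : R, 0 < eps <= 1 /\ eps ^+ pbar = beta.
  exists (powR beta (pbar%:R^-1)); rewrite powR_gt0//=; split.
    have h1 : powR 1 (pbar%:R^-1) = 1 :> R by rewrite powR1.
    by rewrite -[leRHS]h1; apply: ge0_ler_powR; rewrite ?invr_ge0 ?nnegrE// ltW.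
  rewrite -powR_mulrn ?powR_ge0// -powRrM mulVf ?powRr1 ?(ltW b0)//.
  by rewrite pnatr_eq0 -lt0n.
have [e0 e1] := andP e01.
have bE x : (G eps [::] x)%:C = boltzmann pbar lam beta (phi - x).
  by rewrite GE /boltzmann ep.
have fE : (fun x => boltzmann pbar lam beta (phi - x)) = (fun x => (G eps [::] x)%:C).
  by apply/funext => x; exact: esym (bE x).
rewrite fE.
set I := cintegral _.
have GD s : (-1) ^+ size s * (G eps s 0)%:C =
    (pd s (fun x => expR (- (beta * W x))) phi)%:C.
  rewrite (_ : (fun x => expR (- (beta * W x))) = (fun y => G eps [::] (phi - y))); last first.
    by apply/funext => y; rewrite GE ep subKr.
  by rewrite (pd_reflect phi s (tG eps)) rmorphM rmorphXn rmorphN1.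
have -> : \sum_(m < N.+1) ((- beta) ^+ m / m`!%:R)%:C * op_at tau phi (fun x => W x ^+ m) =
   \sum_(cs <- tau) cs.1 * (\sum_(m < N.+1) ((- beta) ^+ m / m`!%:R) *
      pd cs.2 (fun x => W x ^+ m) phi)%:C.
  rewrite /op_at; under eq_bigr do rewrite mulr_sumr.
  rewrite exchange_big /=; apply: eq_bigr => cs _.
  rewrite rmorph_sum mulr_sumr; apply: eq_bigr => m _.
  by rewrite [in RHS]rmorphM /= mulrCA.
rewrite -[X in cabs (X - _)](subrK (\sum_(cs <- tau) cs.1 * ((-1) ^+ size cs.2 * (G eps cs.2 0)%:C))).
rewrite -addrA (le_trans (cabsD _ _))// mulrDl lerD//.
  rewrite (le_trans (HC1 eps e01))//.
  have -> : eps ^+ (pbar * N.+1 + 2 * n) * eps ^- (2 * n) = beta ^+ N.+1.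
    by rewrite exprD mulfK ?expf_neq0 ?gt_eqF// exprM ep.
  by rewrite ler_wpM2r ?ler_norm// exprn_ge0// ltW.
rewrite -sumrB (le_trans (cabs_sum _ _ _))// mulr_suml ler_sum// => cs _.
rewrite GD -mulrBr cabsM -mulrA ler_wpM2l ?cabs_ge0// -rmorphB cabs_real.
by have [_ H] := HD cs.2; exact: H.
Qed.

End expansion_of_Phi.

(** * Derivatives of a multivariate power series *)

Section power_series.
Context {R : realType} {n : nat}.
Local Notation Rn := ('rV[R]_n).
Local Notation e_ j := (delta_mx 0 j : Rn).
Local Notation idx := ({ffun 'I_n -> nat}).
Implicit Types (a : idx) (s : seq 'I_n) (x : Rn).

Definition deg a : nat := \sum_j a j.

(** Multi-indices with entries below m, as partial sums of a power series range
    over such boxes. *)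
Definition box m (al : {ffun 'I_n -> 'I_m}) : idx := [ffun j => nat_of_ord (al j)].

Lemma box_inj m : injective (@box m).
Proof.
move=> al be /ffunP H; apply/ffunP => j; apply: val_inj.
by have := H j; rewrite !ffunE.
Qed.

(** The s-th partial derivative of the monomial x^a. *)
Definition dmono s a x : R :=
  (\prod_j (a j) ^_ (count_mem j s))%:R * \prod_j x 0 j ^+ (a j - count_mem j s).

Lemma dmono_nil a x : dmono [::] a x = \prod_j x 0 j ^+ a j.
Proof.
rewrite /dmono big1 ?mul1r; last by move=> j _; rewrite /= ffactn0.
by apply: eq_bigr => j _; rewrite /= subn0.
Qed.

Lemma pow_second_order (y h rho : R) N : `|y| <= rho -> `|y + h| <= rho ->
  `|(y + h) ^+ N - y ^+ N - h * (N%:R * y ^+ N.-1)| <=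
   h ^+ 2 * ((N * N.-1)%:R * rho ^+ N.-2).
Proof.
move=> y1 y2; have r0 : 0 <= rho by exact: le_trans y1.
elim: N => [|N IH].
  rewrite !expr0 subrr mul0r mulr0 subr0 normr0 /=.
  by rewrite mulr0.
have E : (y + h) ^+ N.+1 - y ^+ N.+1 - h * (N.+1%:R * y ^+ N) =
   (y + h) * ((y + h) ^+ N - y ^+ N - h * (N%:R * y ^+ N.-1)) +
   h ^+ 2 * (N%:R * y ^+ N.-1).
  case: N {IH} => [|N]; first by rewrite /= !expr0 expr1; ring.
  by rewrite /= -[N.+2%:R]natr1 !exprS; ring.
rewrite E /= (le_trans (ler_normD _ _))//.
have h1 : `|h ^+ 2 * (N%:R * y ^+ N.-1)| <= h ^+ 2 * (N%:R * rho ^+ N.-1).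
  rewrite normrM ger0_norm ?sqr_ge0// ler_wpM2l ?sqr_ge0// normrM ger0_norm ?ler0n//.
  by rewrite ler_wpM2l ?ler0n// normrX lerXn2r ?nnegrE.
have h2 : `|(y + h) * ((y + h) ^+ N - y ^+ N - h * (N%:R * y ^+ N.-1))| <=
    h ^+ 2 * ((N * N.-1)%:R * rho ^+ N.-1).
  rewrite normrM (le_trans (ler_pM _ _ y2 IH))// mulrCA ler_wpM2l ?sqr_ge0// mulrCA.
  case: N {IH h1 E} => [|[|N]]; rewrite ?mul0n ?muln0 ?mul0r //=.
  by rewrite -exprS.
rewrite (le_trans (lerD h2 h1))// -mulrDr -mulrDl -natrD ler_wpM2l ?sqr_ge0//.
rewrite ler_wpM2r ?exprn_ge0// ler_nat.
by case: N {IH h1 h2 E} => [|N] //=; nia.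
Qed.

Lemma ffact_le k m : (k ^_ m <= k ^ m)%N.
Proof.
elim: m => [|m IH]; first by rewrite ffactn0 expn0.
by rewrite ffactnSr expnSr leq_mul// leq_subr.
Qed.

Lemma count_sum s : (\sum_j count_mem j s = size s)%N.
Proof.
elim: s => [|i s IH] /=; first by rewrite big1.
rewrite big_split /= IH (bigD1 i)//= eqxx big1 ?addn0// => j /negPf ji.
by rewrite eq_sym ji.
Qed.

Lemma deg_ge a j : (a j <= deg a)%N.
Proof. by rewrite /deg (bigD1 j)//= leq_addr. Qed.

Lemma prod_ffact_le s a : (\prod_j (a j) ^_ (count_mem j s) <= deg a ^ size s)%N.
Proof.
rewrite -(count_sum s) expn_sum.
apply: leq_prod => j _; rewrite (leq_trans (ffact_le _ _))//.
by case: (count_mem j s) => [|k]; rewrite ?expn0// leq_exp2r// deg_ge.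
Qed.

Lemma dmono_le s a x rho : 0 < rho -> (forall j, `|x 0 j| <= rho) ->
  `|dmono s a x| <= (deg a ^ size s)%:R * (rho ^+ deg a * rho ^- size s).
Proof.
move=> r0 xr; rewrite /dmono normrM ger0_norm ?ler0n//.
have [/eqP k0|k0] := boolP (\prod_j (a j) ^_ (count_mem j s) == 0)%N.
  by rewrite k0 mul0r !mulr_ge0// ?ler0n ?invr_ge0 ?exprn_ge0 ?ltW.
apply: ler_pM => //; first by rewrite ler_nat prod_ffact_le.
have cle j : (count_mem j s <= a j)%N.
  rewrite leqNgt; apply: contra k0 => lt.
  by rewrite (bigD1 j)//= ffact_small// mul0n.
have -> : rho ^+ deg a * rho ^- size s = \prod_j rho ^+ (a j - count_mem j s).
  rewrite prodrXr -(count_sum s) /deg -[in LHS](eq_bigr _ (fun j _ => subnK (cle j))).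
  by rewrite big_split exprD mulfK// expf_neq0// gt_eqF.
rewrite normr_prod; apply: ler_prod => j _; rewrite normr_ge0 normrX /=.
by rewrite lerXn2r ?nnegrE// ltW.
Qed.

(** A second-order bound that is summable over all monomials as soon as the series
    of the majorants with polynomial factors converges. *)
Lemma dmono_second_order s a x j h rho : 0 < rho -> (forall j, `|x 0 j| <= rho) ->
  `|x 0 j + h| <= rho ->
  `|dmono s a (x + h *: e_ j) - dmono s a x - h * dmono (j :: s) a x| <=
  h ^+ 2 * ((deg a ^ (size s).+2)%:R * (rho ^+ deg a * rho ^- (size s).+2)).
Proof.
move=> r0 xr xh; pose x' : Rn := \row_i (if i == j then rho else `|x 0 i|).
apply: (@le_trans _ _ (h ^+ 2 * `|dmono [:: j, j & s] a x'|)); last first.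
  rewrite ler_wpM2l ?sqr_ge0//; apply: dmono_le => // i; rewrite mxE.
  by case: eqP => _; rewrite ger0_norm// ltW.
pose N := (a j - count_mem j s)%N.
pose k := (\prod_(i | i != j) (a i) ^_ (count_mem i s))%N.
pose B := \prod_(i | i != j) x 0 i ^+ (a i - count_mem i s).
have cj l i : i != j -> count_mem i (j :: l) = count_mem i l.
  by move=> /negPf ij /=; rewrite eq_sym ij.
have dE (l : seq 'I_n) (y : Rn) : (forall i, i != j -> count_mem i l = count_mem i s) ->
   (forall i, i != j -> y 0 i = x 0 i) ->
   dmono l a y = ((a j) ^_ (count_mem j l) * k)%:R * (y 0 j ^+ (a j - count_mem j l) * B).
  move=> cl yx; rewrite /dmono (bigD1 j)//= [in X in _ * X](bigD1 j)//=.
  congr ((_ * _)%:R * (_ * _)); apply: eq_bigr => i ij; first by rewrite cl.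
  by rewrite cl// yx.
have e1 : dmono s a (x + h *: e_ j) = ((a j) ^_ (count_mem j s) * k)%:R * ((x 0 j + h) ^+ N * B).
  rewrite (dE s)//; last by move=> i /negPf ij; rewrite !mxE ij andbF mulr0 addr0.
  by rewrite !mxE !eqxx mulr1.
have e2 : dmono s a x = ((a j) ^_ (count_mem j s) * k)%:R * (x 0 j ^+ N * B) by rewrite (dE s).
have e3 : dmono (j :: s) a x = ((a j) ^_ (count_mem j s) * k)%:R * (N%:R * x 0 j ^+ N.-1 * B).
  rewrite (dE (j :: s))//; last by move=> i ij; exact: cj.
  rewrite /= eqxx add1n ffactnSr -/N subnS -/N !natrM; ring.
have e4 : `|dmono [:: j, j & s] a x'| =
   ((a j) ^_ (count_mem j s) * k)%:R * ((N * N.-1)%:R * rho ^+ N.-2 * `|B|).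
  rewrite /dmono (bigD1 j)//= [in X in _ * X](bigD1 j)//= mxE eqxx.
  rewrite /= !add1n ffactnSr ffactnSr subnS -/N subnS subnS -/N.
  rewrite normrM ger0_norm ?ler0n// normrM (ger0_norm (exprn_ge0 _ (ltW r0))).
  rewrite (_ : \prod_(i | i != j) (a i) ^_ _ = k)%N; last first.
    by apply: eq_bigr => i /negPf ij; rewrite eq_sym ij.
  rewrite (_ : `|\prod_(i | i != j) _| = `|B|); last first.
    rewrite !normr_prod; apply: eq_bigr => i ij.
    by rewrite mxE (negPf ij) eq_sym (negPf ij) !normrX normr_id.
  by rewrite !natrM; ring.
rewrite e1 e2 e3 e4.
have -> : ((a j) ^_ (count_mem j s) * k)%:R * ((x 0 j + h) ^+ N * B) -
  ((a j) ^_ (count_mem j s) * k)%:R * (x 0 j ^+ N * B) -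
  h * (((a j) ^_ (count_mem j s) * k)%:R * (N%:R * x 0 j ^+ N.-1 * B)) =
  ((a j) ^_ (count_mem j s) * k)%:R * (((x 0 j + h) ^+ N - x 0 j ^+ N - h * (N%:R * x 0 j ^+ N.-1)) * B).
  by ring.
rewrite normrM ger0_norm ?ler0n// [leRHS]mulrCA ler_wpM2l ?ler0n// normrM [leRHS]mulrA ler_wpM2r//.
exact: pow_second_order.
Qed.

(** Locally uniform second-order bounds let the derivative pass to the limit;
    they also force the derivatives to converge. *)
Lemma limit_derivative (u : nat -> R -> R) (g : nat -> R) (U : R -> R) (eta M : R) :
  0 < eta -> 0 <= M ->
  (forall h, `|h| < eta -> u ^~ h @ \oo --> U h) ->
  (forall m h, `|h| < eta -> `|u m h - u m 0 - h * g m| <= M * h ^+ 2) ->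
  exists G, g @ \oo --> G /\ is_derive (0:R) (1:R) (U : R -> R^o) G.
Proof.
move=> eta0 M0 uU uM.
have u0 : u ^~ 0 @ \oo --> U 0 by apply: uU; rewrite normr0.
have : cvg (g @ \oo).
  apply/cauchy_cvgP/cauchy_exP => e e0.
  pose h := Num.min (eta / 2) (e / (2 * (M + 1))).
  have M1 : 0 < M + 1 by rewrite ltr_wpDl.
  have h0 : 0 < h by rewrite /h lt_min !divr_gt0// mulr_gt0.
  have he : `|h| < eta by rewrite gtr0_norm// /h gt_min ltr_pdivrMr// ltr_pMr// ltr1n.
  exists ((U h - U 0) / h).
  have c1 : (fun m => (u m h - u m 0) / h) @ \oo --> (U h - U 0) / h.
    by apply: cvgM; [apply: cvgB => //; exact: uU|exact: cvg_cst].
  have e2 : 0 < e / 2 by rewrite divr_gt0.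
  have /cvgrPdist_lt/(_ _ e2) := c1; apply: filterS => m cm.
  rewrite /ball /= (le_lt_trans (ler_distD ((u m h - u m 0) / h) _ _))//.
  rewrite [ltRHS](splitr e) ltr_leD//.
  have := uM m h he => H.
  have -> : (u m h - u m 0) / h - g m = (u m h - u m 0 - h * g m) / h by field; rewrite gt_eqF.
  rewrite normrM normfV (gtr0_norm h0) ler_pdivrMr// (le_trans H)//.
  rewrite expr2 mulrA ler_wpM2r ?(ltW h0)//.
  have hle : h <= e / (2 * (M + 1)) by rewrite /h ge_min lexx orbT.
  rewrite (le_trans (ler_wpM2l M0 hle))//.
  rewrite mulrA ler_pdivrMr ?mulr_gt0//.
  have -> : e / 2 * (2 * (M + 1)) = e * (M + 1) by field.
  by rewrite mulrC ler_wpM2l ?(ltW e0)// lerDl.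
move=> /cvg_ex[G gG]; exists G; split => //.
have UM h : `|h| < eta -> `|U h - U 0 - h * G| <= M * h ^+ 2.
  move=> he.
  have c : (fun m => u m h - u m 0 - h * g m) @ \oo --> U h - U 0 - h * G.
    apply: cvgB; first by apply: cvgB => //; exact: uU.
    by apply: cvgM => //; exact: cvg_cst.
  apply: (cvgr_to_le (cvg_norm c)).
  by apply: nearW => m; exact: uM.
have E : (fun h : R => h^-1 *: ((U (h *: (1:R) + 0) : R^o) - U 0)) @ 0^' --> (G : R^o).
  apply/cvgrPdist_lt => e e0.
  have M1 : 0 < M + 1 by rewrite ltr_wpDl.
  near=> h.
  have h0 : h != 0 by near: h; exact: nbhs_dnbhs_neq.
  have he : `|h| < eta.
    near: h; apply: nbhs_dnbhs; exists eta => //= t /=; by rewrite sub0r normrN.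
  have he2 : `|h| < e / (M + 1).
    near: h; apply: nbhs_dnbhs; exists (e / (M + 1)) => /=; first by rewrite divr_gt0.
    by move=> t /=; rewrite sub0r normrN.
  rewrite addr0 -[h *: 1]/(h * 1) mulr1 -[_ *: _]/(h^-1 * (U h - U 0)).
  have -> : G - h^-1 * (U h - U 0) = - ((U h - U 0 - h * G) / h) by field.
  rewrite normrN normrM normfV ltr_pdivrMr ?normr_gt0//.
  rewrite (le_lt_trans (UM h he))// -(real_normK (num_real h)) expr2 mulrA.
  rewrite ltr_pM2r ?normr_gt0//.
  rewrite (@le_lt_trans _ _ ((M + 1) * `|h|))//; first by rewrite ler_wpM2r// lerDl.
  by rewrite mulrC -ltr_pdivlMr.
by split; [apply/cvg_ex; eexists; exact: E|apply: (cvg_lim _ E)].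
Unshelve. all: by end_near. Qed.

Section sum_of_series.
Variables (c : idx -> R[i]) (r M : R).
Hypothesis r0 : 0 < r.
Hypothesis cM : forall m, \sum_(al : {ffun 'I_n -> 'I_m})
  cabs (c (box al)) * r ^+ deg (box al) <= M.

Lemma majorant_ge0 : 0 <= M.
Proof.
apply: le_trans (cM 0); apply: sumr_ge0 => al _.
by rewrite mulr_ge0 ?cabs_ge0// exprn_ge0// ltW.
Qed.

(** A radius at which all the derivatives converge together. *)
Let rho := r * expR (- 1).

Let rho0 : 0 < rho.
Proof. by rewrite mulr_gt0// expR_gt0. Qed.

(** On the radius r / e the exponential e ^ (- N) absorbs the factor N ^ q, as
    N ^ q <= q! e ^ N. *)
Lemma majorant_derivatives q m : \sum_(al : {ffun 'I_n -> 'I_m})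
  cabs (c (box al)) * ((deg (box al) ^ q)%:R * (rho ^+ deg (box al) * rho ^- q)) <=
  q`!%:R * rho ^- q * M.
Proof.
have W0 : 0 <= q`!%:R * rho ^- q by rewrite mulr_ge0// invr_ge0 exprn_ge0// ltW.
apply: le_trans (ler_wpM2l W0 (cM m)); rewrite mulr_sumr ler_sum// => al _.
rewrite [leRHS]mulrCA ler_wpM2l ?cabs_ge0//; set N := deg _.
have -> : (N ^ q)%:R * (rho ^+ N * rho ^- q) = N%:R ^+ q * expR (- N%:R) * (rho ^- q * r ^+ N).
  have -> : expR (- N%:R) = expR (- 1) ^+ N :> R by rewrite -expRM_natl mulrN1.
  by rewrite natrX /rho exprMn; ring.
rewrite -[leRHS]mulrA; apply: ler_wpM2r.
  by rewrite mulr_ge0 ?invr_ge0 ?exprn_ge0// ltW.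
have := @expr_le_fact_expR R q N%:R (ler0n _ _) => H.
by rewrite expRN ler_pdivrMr ?expR_gt0.
Qed.

Variable f : Rn -> R[i].
Hypothesis fc : forall x, (forall j, `|x 0 j| < r) ->
  (fun m => cabs (\sum_(al : {ffun 'I_n -> 'I_m})
     c (box al) * (\prod_j x 0 j ^+ (box al) j)%:C - f x)) @ \oo --> (0:R).

Let S s m x := \sum_(al : {ffun 'I_n -> 'I_m}) c (box al) * (dmono s (box al) x)%:C.

Lemma cabs_cvg_ReIm (v : nat -> R[i]) z : (fun m => cabs (v m - z)) @ \oo --> (0:R) <->
  (fun m => complex.Re (v m)) @ \oo --> complex.Re z /\
  (fun m => complex.Im (v m)) @ \oo --> complex.Im z.
Proof.
split=> [vz|[v1 v2]].
  split; apply/cvgrPdist_lt => e e0; have /cvgrPdist_lt/(_ e e0) := vz;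
    apply: filterS => m; rewrite sub0r normrN (ger0_norm (cabs_ge0 _)); apply: le_lt_trans.
    by rewrite -cReN -cReD -cabsN opprB normr_Re_le.
  by rewrite -cImN -cImD -cabsN opprB normr_Im_le.
apply: (@cvg_norm_le0 _ _ (fun m => `|complex.Re (v m) - complex.Re z| +
   `|complex.Im (v m) - complex.Im z|)) => [m|].
  rewrite ger0_norm ?cabs_ge0// (le_trans (cabs_le_ReIm _))//.
  by rewrite cReD cReN cImD cImN.
rewrite -[X in _ --> X]addr0; apply: cvgD.
  rewrite -(@normr0 _ R) -(subrr (complex.Re z)); apply: cvg_norm.
  by apply: cvgB => //; exact: cvg_cst.
rewrite -(@normr0 _ R) -(subrr (complex.Im z)); apply: cvg_norm.
by apply: cvgB => //; exact: cvg_cst.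
Qed.

(** Induction on s: the partial sums of the derivatives along s converge, and their
    second-order differences are bounded uniformly in m. *)
Lemma series_derivatives s x : (forall j, `|x 0 j| < rho) ->
  (fun m => cabs (S s m x - pderivs s f x)) @ \oo --> (0:R).
Proof.
elim: s x => [|j s IH] x xr.
  have := fc (x := x); rewrite /S /=.
  under [in X in _ -> X]eq_fun do under eq_bigr do rewrite dmono_nil.
  apply => i; rewrite (lt_trans (xr i))// /rho -[ltRHS]mulr1 ltr_pM2l//.
pose eta := rho - `|x 0 j|.
have eta0 : 0 < eta by rewrite subr_gt0.
pose M' := (size s).+2`!%:R * rho ^- (size s).+2 * M.
have M'0 : 0 <= M'.
  by rewrite !mulr_ge0 ?majorant_ge0// invr_ge0 exprn_ge0// ltW.
have xh h : `|h| < eta -> `|x 0 j + h| < rho.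
  by move=> he; rewrite (le_lt_trans (ler_normD _ _))// -ltrBrDl.
have line h : `|h| < eta -> forall i, `|(x + h *: e_ j) 0 i| < rho.
  move=> he i; rewrite !mxE eqxx /=; have [->|ij] := eqVneq i j.
    by rewrite mulr1 xh.
  by rewrite mulr0 addr0.
have bound m h : `|h| < eta ->
    cabs (S s m (x + h *: e_ j) - S s m x - h%:C * S (j :: s) m x) <= M' * h ^+ 2.
  move=> he; rewrite /S mulr_sumr -!sumrB (le_trans (cabs_sum _ _ _))//.
  rewrite [leRHS]mulrC (le_trans _ (ler_wpM2l (sqr_ge0 h) (majorant_derivatives (size s).+2 m)))//.
  rewrite mulr_sumr ler_sum// => al _.
  rewrite mulrCA -!mulrBr -rmorphM /= -!rmorphB /= cabsM cabs_real [leRHS]mulrCA.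
  rewrite ler_wpM2l ?cabs_ge0//; apply: dmono_second_order => // [i|]; first exact: ltW.
  exact/ltW/xh.
have key (p : R[i] -> R) : (forall z w, p (z + w) = p z + p w) ->
   (forall z, p (- z) = - p z) -> (forall t z, p (t%:C * z) = t * p z) ->
   (forall z, `|p z| <= cabs z) ->
   (forall y : Rn, (forall i, `|y 0 i| < rho) ->
     (fun m => p (S s m y)) @ \oo --> p (pderivs s f y)) ->
   exists G, (fun m => p (S (j :: s) m x)) @ \oo --> G /\
     'D_(e_ j) ((fun y => p (pderivs s f y)) : Rn -> R^o) x = G.
  move=> pD pN pZ ple cp.
  have pB m h : `|h| < eta -> `|p (S s m (x + h *: e_ j)) - p (S s m (x + 0 *: e_ j)) -
      h * p (S (j :: s) m x)| <= M' * h ^+ 2.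
    move=> he; rewrite scale0r addr0 -pZ -!pN -!pD.
    exact: le_trans (ple _) (bound m h he).
  have [G [c1 c2]] := @limit_derivative (fun m h => p (S s m (x + h *: e_ j)))
    (fun m => p (S (j :: s) m x)) (fun h => p (pderivs s f (x + h *: e_ j))) eta M' eta0 M'0
    (fun h he => cp _ (line h he)) pB.
  exists G; split => //.
  by case: (@is_derive_of_line _ _ (fun y => p (pderivs s f y)) x (e_ j) G c2).
have cRe (y : Rn) : (forall i, `|y 0 i| < rho) ->
     (fun m => complex.Re (S s m y)) @ \oo --> complex.Re (pderivs s f y).
  by move=> /(IH y)/cabs_cvg_ReIm[].
have cIm (y : Rn) : (forall i, `|y 0 i| < rho) ->
     (fun m => complex.Im (S s m y)) @ \oo --> complex.Im (pderivs s f y).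
  by move=> /(IH y)/cabs_cvg_ReIm[].
have ReZ t (z : R[i]) : complex.Re (t%:C * z) = t * complex.Re z.
  by rewrite cReM /= mul0r subr0.
have ImZ t (z : R[i]) : complex.Im (t%:C * z) = t * complex.Im z.
  by rewrite cImM /= mul0r addr0.
have [G1 [g1 d1]] := key (@complex.Re R) (@cReD R) (@cReN R) ReZ
  (@normr_Re_le R) cRe.
have [G2 [g2 d2]] := key (@complex.Im R) (@cImD R) (@cImN R) ImZ
  (@normr_Im_le R) cIm.
by apply/cabs_cvg_ReIm; rewrite /= /pderiv /= d1 d2.
Qed.


Definition counts s : idx := [ffun j => count_mem j s].

Lemma dmono_at0 s a : dmono s a 0 = if a == counts s then (\prod_j (a j)`!)%:R else 0.
Proof.
rewrite /dmono; case: eqP => [->|ne].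
  rewrite [X in _ * X]big1 ?mulr1 => [|j _]; last by rewrite ffunE subnn expr0.
  by congr _%:R; apply: eq_bigr => j _; rewrite ffunE ffactnn.
have [j jne] : exists j, a j != count_mem j s.
  apply/existsP; apply: contra_notT ne; rewrite negb_exists => /forallP H.
  by apply/ffunP => j; rewrite ffunE; apply/eqP; rewrite -[_ == _]negbK H.
have [lt|ge] := ltnP (a j) (count_mem j s).
  by rewrite (bigD1 j)//= ffact_small// mul0n mul0r.
rewrite [X in _ * X](bigD1 j)//= mxE expr0n subn_eq0 leqNgt ltn_neqAle ge.
by rewrite eq_sym jne /= mul0r mulr0.
Qed.

Lemma count_le_size j s : (count_mem j s <= size s)%N.
Proof. exact: count_size. Qed.

Lemma box_onto m a : (forall j, (a j < m)%N) -> exists al : {ffun 'I_n -> 'I_m}, box al = a.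
Proof.
move=> am; exists [ffun j => Ordinal (am j)].
by apply/ffunP => j; rewrite !ffunE.
Qed.

Lemma sum_box_eq m (F : idx -> R[i]) a : (forall j, (a j < m)%N) ->
  \sum_(al : {ffun 'I_n -> 'I_m}) (if box al == a then F (box al) else 0) = F a.
Proof.
move=> am; have [al0 <-] := box_onto am.
rewrite (bigD1 al0)//= eqxx big1 ?addr0// => al ne.
by rewrite (inj_eq (@box_inj m)) (negPf ne).
Qed.

Lemma derivatives_at0 s :
  pderivs s f 0 = c (counts s) * (\prod_j (counts s j)`!)%:R.
Proof.
have z0 : forall j : 'I_n, `|(0 : Rn) 0 j| < rho by move=> j; rewrite mxE normr0.
have H := series_derivatives s z0.
apply/eqP; rewrite eq_sym -subr_eq0 -cabs_eq0; apply/eqP.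
have c2 : (fun m => cabs (S s m 0 - pderivs s f 0)) @ \oo -->
    cabs (c (counts s) * (\prod_j (counts s j)`!)%:R - pderivs s f 0).
  apply: cvg_near_cst; exists (size s).+1 => // m /= sm; congr (cabs (_ - _)).
  rewrite /S; transitivity (\sum_(al : {ffun 'I_n -> 'I_m}) (if box al == counts s then
     c (box al) * (\prod_j (box al j)`!)%:R else 0)).
    apply: eq_bigr => al _; rewrite dmono_at0; case: eqP => _.
      by rewrite rmorph_nat.
    by rewrite mulr0.
  rewrite (@sum_box_eq _ (fun a => c a * (\prod_j (a j)`!)%:R))// => j.
  by rewrite ffunE (leq_ltn_trans (count_le_size j s)).
exact: (cvg_unique _ c2 H).
Qed.

Lemma counts_perm s s' : perm_eq s s' -> counts s = counts s'.
Proof. by move=> /permP H; apply/ffunP => j; rewrite !ffunE H. Qed.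

End sum_of_series.

(** It relates sums over index sequences to sums over multi-indices. Induction
    on l: removing the first index j of a sequence lowers the j-th multiplicity
    by one. *)
Lemma multinomial_count l a :
  ((\sum_(X : l.-tuple 'I_n) (a == counts X)) * \prod_j (a j)`! =
   l`! * (deg a == l))%N.
Proof.
elim: l a => [|l IH] a.
  rewrite (big_pred1 [tuple]); last by move=> X; apply/esym/eqP; exact: tuple0.
  have -> : (a == counts [tuple]) = (deg a == 0)%N.
    apply/eqP/eqP => [->|d0].
      by rewrite /deg big1// => j _; rewrite ffunE.
    by apply/ffunP => j; rewrite ffunE /=; apply/eqP; rewrite -leqn0 -d0 deg_ge.
  have [d0|_] := eqVneq (deg a) 0%N; last by rewrite mul0n.
  by rewrite big1 // => j _; have := deg_ge a j; rewrite d0 leqn0 => /eqP ->.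
pose sub1 j : idx := [ffun i => if i == j then (a i).-1 else a i].
have cE j (X : l.-tuple 'I_n) :
    (a == counts (j :: X)) = (0 < a j)%N && (sub1 j == counts X).
  apply/eqP/andP => [aE|[aj /eqP E]].
    rewrite {1}aE ffunE /= eqxx; split=> //; apply/eqP/ffunP => i.
    rewrite !ffunE aE !ffunE /=; by case: (eqVneq i j) => [->|ij]; rewrite ?add1n ?add0n.
  apply/ffunP => i; have := congr1 (fun g : idx => g i) E; rewrite !ffunE /=.
  by case: (eqVneq i j) => [->|_] // <-; rewrite add1n prednK.
rewrite (reindex (fun p : 'I_n * l.-tuple 'I_n => [tuple of p.1 :: p.2])) /=; last first.
  exists (fun X : l.+1.-tuple 'I_n => (thead X, [tuple of behead X])) => [[j X] _|X _] /=.
    by congr (_, _); apply: val_inj.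
  by rewrite [RHS]tuple_eta; apply: val_inj.
rewrite -(pair_big xpredT xpredT (fun j (X : l.-tuple 'I_n) => (a == counts (j :: X)) : nat)) /=.
rewrite big_distrl /=.
have step j : ((\sum_(X : l.-tuple 'I_n) (a == counts (j :: X))) * \prod_j (a j)`! =
   a j * (l`! * (deg a == l.+1)))%N.
  rewrite (eq_bigr (fun X : l.-tuple 'I_n => ((0 < a j) && (sub1 j == counts X))%N : nat)); last first.
    by move=> X _; rewrite -cE.
  have [->|aj] := posnP (a j); first by rewrite big1.
  have -> : (\prod_j (a j)`! = a j * \prod_i (sub1 j i)`!)%N.
    rewrite (bigD1 j)//= [in RHS](bigD1 j)//= ffunE eqxx mulnA; congr (_ * _)%N.
      by rewrite -{1 2}(prednK aj) factS.
    by apply: eq_bigr => i /negPf ij; rewrite ffunE ij.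
  rewrite mulnCA; congr (_ * _)%N; rewrite IH; congr (_ * (_ : bool))%N.
  have -> : deg a = (deg (sub1 j)).+1; last by rewrite eqSS.
  rewrite /deg (bigD1 j)//= [in RHS](bigD1 j)//= ffunE eqxx -addSn prednK//.
  by congr addn; apply: eq_bigr => i /negPf ij; rewrite ffunE ij.
under eq_bigr do rewrite step.
rewrite -big_distrl /= -/(deg a) factS.
by have [->|_] := eqVneq (deg a) l.+1; [rewrite !muln1|rewrite !muln0].
Qed.

End power_series.

(** * Taylor polynomials of the symbol *)

Section measurability_of_continuous.
Context {R : realType} {n : nat}.
Local Notation T := (n.-tuple (measurableTypeR R)).

(** An open set is a countable union of rational boxes, and boxes are measurable
    for the product structure on tuples. *)
Lemma measurable_trow_open (U : set 'rV[R]_n) : open U ->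
  measurable ((@trow R n) @^-1` U : set T).
Proof.
move=> oU.
pose e (k : nat) : R := k.+1%:R^-1.
pose F (kq : nat * {ffun 'I_n -> rat}) : set T :=
  [set x | forall j, `|tnth x j - ratr (kq.2 j)| < e kq.1].
pose P (kq : nat * {ffun 'I_n -> rat}) : Prop := F kq `<=` (@trow R n) @^-1` U.
have mF kq : measurable (F kq).
  have -> : F kq = ~` \bigcup_(j in [set: 'I_n]) ~` [set x : T | `|tnth x j - ratr (kq.2 j)| < e kq.1].
    apply/seteqP; split=> [x Fx [j _]|x Fx j]; first by apply; exact: Fx.
    by apply: contrapT => h; apply: Fx; exists j.
  apply: measurableC; apply: fin_bigcup_measurable => // j _; apply: measurableC.
  have mf : measurable_fun setT (fun x : T => `|tnth x j - ratr (kq.2 j)|).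
    apply: measurableT_comp => //; apply: measurable_funB => //.
    exact: measurable_tnth.
  have -> : [set x : T | `|tnth x j - ratr (kq.2 j)| < e kq.1] =
      setT `&` (fun x : T => `|tnth x j - ratr (kq.2 j)|) @^-1` `]-oo, e kq.1[%classic.
    by rewrite setTI predeqE => x; rewrite /= in_itv.
  by apply: mf => //; exact: measurable_itv.
have -> : (@trow R n) @^-1` U = \bigcup_(kq in [set kq | P kq]) F kq.
  rewrite predeqE => x; split=> [Ux|[kq Pkq Fx]]; last exact: Pkq.
  have := oU; rewrite openE => /(_ _ Ux); rewrite /interior => /nbhs_ballP[d /= d0 dU].
  have [k kd] : exists k, e k < d / 2.
    exists (Num.truncn (2 / d)); rewrite /e -[ltRHS]invf_div ltf_pV2 ?posrE ?divr_gt0 ?ltr0n//.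
    exact: truncnS_gt.
  have /choice[q Hq] : forall j, exists q : rat, `|tnth x j - ratr q| < e k.
    move=> j; have e0 : 0 < e k by rewrite invr_gt0 ltr0n.
    have lt : tnth x j - e k < tnth x j + e k by rewrite ltrD2l gtrN.
    have [q] := rat_in_itvoo lt.
    rewrite in_itv /= => /andP[q1 q2]; exists q.
    by rewrite distrC ltr_distl q1 q2.
  exists (k, [ffun j => q j]); last by move=> j; rewrite /= ffunE.
  move=> y Fy /=; apply: dU.
  split => // i j; rewrite !mxE /ball /=.
  have := Fy j; rewrite /= ffunE => Hy.
  rewrite (le_lt_trans (ler_distD (ratr (q j)) _ _))// [ltRHS](splitr d).
  by rewrite ltrD// ?(lt_trans (Hq j))// distrC (lt_trans Hy).
rewrite bigcup_mkcond.
apply: (@countable_bigcupT_measurable _ T _ (fun kq => if kq \in [set kq | P kq] then F kq else set0)).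
  exact: countableP.
by move=> kq; case: ifP.
Qed.

Lemma measurable_continuous_trow (f : 'rV[R]_n -> R) : continuous f ->
  measurable_fun setT (fun x : T => f (trow x)).
Proof.
move=> cf; apply: (measurability _ (RGenOpens.measurableE R)).
move=> _ [_ [a [b ->] <-]]; rewrite setTI.
have oI : open `]a, b[%classic by exact: interval_open.
by have := measurable_trow_open (open_comp (fun x _ => cf x) oI).
Qed.

End measurability_of_continuous.

Section symbol_expansion.
Context {R : realType} {n : nat}.
Local Notation T := (n.-tuple (measurableTypeR R)).
Local Notation idx := ({ffun 'I_n -> nat}).
Variable Psi : 'rV[R[i]]_n -> R[i].

Definition cmono (a : idx) (z : 'I_n -> R[i]) : R[i] := \prod_j z j ^+ a j.

Lemma prod_counts (s : seq 'I_n) (z : 'I_n -> R[i]) :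
  \prod_(i <- s) z i = cmono (counts s) z.
Proof.
rewrite /cmono; elim: s => [|k s IH].
  by rewrite big_nil big1// => j _; rewrite ffunE expr0.
rewrite big_cons IH.
have -> : z k = \prod_j z j ^+ (k == j).
  rewrite (bigD1 k)//= eqxx expr1 big1 ?mulr1// => j /negPf jk.
  by rewrite eq_sym jk expr0.
by rewrite -big_split; apply: eq_bigr => j _; rewrite !ffunE /= exprD.
Qed.

(** The Taylor polynomial of degree below K, as a sum over index sequences: this
    is the form in which the coefficients C enter the Feynman rules. *)
Definition taylor_poly (K : nat) (z : 'I_n -> R[i]) : R[i] :=
  \sum_(l < K) (l`!%:R)^-1 * \sum_(X : l.-tuple 'I_n)
    (Ccoef Psi X * \prod_(i <- X) z i).

(** The same polynomial as a sum over multi-indices, where it is a truncation of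
    the convergent power series. *)
Lemma taylor_poly_box (c : idx -> R[i]) (K m : nat) (z : 'I_n -> R[i]) :
  (forall s, Ccoef Psi s = c (counts s) * (\prod_j (counts s j)`!)%:R) -> (K <= m)%N ->
  taylor_poly K z = \sum_(al : {ffun 'I_n -> 'I_m} | (deg (box al) < K)%N)
    c (box al) * cmono (box al) z.
Proof.
move=> cE Km; pose H a := c a * (\prod_j (a j)`!)%:R * cmono a z.
have step (l : 'I_K) : (l`!%:R)^-1 * \sum_(X : l.-tuple 'I_n)
    (Ccoef Psi X * \prod_(i <- X) z i) =
    \sum_(al : {ffun 'I_n -> 'I_m}) (deg (box al) == l)%:R * (c (box al) * cmono (box al) z).
  have E X : Ccoef Psi (tval X) * \prod_(i <- tval X) z i =
      \sum_(al : {ffun 'I_n -> 'I_m}) (box al == counts (X : l.-tuple 'I_n))%:R * H (box al).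
    rewrite cE prod_counts -/(H _) -(@sum_box_eq _ _ m H); last first.
      move=> j; rewrite ffunE (leq_ltn_trans (count_le_size _ _))// size_tuple.
      exact: leq_trans (ltn_ord l) Km.
    by apply: eq_bigr => al _; case: eqP => _; rewrite ?mul1r ?mul0r.
  under eq_bigr do rewrite E.
  rewrite exchange_big mulr_sumr; apply: eq_bigr => al _ /=.
  rewrite -mulr_suml -natr_sum /H.
  have := multinomial_count l (box al) => /(congr1 (fun k => k%:R : R[i])).
  rewrite !natrM => N.
  have f0 : (l`!%:R : R[i]) != 0 by rewrite pnatr_eq0 -lt0n fact_gt0.
  apply: (mulfI f0); rewrite (mulVKf f0).
  rewrite [RHS]mulrA -N; ring.
rewrite /taylor_poly (eq_bigr _ (fun l _ => step l)) exchange_big /=.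
rewrite [RHS]big_mkcond; apply: eq_bigr => al _; rewrite -mulr_suml.
case: ltnP => [lt|ge].
  rewrite (bigD1 (Ordinal lt))//= eqxx big1 ?addr0 ?mul1r// => i.
  by rewrite -val_eqE /= eq_sym => /negPf ->.
rewrite big1 ?mul0r// => i _.
by rewrite gtn_eqF// (leq_trans (ltn_ord i) ge).
Qed.

Hypothesis P1 : analytic_at Psi 0.

Lemma analytic_data : exists (c : idx -> R[i]) (r M : R), [/\ 0 < r,
  forall m, \sum_(al : {ffun 'I_n -> 'I_m}) cabs (c (box al)) * r ^+ deg (box al) <= M,
  forall z : 'I_n -> R[i], (forall j, cabs (z j) < r) ->
    (fun m => cabs (\sum_(al : {ffun 'I_n -> 'I_m}) c (box al) * cmono (box al) z -
       Psi (\row_j z j))) @ \oo --> (0:R) &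
  forall s, Ccoef Psi s = c (counts s) * (\prod_j (counts s j)`!)%:R].
Proof.
have [c [r [r0 fin cv]]] := P1.
set E := (\esum_(al in _) _)%E in fin.
have E0 : (0 <= E)%E.
  by apply: esum_ge0 => a _; rewrite lee_fin mulr_ge0 ?cabs_ge0// exprn_ge0// ltW.
have EM : E = (fine E)%:E by rewrite fineK// ge0_fin_numE.
have cM m : \sum_(al : {ffun 'I_n -> 'I_m}) cabs (c (box al)) * r ^+ deg (box al) <= fine E.
  rewrite -lee_fin -EM; apply: esum_ge.
  pose sq := [seq box al | al <- index_enum {ffun 'I_n -> 'I_m}].
  have us : uniq sq by rewrite map_inj_uniq ?index_enum_uniq//; exact: box_inj.
  exists [set` sq]; first by split => //; exact: finite_seq.
  rewrite -fsbig_seq// big_map sumEFin lee_fin.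
  by rewrite le_eqVlt; apply/orP; left; apply/eqP; apply: eq_bigr.
have cz (z : 'I_n -> R[i]) : (forall j, cabs (z j) < r) ->
    (fun m => cabs (\sum_(al : {ffun 'I_n -> 'I_m}) c (box al) * cmono (box al) z -
       Psi (\row_j z j))) @ \oo --> (0:R).
  move=> zr; have := cv (\row_j z j).
  have H j : cabs ((\row_j z j) 0 j - (0 : 'rV[R[i]]_n) 0 j) < r.
    by rewrite !mxE subr0.
  move=> /(_ H); apply: cvg_trans; apply: near_eq_cvg; apply: nearW => m.
  congr (cabs (_ - _)); apply: eq_bigr => al _; congr (_ * _).
  by apply: eq_bigr => j _; rewrite !mxE subr0 ffunE.
exists c, r, (fine E); split => // s.
apply: (@derivatives_at0 _ _ c r (fine E) r0 cM) => x xr.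
have := cz (fun j => (x 0 j)%:C).
have H j : cabs (x 0 j)%:C < r by rewrite cabs_real.
move=> /(_ H); apply: cvg_trans; apply: near_eq_cvg; apply: nearW => m.
congr (cabs (_ - _)); last by rewrite /of_real; congr Psi; apply/rowP => j; rewrite !mxE.
apply: eq_bigr => al _; congr (_ * _).
by rewrite rmorph_prod; apply: eq_bigr => j _; rewrite rmorphXn.
Qed.

(** Symmetry of the iterated derivatives at 0, read off from the power series. *)
Lemma Ccoef_perm s s' : perm_eq s s' -> Ccoef Psi s = Ccoef Psi s'.
Proof.
have [c [r [M [_ _ _ H]]]] := analytic_data.
by move=> ss'; rewrite !H (counts_perm ss').
Qed.

Lemma Ccoef_nil : Ccoef Psi [::] = Psi 0.
Proof. by rewrite /Ccoef /= /of_real map_mx0. Qed.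

(** The argument - i xi at which the symbol evaluates Psi. *)
Definition mi (xi : 'rV[R]_n) (j : 'I_n) : R[i] := - 'i%C * (xi 0 j)%:C.

Lemma cabs_mi xi j : cabs (mi xi j) = `|xi 0 j|.
Proof.
rewrite /mi cabsM cabsN cabs_real (_ : cabs 'i%C = 1) ?mul1r//.
by rewrite cabsE /= expr0n add0r expr1n sqrtr1.
Qed.

Lemma symbolE xi : symbol Psi xi = Psi (\row_j mi xi j).
Proof. by congr Psi; apply/rowP => j; rewrite !mxE. Qed.

(** Terms of degree at least K gain the factor (|xi| / r) ^ K. *)
Lemma symbol_taylor : exists r M : R, [/\ 0 < r, 0 <= M & forall K (xi : 'rV[R]_n), `|xi| < r ->
  cabs (symbol Psi xi - taylor_poly K (mi xi)) <= M * (`|xi| / r) ^+ K].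
Proof.
have [c [r [M [r0 cM cz cE]]]] := analytic_data.
exists r, M; split => //; first exact: (majorant_ge0 r0 cM).
move=> K xi xr.
have zr j : cabs (mi xi j) < r by rewrite cabs_mi (le_lt_trans (norm_coord_le _ _)).
have H := cz _ zr.
have H2 : (fun m => cabs (\sum_(al : {ffun 'I_n -> 'I_m}) c (box al) * cmono (box al) (mi xi) -
       Psi (\row_j mi xi j)) + M * (`|xi| / r) ^+ K) @ \oo --> 0 + M * (`|xi| / r) ^+ K.
  by apply: cvgD => //; exact: cvg_cst.
rewrite -[leRHS]add0r; apply: (cvgr_to_ge H2).
exists K => // m /= Km; rewrite symbolE.
set S := (X in _ <= cabs (X - _) + _).
rewrite (_ : Psi _ - _ = (Psi (\row_j mi xi j) - S) + (S - taylor_poly K (mi xi))); last first.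
  by rewrite addrA subrK.
rewrite (le_trans (cabsD _ _))// lerD//; first by rewrite cabs_distC.
rewrite /S.
rewrite (taylor_poly_box _ cE Km) (bigID (fun al => (deg (box al) < K)%N)) /=.
rewrite addrAC subrr add0r (le_trans (cabs_sum _ _ _))//.
have t0 : 0 <= `|xi| / r by rewrite divr_ge0// ltW.
have := ler_wpM2r (exprn_ge0 K t0) (cM m); apply: le_trans.
rewrite mulr_suml [leRHS](bigID (fun al => (deg (box al) < K)%N)) /=.
rewrite -[leLHS]add0r lerD//.
  by rewrite sumr_ge0// => al _; rewrite !mulr_ge0 ?cabs_ge0 ?exprn_ge0// ltW.
apply: ler_sum => al; rewrite -leqNgt => dK.
rewrite cabsM -mulrA ler_wpM2l ?cabs_ge0//.
rewrite (@le_trans _ _ (`|xi| ^+ deg (box al)))//.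
  rewrite cabs_prod /deg -prodrXr; apply: ler_prod => j _.
  by rewrite cabs_ge0 cabsX cabs_mi lerXn2r ?nnegrE// norm_coord_le.
have -> : `|xi| = r * (`|xi| / r) by rewrite mulrCA mulfV ?mulr1// gt_eqF.
rewrite exprMn ler_wpM2l ?exprn_ge0 ?(ltW r0)//.
rewrite [X in (X / _) ^+ K](_ : r * (`|xi| / r) = `|xi|); last first.
  by rewrite mulrCA mulfV ?mulr1// gt_eqF.
by rewrite ler_wiXn2l// ler_pdivrMr// mul1r ltW.
Qed.

Definition op_mul (a b : seq (R[i] * seq 'I_n)) : seq (R[i] * seq 'I_n) :=
  [seq (p.1 * q.1, p.2 ++ q.2) | p <- a, q <- b].

Definition op_exp (a : seq (R[i] * seq 'I_n)) k :=
  iter k (fun b => op_mul b a) [:: (1, [::])].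

Definition op_taylor K : seq (R[i] * seq 'I_n) :=
  flatten [seq [seq ((l`!%:R)^-1 * Ccoef Psi X, tval X) | X : l.-tuple 'I_n] | l <- iota 0 K].

(** Truncation of exp (t Psi) as an operator: the exponential series is cut at
    order K, and Psi is replaced by its Taylor polynomial. *)
Definition op_multiplier (t : R) K : seq (R[i] * seq 'I_n) :=
  flatten [seq [seq ((k`!%:R)^-1 * t%:C ^+ k * p.1, p.2) | p <- op_exp (op_taylor K) k]
          | k <- iota 0 K].

Lemma op_poly_mul a b xi : op_poly (op_mul a b) xi = op_poly a xi * op_poly b xi.
Proof.
rewrite /op_poly /op_mul big_allpairs_dep /= mulr_suml; apply: eq_bigr => p _.
rewrite mulr_sumr; apply: eq_bigr => q _ /=.
by rewrite big_cat /= mulrACA.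
Qed.

Lemma op_poly_exp a k xi : op_poly (op_exp a k) xi = op_poly a xi ^+ k.
Proof.
elim: k => [|k IH]; first by rewrite /op_poly big_seq1 /= big_nil mulr1.
by rewrite /= op_poly_mul IH exprSr.
Qed.

Lemma op_poly_taylor K xi : op_poly (op_taylor K) xi = taylor_poly K (mi xi).
Proof.
rewrite /op_poly /op_taylor big_flatten big_map /= -[K in iota 0 K]subn0 big_mkord.
apply: eq_bigr => l _; rewrite big_image /= mulr_sumr.
by apply: eq_bigr => X _; rewrite mulrA.
Qed.

Lemma op_poly_multiplier t K xi :
  op_poly (op_multiplier t K) xi = exp_trunc K (t%:C * taylor_poly K (mi xi)).
Proof.
rewrite /op_poly /op_multiplier big_flatten big_map /= -[X in iota 0 X]subn0 big_mkord.
apply: eq_bigr => k _; rewrite big_map /=.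
rewrite exprMn -op_poly_taylor -op_poly_exp /op_poly !mulr_sumr.
by apply: eq_bigr => p _; rewrite !mulrA.
Qed.

End symbol_expansion.

(** * Approximation of the multiplier *)

Section multiplier_expansion.
Context {R : realType} {n : nat}.
Local Notation T := (n.-tuple (measurableTypeR R)).
Variable Psi : 'rV[R[i]]_n -> R[i].

Lemma norm_expr_le_sum (x : 'rV[R]_n) K : (0 < K)%N ->
  `|x| ^+ K <= \sum_(j < n) `|x 0 j| ^+ K.
Proof.
move=> K0; have [x0|x0] := eqVneq `|x| 0.
  by rewrite x0 expr0n gtn_eqF// sumr_ge0// => j _; rewrite exprn_ge0.
have [[i j] /= ij] := mx_norm_neq0 x0.
rewrite (_ : `|x| = `|x 0 j|); last by rewrite -[LHS]/(mx_norm x) ij (ord1 i).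
by rewrite (bigD1 j)//= lerDl sumr_ge0// => k _; rewrite exprn_ge0.
Qed.

Lemma sum_le_bw (xi : T) : 1 + \sum_(j < n) tnth xi j ^+ 2 <= bw xi.
Proof.
have : 0 <= \sum_(j < n) tnth xi j ^+ 2 /\ 1 + \sum_(j < n) tnth xi j ^+ 2 <= bw xi.
  rewrite /bw; elim/big_rec2 : _ => [|j y x _ [x0 H]]; first by rewrite addr0.
  have y0 : 0 <= tnth xi j ^+ 2 by exact: sqr_ge0.
  by split; [exact: addr_ge0|nra].
by case.
Qed.

Lemma bw_ge_coord (xi : T) j : `|tnth xi j| <= bw xi.
Proof.
apply: le_trans (sum_le_bw xi); rewrite (bigD1 j)//=.
have : 0 <= \sum_(i < n | i != j) tnth xi i ^+ 2.
  by rewrite sumr_ge0// => i _; exact: sqr_ge0.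
rewrite -(real_normK (num_real (tnth xi j))).
by move: `|_| (normr_ge0 (tnth xi j)) => y y0 s0; nra.
Qed.

Lemma enorm_le_bw (xi : T) : enorm (trow xi) <= bw xi.
Proof.
have b1 := bw_ge1 xi; have b0 : 0 <= bw xi by lra.
rewrite /enorm -[leRHS]ger0_norm// -sqrtr_sqr ler_wsqrtr//.
have -> : dot (trow xi) (trow xi) = \sum_(j < n) tnth xi j ^+ 2.
  by apply: eq_bigr => j _; rewrite !mxE expr2.
have := sum_le_bw xi; nra.
Qed.

Lemma op_poly_growth (tau : seq (R[i] * seq 'I_n)) : exists (C : R) (M : nat),
  0 <= C /\ forall xi : T, cabs (op_poly tau (trow xi)) <= C * bw xi ^+ M.
Proof.
elim: tau => [|[c s] tau [C [M [C0 H]]]].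
  by exists 0, 0%N; split=> // xi; rewrite /op_poly big_nil cabs0 mul0r.
exists (cabs c + C), (size s + M)%N; split; first by rewrite addr_ge0 ?cabs_ge0.
move=> xi; have b1 := bw_ge1 xi.
rewrite /op_poly big_cons (le_trans (cabsD _ _))// mulrDl lerD//=; last first.
  rewrite (le_trans (H xi))// ler_wpM2l// ler_weXn2l// leq_addl.
  by [].
rewrite cabsM ler_wpM2l ?cabs_ge0// (@le_trans _ _ (bw xi ^+ size s))//; last first.
  by rewrite ler_weXn2l// leq_addr.
rewrite cabs_prod.
elim: s => [|j s IH]; first by rewrite big_nil expr0.
rewrite big_cons /= exprS ler_pM ?cabs_ge0//.
  by rewrite prodr_ge0// => i _; exact: cabs_ge0.
by rewrite -/(mi (trow xi) j) cabs_mi mxE bw_ge_coord.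
Qed.

Lemma cmeasurable_multiplier (t : R) : smooth (symbol Psi) ->
  cmeasurable (fun xi : 'rV[R]_n => cexp (t%:C * symbol Psi xi)).
Proof.
move=> /(_ [::]) [cR cI _].
have mR := measurable_continuous_trow cR; have mI := measurable_continuous_trow cI.
have mtR : measurable_fun setT (fun xi : T => complex.Re (t%:C * symbol Psi (trow xi))).
  under eq_fun do rewrite cReM /= mul0r subr0.
  exact: (measurable_funM (measurable_cst _) mR).
have mtI : measurable_fun setT (fun xi : T => complex.Im (t%:C * symbol Psi (trow xi))).
  under eq_fun do rewrite cImM /= mul0r addr0.
  exact: (measurable_funM (measurable_cst _) mI).
have mE := measurableT_comp (@measurable_expR R) mtR.
have mC : measurable_fun setT (cos : R -> R) := continuous_measurable_fun (@continuous_cos R).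
have mS : measurable_fun setT (sin : R -> R) := continuous_measurable_fun (@continuous_sin R).
split.
  under eq_fun do rewrite Re_cexp.
  exact: (measurable_funM mE (measurableT_comp mC mtI)).
under eq_fun do rewrite Im_cexp.
exact: (measurable_funM mE (measurableT_comp mS mtI)).
Qed.

Hypothesis Psi0 : Psi 0 = 0.
Hypothesis P1 : analytic_at Psi 0.
Hypothesis P2 : exists2 c : R, 0 < c &
  forall xi : 'rV[R]_n, complex.Re (symbol Psi xi) <= c * ln (1 + enorm xi).

Lemma taylor_poly1 z : taylor_poly Psi 1 z = 0.
Proof.
rewrite /taylor_poly big_ord1 (_ : \sum_(X : 0.-tuple 'I_n) _ = 0) ?mulr0//.
by rewrite big1// => X _; rewrite tuple0 Ccoef_nil Psi0 mul0r.
Qed.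

(** Both truncations are of order K at the origin, the second one because Psi has
    no constant term. *)
Lemma multiplier_near (t : R) K : 0 <= t -> (0 < K)%N ->
  exists r C : R, [/\ 0 < r, 0 <= C & forall xi : 'rV[R]_n, `|xi| < r ->
    cabs (cexp (t%:C * symbol Psi xi) - op_poly (op_multiplier Psi t K) xi) <=
    C * `|xi| ^+ K].
Proof.
move=> t0 K0; have [r [M [r0 M0 H]]] := symbol_taylor P1.
pose A := t * M; have A0 : 0 <= A by rewrite mulr_ge0.
pose C := expR (2 * A) * (2 * A * expR A) + (4 * A) ^+ K * expR (2 * A).
have C0 : 0 <= C.
  have A2 : 0 <= 2 * A by rewrite mulr_ge0.
  have A4 : 0 <= 4 * A by rewrite mulr_ge0.
  by apply: addr_ge0; apply: mulr_ge0; rewrite ?expR_ge0 ?exprn_ge0 ?mulr_ge0 ?expR_ge0.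
exists r, (C / r ^+ K); split => //; first by rewrite divr_ge0 ?exprn_ge0 ?(ltW r0).
move=> xi xr; rewrite op_poly_multiplier.
set a := t%:C * symbol Psi xi; set b := t%:C * taylor_poly Psi K (mi xi).
set rho := `|xi| / r.
have rho0 : 0 <= rho by rewrite divr_ge0// ltW.
have rho1 : rho <= 1 by rewrite ler_pdivrMr// mul1r ltW.
have rhoK : rho ^+ K <= rho by rewrite -[leRHS]expr1 ler_wiXn2l.
have rhoK0 : 0 <= rho ^+ K by exact: exprn_ge0.
have ct : cabs t%:C = t by rewrite cabs_real ger0_norm.
have ab : cabs (a - b) <= A * rho ^+ K.
  by rewrite /a /b -mulrBr cabsM ct -mulrA ler_wpM2l// H.
have ha : cabs a <= A * rho.
  have := H 1%N xi xr; rewrite taylor_poly1 subr0 expr1 => Hs.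
  by rewrite /a cabsM ct -mulrA ler_wpM2l.
have hb : cabs b <= 2 * A * rho.
  rewrite (_ : b = a + - (a - b)); last by rewrite opprB addrC subrK.
  rewrite (le_trans (cabsD _ _))// cabsN; have := ler_wpM2l A0 rhoK; lra.
have hb1 : cabs b <= 2 * A by rewrite (le_trans hb)// ler_piMr// mulr_ge0.
have ab1 : cabs (a - b) <= A by rewrite (le_trans ab)// ler_piMr// (le_trans rhoK).
rewrite (_ : cexp a - _ = (cexp a - cexp b) + (cexp b - exp_trunc K b)); last first.
  by rewrite addrA subrK.
have -> : C / r ^+ K * `|xi| ^+ K = C * rho ^+ K by rewrite /rho expr_div_n; ring.
rewrite (le_trans (cabsD _ _))// /C mulrDl lerD//.
  apply: le_trans (cexp_lipschitz _ _) _.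
  rewrite -[leRHS]mulrA ler_pM ?expR_ge0 ?ler_expR ?mulr_ge0 ?cabs_ge0 ?expR_ge0//.
  rewrite [leRHS]mulrAC ler_pM ?expR_ge0 ?ler_expR ?mulr_ge0 ?cabs_ge0//.
  by rewrite -[leRHS]mulrA ler_wpM2l.
apply: le_trans (cexp_taylor _ _) _.
rewrite [leRHS]mulrAC ler_pM ?expR_ge0 ?ler_expR ?exprn_ge0 ?mulr_ge0 ?cabs_ge0//.
have Ar : 0 <= 4 * A * rho by apply: mulr_ge0 => //; exact: mulr_ge0.
rewrite -exprMn lerXn2r ?nnegrE ?Ar ?mulr_ge0 ?cabs_ge0//; lra.
Qed.

(** The bound Re Psi <= c log (1 + |xi|) exponentiates to the power t c of
    1 + |xi|. *)
Lemma multiplier_growth (t : R) : 0 <= t -> exists q : nat, forall xi : T,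
  cabs (cexp (t%:C * symbol Psi (trow xi))) <= (2 * bw xi) ^+ q.
Proof.
move=> t0; have [c c0 H] := P2.
have [q hq] : exists q : nat, t * c <= q%:R.
  by exists (Num.truncn (t * c)).+1; rewrite ltW// truncnS_gt.
exists q => xi; have b1 := bw_ge1 xi.
have e0 : 0 <= enorm (trow xi) by exact: sqrtr_ge0.
have l0 : 0 <= ln (1 + enorm (trow xi)) by rewrite ln_ge0// lerDl.
rewrite cabs_cexp cReM /= mul0r subr0.
apply: (@le_trans _ _ (expR (q%:R * ln (1 + enorm (trow xi))))).
  rewrite ler_expR (le_trans (ler_wpM2l t0 (H _)))// mulrA ler_wpM2r//.
rewrite expRM_natl lnK ?posrE ?ltr_wpDr//.
rewrite lerXn2r ?nnegrE ?addr_ge0 ?mulr_ge0//; first lra.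
by have := enorm_le_bw xi; lra.
Qed.

(** Away from the origin the bound is trivial up to polynomial growth, because
    the sum of the |xi_j| ^ K is bounded below there. *)
Lemma multiplier_expansion (t : R) K : 0 <= t -> (0 < K)%N -> exists (C : R) (M : nat),
  0 <= C /\ forall xi : T,
  cabs (cexp (t%:C * symbol Psi (trow xi)) - op_poly (op_multiplier Psi t K) (trow xi)) <=
  C * (\sum_(j < n) `|tnth xi j| ^+ K) * bw xi ^+ M.
Proof.
move=> t0 K0; have [r [C [r0 C0 H]]] := multiplier_near t0 K0.
have [q Hq] := multiplier_growth t0.
have [C3 [M [C30 HM]]] := op_poly_growth (op_multiplier Psi t K).
pose D := (2 ^+ q + C3) / r ^+ K.
have D0 : 0 <= D by rewrite divr_ge0 ?exprn_ge0 ?addr_ge0 ?exprn_ge0// ltW.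
exists (C + D), (q + M)%N; split; first exact: addr_ge0.
move=> xi; have b1 := bw_ge1 xi.
have S0 : `|trow xi| ^+ K <= \sum_(j < n) `|tnth xi j| ^+ K.
  apply: le_trans (norm_expr_le_sum _ K0) _.
  by apply: ler_sum => j _; rewrite mxE.
set S := \sum_(j < n) _ in S0 *.
have Spos : 0 <= S := le_trans (exprn_ge0 K (normr_ge0 _)) S0.
have bqM1 : 1 <= bw xi ^+ (q + M) by exact: exprn_ege1.
have [lt|ge] := ltP `|trow xi| r.
  apply: le_trans (H _ lt) _; apply: (@le_trans _ _ (C * S)); first by rewrite ler_wpM2l.
  rewrite -[leLHS]mulr1 ler_pM ?mulr_ge0// ler_wpM2r// lerDl//.
have SrK : 1 <= S / r ^+ K.
  rewrite ler_pdivlMr ?exprn_gt0// mul1r (le_trans _ S0)// lerXn2r// nnegrE// ltW//.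
apply: le_trans (cabsB _ _) _.
apply: (@le_trans _ _ ((2 ^+ q + C3) * bw xi ^+ (q + M))).
  rewrite mulrDl lerD//.
    apply: le_trans (Hq xi) _; rewrite exprMn ler_wpM2l ?exprn_ge0//.
    by rewrite ler_weXn2l// leq_addr.
  apply: le_trans (HM xi) _; rewrite ler_wpM2l//.
  by rewrite ler_weXn2l// leq_addl.
rewrite ler_wpM2r ?exprn_ge0 ?(le_trans ler01)//.
apply: (@le_trans _ _ (D * S)); last by rewrite ler_wpM2r// lerDr.
rewrite /D mulrAC -mulrA ler_peMr// addr_ge0 ?exprn_ge0//.
Qed.

End multiplier_expansion.

(** * Sums over partitions into blocks *)

Section partition_sums.
Import mathcomp.boot.fintype mathcomp.boot.finset.
Local Close Scope classical_set_scope.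
Context {A : finType} {F : comNzRingType}.
Implicit Types (S B : {set A}) (P : {set {set A}}) (G : {set {set A}} * {set A}).

Lemma partition_iff P S : finset.partition P S <->
  [/\ forall B, B \in P -> B != set0,
      forall B a, B \in P -> a \in B -> a \in S,
      forall a, a \in S -> exists2 B, B \in P & a \in B &
      forall B B' a, B \in P -> B' \in P -> a \in B -> a \in B' -> B = B'].
Proof.
split=> [/and3P[/eqP cP tP P0]|[H0 HS Hc Hd]].
  split=> [B BP|B a BP aB|a|B B' a BP BP' aB aB'].
  - by apply: contraNneq P0 => <-.
  - by rewrite -cP; apply/bigcupP; exists B.
  - by rewrite -cP => /bigcupP[B BP aB]; exists B.
  - apply: contraTeq tP => BB'; apply/trivIsetP => /(_ _ _ BP BP' BB').
    by move=> /disjoint_setI0/setP/(_ a); rewrite !inE aB aB'.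
apply/and3P; split.
- apply/eqP/setP => a; apply/bigcupP/idP => [[B BP aB]|/Hc[B BP aB]]; first exact: HS aB.
  by exists B.
- apply/trivIsetP => B B' BP BP'; apply: contraNT => /pred0Pn[a /andP[/= aB aB']].
  by apply/eqP; exact: Hd aB aB'.
- by apply/negP => /H0; rewrite eqxx.
Qed.

(** Blocks partition the part of S that is not left outside: [G.1] are the blocks,
    [G.2] the elements outside. *)
Definition config S G := (G.2 \subset S) && finset.partition G.1 (S :\: G.2).

Lemma config_iff S G : config S G <->
  [/\ forall B, B \in G.1 -> B != set0,
      forall B a, B \in G.1 -> a \in B -> (a \in S) && (a \notin G.2),
      forall a, a \in G.2 -> a \in S,
      forall a, a \in S -> a \notin G.2 -> exists2 B, B \in G.1 & a \in B &
      forall B B' a, B \in G.1 -> B' \in G.1 -> a \in B -> a \in B' -> B = B'].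
Proof.
split=> [/andP[/subsetP OS /partition_iff[H0 HS Hc Hd]]|[H0 HS OS Hc Hd]].
  split=> //.
  - by move=> B a BP aB; have := HS _ _ BP aB; rewrite inE andbC.
  - by move=> a aS aO; apply: Hc; rewrite inE aS aO.
apply/andP; split; first exact/subsetP.
apply/partition_iff; split=> //.
- by move=> B a BP aB; have := HS _ _ BP aB; rewrite inE andbC.
- by move=> a; rewrite inE => /andP[aO aS]; exact: Hc.
Qed.

Variables (w : {set A} -> F) (o : A -> F).

Definition weight G : F := (\prod_(B in G.1) w B) * \prod_(a in G.2) o a.

Definition config_sum S : F := \sum_(G | config S G) weight G.

Definition config_sumk k S : F := \sum_(G | config S G && (#|G.1| == k)) weight G.

Lemma config_card S G : config S G -> (#|G.1| <= #|S|)%N.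
Proof.
move=> /andP[_ pG]; have := card_partition pG => E.
rewrite (@leq_trans #|S :\: G.2|)//; last exact/subset_leq_card/subsetDl.
rewrite E -sum1_card leq_sum// => B BP; rewrite card_gt0.
by move/partition_iff : pG => [H0 _ _ _]; exact: H0.
Qed.

Lemma config_sumk0 S : config_sumk 0 S = \prod_(a in S) o a.
Proof.
rewrite /config_sumk (big_pred1 (set0, S)) /=; first by rewrite /weight /= big_set0 mul1r.
move=> [P O] /=; rewrite cards_eq0 xpair_eqE; apply/andP/andP => -[].
  move=> /config_iff[/= _ _ OS Hc _] /eqP P0; split; first by rewrite P0.
  apply/eqP/setP => a; apply/idP/idP; first exact: OS.
  move=> aS; apply: contraT => aO; have [B] := Hc _ aS aO.
  by rewrite P0 inE.
move=> /eqP -> /eqP ->; split=> //; apply/config_iff; split => /=.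
- by move=> B; rewrite inE.
- by move=> B a; rewrite inE.
- by [].
- by move=> a ->.
- by move=> B B' a; rewrite inE.
Qed.

Lemma config_sumE K S : (#|S| < K)%N -> config_sum S = \sum_(k < K) config_sumk k S.
Proof.
move=> SK; rewrite /config_sum.
have h G : config S G -> (#|G.1| < K)%N.
  by move=> /config_card /leq_ltn_trans; apply.
case: K SK h => // K SK h.
rewrite (partition_big (fun G => inord #|G.1| : 'I_K.+1) predT)//=.
apply: eq_bigr => k _; apply: eq_bigl => G.
have [/= cG|//] := boolP (config S G).
by rewrite -val_eqE /= inordK// h.
Qed.

Lemma config_add S B G : B != set0 -> B \subset S -> config (S :\: B) G ->
  B \notin G.1 /\ config S (B |: G.1, G.2).
Proof.
move=> B0 /subsetP BS /config_iff[H0 HS OS Hc Hd].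
have [b bB] := set0Pn _ B0.
split; first by apply/negP => /HS /(_ bB); rewrite inE bB.
apply/config_iff; split => /=.
- by move=> B'; rewrite !inE => /orP[/eqP ->//|]; exact: H0.
- move=> B' a; rewrite !inE => /orP[/eqP ->|B'P] aB'.
    rewrite BS//=; apply: contraT; rewrite negbK => /OS.
    by rewrite inE aB'.
  by have := HS _ _ B'P aB'; rewrite inE -andbA => /and3P[_ -> ->].
- by move=> a /OS; rewrite inE => /andP[].
- move=> a aS aO; have [aB|aB] := boolP (a \in B).
    by exists B => //; rewrite !inE eqxx.
  have [|B' B'P aB'] := Hc a _ aO; first by rewrite inE aB.
  by exists B' => //; rewrite !inE B'P orbT.
- have X B' a : B' \in G.1 -> a \in B -> a \in B' -> False.
    by move=> B'P aB aB'; have := HS _ _ B'P aB'; rewrite inE aB.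
  move=> B1 B2 a; rewrite !inE => /orP[/eqP ->|P1] /orP[/eqP ->|P2]//.
  + by move=> aB aB2; case: (X _ _ P2 aB aB2).
  + by move=> aB aB2; case: (X _ _ P1 aB2 aB).
  + exact: Hd.
Qed.

Lemma config_remove S B G : config S G -> B \in G.1 ->
  [/\ B != set0, B \subset S & config (S :\: B) (G.1 :\ B, G.2)].
Proof.
move=> /config_iff[H0 HS OS Hc Hd] BP; split; first exact: H0.
  by apply/subsetP => a aB; have /andP[] := HS _ _ BP aB.
apply/config_iff; split => /=.
- by move=> B'; rewrite !inE => /andP[_]; exact: H0.
- move=> B' a; rewrite !inE => /andP[B'B B'P] aB'.
  have /andP[-> ->] := HS _ _ B'P aB'; rewrite !andbT.
  by apply: contra B'B => aB; rewrite (Hd _ _ _ B'P BP aB' aB).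
- move=> a aO; rewrite inE OS// andbT; apply/negP => aB.
  by have /andP[_] := HS _ _ BP aB; rewrite aO.
- move=> a; rewrite inE => /andP[aB aS] aO; have [B' B'P aB'] := Hc _ aS aO.
  exists B' => //; rewrite !inE B'P andbT.
  by apply: contraNneq aB => <-.
- by move=> B1 B2 a; rewrite !inE => /andP[_ P1] /andP[_ P2]; exact: Hd.
Qed.

(** Count pairs of a configuration with k + 1 blocks and one of its blocks, in two
    ways. Iterating the right-hand side is what powers of an operator do to a
    monomial. *)
Lemma config_sumkS k S : k.+1%:R * config_sumk k.+1 S =
  \sum_(B | (B != set0) && (B \subset S)) w B * config_sumk k (S :\: B).
Proof.
have -> : k.+1%:R * config_sumk k.+1 S =
    \sum_(G | config S G && (#|G.1| == k.+1)) \sum_(B in G.1) weight G.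
  rewrite /config_sumk mulr_sumr; apply: eq_bigr => G /andP[_ /eqP E].
  by rewrite sumr_const E mulr_natl.
rewrite (exchange_big_dep (fun B => (B != set0) && (B \subset S))) /=; last first.
  by move=> G B /andP[cG _] BP; have [-> ->] := config_remove cG BP.
apply: eq_bigr => B /andP[B0 BS]; rewrite /config_sumk mulr_sumr.
rewrite (reindex_onto (fun G => (B |: G.1, G.2)) (fun G => (G.1 :\ B, G.2))); last first.
  by move=> [P O] /= /andP[_ BP]; rewrite setD1K.
apply: eq_big => [[P O]|[P O]] /=.
  apply/idP/idP.
    move=> /andP[/andP[/andP[cG cP] BP] /eqP[/esym E]].
    have [_ _ c'] := config_remove cG BP.
    rewrite /= -E in c'; rewrite c' /=; move: cP.
    have := cardsD1 B (B |: P); rewrite BP -E => ->.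
    by rewrite add1n eqSS.
  move=> /andP[cG /eqP cP]; have [BP c'] := config_add B0 BS cG.
  by rewrite c' cardsU1 BP cP /= !inE eqxx /= setU1K// add1n !eqxx.
move=> /andP[/andP[/andP[cG cP] BP] /eqP[/esym E]].
by rewrite /weight /= big_setU1 ?mulrA// E !inE eqxx.
Qed.

End partition_sums.

(** * Connected components and the cluster expansion *)

Section clusters.
Import mathcomp.boot.fintype mathcomp.boot.finset.
Local Close Scope classical_set_scope.
Context {A I : finType} {F : comNzRingType}.
Variable tg : A -> I.
Implicit Types (S B : {set A}) (J K : {set I}) (G : {set {set A}} * {set A}).

(** The map [tg] sends a leg to its vertex. *)
Definition legs J : {set A} := [set a | tg a \in J].

(** Adjacency of full vertices through a block; elements outside the blocks do not
    connect anything. *)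
Definition adj G : rel I := fun n n' =>
  [exists B in G.1, [exists a in B, tg a == n] && [exists a in B, tg a == n']].

Lemma adjP G n n' : reflect (exists B a a',
  [/\ B \in G.1, a \in B, a' \in B, tg a = n & tg a' = n']) (adj G n n').
Proof.
apply: (iffP exists_inP) => [[B BP /andP[/exists_inP[a aB /eqP an] /exists_inP[a' aB' /eqP an']]]|].
  by exists B, a, a'.
move=> [B [a [a' [BP aB aB' an an']]]]; exists B => //.
by apply/andP; split; apply/exists_inP; [exists a|exists a'] => //; exact/eqP.
Qed.

Definition component v G : {set I} := [set n | connect (adj G) v n].

Lemma component_step v G n n' : n \in component v G -> adj G n n' -> n' \in component v G.
Proof. by rewrite !inE => vn nn'; exact: connect_trans vn (connect1 nn'). Qed.

Lemma component_sub v G (D : {set I}) : v \in D ->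
  (forall n n', n \in D -> adj G n n' -> n' \in D) -> component v G \subset D.
Proof.
move=> vD cD; apply/subsetP => n; rewrite inE => /connectP[s].
elim: s v vD => [v vD _ ->//|k s IH v vD /= /andP[vk ks] e].
exact: IH (cD _ _ vD vk) ks e.
Qed.

Lemma mem_component v G : v \in component v G.
Proof. by rewrite inE. Qed.

Lemma component_config v J G : v \in J -> config (legs J) G -> component v G \subset J.
Proof.
move=> vJ /config_iff[_ HS _ _ _]; apply: component_sub => // n n' _.
move=> /adjP[B [a [a' [BP _ aB' _ <-]]]].
by have /andP[] := HS _ _ BP aB'; rewrite inE.
Qed.

Definition restrict J G : {set {set A}} * {set A} :=
  ([set B in G.1 | B \subset legs J], G.2 :&: legs J).

Lemma restrict_config J K G : config (legs J) G -> K \subset J ->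
  (forall B a, B \in G.1 -> a \in B -> tg a \in K -> B \subset legs K) ->
  config (legs K) (restrict K G).
Proof.
move=> /config_iff[H0 HS OS Hc Hd] /subsetP KJ HK; apply/config_iff; split => /=.
- by move=> B; rewrite !inE => /andP[BP _]; exact: H0.
- move=> B a; rewrite !inE => /andP[BP /subsetP BK] aB.
  have := BK _ aB; rewrite inE => ->; rewrite andbT /=.
  by have /andP[] := HS _ _ BP aB.
- by move=> a; rewrite !inE => /andP[].
- move=> a; rewrite !inE => aK; rewrite aK andbT => aO.
  have [|B BP aB] := Hc a _ aO; first by rewrite inE KJ.
  by exists B => //; rewrite inE BP (HK _ _ BP aB aK).
- by move=> B B' a; rewrite !inE => /andP[BP _] /andP[BP' _]; exact: Hd.
Qed.

Lemma block_in_component v G B a : B \in G.1 -> a \in B ->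
  tg a \in component v G -> B \subset legs (component v G).
Proof.
move=> BP aB av; apply/subsetP => b bB; rewrite inE.
by apply: (component_step av); apply/adjP; exists B, a, b.
Qed.

Lemma component_restrict v G : component v (restrict (component v G) G) = component v G.
Proof.
apply/eqP; rewrite eqEsubset; apply/andP; split; apply: component_sub; rewrite ?mem_component//.
  move=> n n' nv /adjP[B [a [a' [BP aB aB' an an']]]].
  apply: (component_step nv); apply/adjP; exists B, a, a'; split=> //.
  by move: BP; rewrite inE => /andP[].
set D := component v (restrict _ _).
have sub : D \subset component v G.
  apply: component_sub; first exact: mem_component.
  move=> n n' nv /adjP[B [a [a' [BP aB aB' an an']]]].
  apply: (component_step nv); apply/adjP; exists B, a, a'; split=> //.
  by move: BP; rewrite inE => /andP[].
move=> n n' nD /adjP[B [a [a' [BP aB aB' an an']]]].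
apply: (component_step nD); apply/adjP; exists B, a, a'; split=> //.
rewrite inE BP (block_in_component BP aB)// an.
exact: (subsetP sub).
Qed.

Lemma split_component v J G : v \in J -> config (legs J) G ->
  let J' := component v G in
  [/\ config (legs J') (restrict J' G), component v (restrict J' G) = J',
      config (legs (J :\: J')) (restrict (J :\: J') G) &
      ((restrict J' G).1 :|: (restrict (J :\: J') G).1,
       (restrict J' G).2 :|: (restrict (J :\: J') G).2) = G].
Proof.
move=> vJ cG J'; have J'J := component_config vJ cG.
have out B a : B \in G.1 -> a \in B -> tg a \in J :\: J' -> B \subset legs (J :\: J').
  move=> BP aB; rewrite inE => /andP[aJ' aJ]; apply/subsetP => b bB; rewrite inE inE.
  move/config_iff : cG => [_ HS _ _ _].
  have /andP[] := HS _ _ BP bB; rewrite inE => -> _; rewrite andbT.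
  apply: contra aJ' => bJ'.
  have /subsetP sub := block_in_component BP bB bJ'.
  by have := sub _ aB; rewrite inE.
have inn B a : B \in G.1 -> a \in B -> tg a \in J' -> B \subset legs J'.
  exact: block_in_component.
split.
- exact: restrict_config cG J'J inn.
- exact: component_restrict.
- by apply: (restrict_config cG _ out); exact: subsetDl.
- case: G cG @J' J'J out inn => P O cG J' J'J out inn; move/config_iff : (cG) => /= [H0 HS OS _ _].
  congr (_, _); apply/setP.
    move=> B; rewrite !inE -andb_orr; have [BP|//] := boolP (B \in P); rewrite /=.
    have [a aB] := set0Pn _ (H0 _ BP).
    have /andP[] := HS _ _ BP aB; rewrite inE => aJ _.
    have [aJ'|aJ'] := boolP (tg a \in J'); first by rewrite (inn _ _ BP aB).
    by rewrite (out _ _ BP aB) ?orbT// inE aJ' aJ.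
  move=> a; rewrite !inE -andb_orr; have [aO|//] := boolP (a \in O); rewrite /=.
  by have := OS _ aO; rewrite inE => ->; rewrite andbT orbN.
Qed.

Lemma prod_setU (T : finType) (X Y : {set T}) (f : T -> F) : [disjoint X & Y] ->
  \prod_(i in X :|: Y) f i = (\prod_(i in X) f i) * \prod_(i in Y) f i.
Proof. by move=> d; rewrite -bigU//; apply: eq_bigl => i; rewrite !inE. Qed.

Definition merge G G' : {set {set A}} * {set A} := (G.1 :|: G'.1, G.2 :|: G'.2).

Lemma merge_configs v J J' G G' : v \in J' -> J' \subset J ->
  config (legs J') G -> component v G = J' -> config (legs (J :\: J')) G' ->
  [/\ config (legs J) (merge G G'), component v (merge G G') = J',
      restrict J' (merge G G') = G, restrict (J :\: J') (merge G G') = G' &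
      [disjoint G.1 & G'.1] && [disjoint G.2 & G'.2]].
Proof.
case: G => P O; case: G' => P' O'.
move=> vJ' /subsetP J'J /config_iff[/= H0 HS OS Hc Hd] cv /config_iff[/= H0' HS' OS' Hc' Hd'].
have sP B : B \in P -> B \subset legs J'.
  by move=> BP; apply/subsetP => a aB; have /andP[] := HS _ _ BP aB.
have sP' B : B \in P' -> B \subset legs (J :\: J').
  by move=> BP; apply/subsetP => a aB; have /andP[] := HS' _ _ BP aB.
have tP B a : B \in P -> a \in B -> tg a \in J'.
  by move=> /sP/subsetP h /h; rewrite inE.
have tP' B a : B \in P' -> a \in B -> (tg a \notin J') && (tg a \in J).
  by move=> /sP'/subsetP h /h; rewrite !inE.
have tO a : a \in O -> tg a \in J' by move=> /OS; rewrite inE.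
have tO' a : a \in O' -> (tg a \notin J') && (tg a \in J) by move=> /OS'; rewrite !inE.
have nP B : B \in P -> (B \in P' = false) * (B \subset legs (J :\: J') = false).
  move=> BP; have [a aB] := set0Pn _ (H0 _ BP); have aJ' := tP _ _ BP aB.
  split; apply/negP; first by move=> /tP'/(_ aB); rewrite aJ'.
  by move=> /subsetP/(_ _ aB); rewrite !inE aJ'.
have nP' B : B \in P' -> B \subset legs J' = false.
  move=> BP; have [a aB] := set0Pn _ (H0' _ BP); have /andP[aJ' _] := tP' _ _ BP aB.
  by apply/negP => /subsetP/(_ _ aB); rewrite inE; apply/negP.
have cm : config (legs J) (merge (P, O) (P', O')).
  apply/config_iff; split => /=.
  - by move=> B; rewrite inE => /orP[/H0|/H0'].
  - move=> B a; rewrite !inE negb_or => /orP[BP|BP] aB.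
      have aJ' := tP _ _ BP aB; have /andP[_ ->] := HS _ _ BP aB; rewrite J'J//=.
      by apply/negP => /tO'; rewrite aJ'.
    have /andP[aJ' ->] := tP' _ _ BP aB; have /andP[_ ->] := HS' _ _ BP aB; rewrite andbT /=.
    by apply: contra aJ' => /tO.
  - by move=> a; rewrite !inE => /orP[/tO/J'J|/tO'/andP[]].
  - move=> a; rewrite !inE negb_or => aJ /andP[aO aO'].
    have [aJ'|aJ'] := boolP (tg a \in J').
      have [|B BP aB] := Hc a _ aO; first by rewrite inE.
      by exists B => //; rewrite inE BP.
    have [|B BP aB] := Hc' a _ aO'; first by rewrite !inE aJ'.
    by exists B => //; rewrite inE BP orbT.
  - have X B B' a : B \in P -> B' \in P' -> a \in B -> a \in B' -> False.
      by move=> BP BP' aB aB'; have := tP' _ _ BP' aB'; rewrite (tP _ _ BP aB).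
    move=> B B' a; rewrite !inE => /orP[BP|BP] /orP[BP'|BP'] aB aB'.
    + exact: Hd aB aB'.
    + by case: (X _ _ _ BP BP' aB aB').
    + by case: (X _ _ _ BP' BP aB' aB).
    + exact: Hd' aB aB'.
split => //.
- apply/eqP; rewrite eqEsubset; apply/andP; split.
    apply: component_sub => // n n' nJ' /adjP[B [a [a' [BP aB aB' an <-]]]].
    move: BP; rewrite inE => /orP[BP|BP]; first exact: tP BP aB'.
    by have := tP' _ _ BP aB; rewrite an nJ'.
  rewrite -{1}cv; apply: component_sub; first exact: mem_component.
  move=> n n' nD /adjP[B [a [a' [BP aB aB' an an']]]].
  apply: (component_step nD); apply/adjP; exists B, a, a'; split=> //.
  by rewrite inE BP.
- congr (_, _); apply/setP; [move=> B|move=> a]; rewrite !inE /=.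
    have [BP|BP] := boolP (B \in P); first by rewrite (sP _ BP).
    by apply/andP => -[/= BP']; rewrite (nP' _ BP').
  have [aO|aO] := boolP (a \in O); first by rewrite (tO _ aO).
  by apply/andP => -[/= /tO'/andP[/negPf ->]].
- congr (_, _); apply/setP; [move=> B|move=> a]; rewrite !inE /=.
    have [BP|BP] := boolP (B \in P); first by rewrite !(nP _ BP).
    by have [/sP' ->|//] := boolP (B \in P').
  have [aO|aO] := boolP (a \in O).
    by rewrite (tO _ aO); apply/esym/negP => /tO'; rewrite (tO _ aO).
  by have [/tO' ->|] := boolP (a \in O').
- apply/andP; split; rewrite -setI_eq0 /=; apply/eqP/setP => x; rewrite !inE.
    by apply/andP => -[/nP[->]].
  by apply/andP => -[/tO xJ' /tO']; rewrite xJ'.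
Qed.

Variables (w : {set A} -> F) (o : A -> F).

(** For v in J, the component of v is J exactly when the configuration connects J. *)
Definition connected_weight v J : F :=
  \sum_(G | config (legs J) G && (component v G == J)) weight w o G.

(** Cut a configuration along the component J' of [v]: a block that meets the
    component lies in it, so that both parts are configurations again, and the
    weight is multiplicative. *)
Lemma cluster_expansion v J : v \in J -> config_sum w o (legs J) =
  \sum_(J' : {set I} | (v \in J') && (J' \subset J))
    connected_weight v J' * config_sum w o (legs (J :\: J')).
Proof.
move=> vJ; rewrite {1}/config_sum.
rewrite (partition_big (component v) (fun J' => (v \in J') && (J' \subset J))) /=; last first.
  by move=> G cG; rewrite mem_component component_config.
apply: eq_bigr => J' /andP[vJ' J'J].
rewrite /connected_weight /config_sum big_distrlr /= pair_big /=.
rewrite (reindex_onto (fun GG => merge GG.1 GG.2)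
  (fun G => (restrict J' G, restrict (J :\: J') G))); last first.
  by move=> G /andP[cG /eqP <-]; have [_ _ _] := split_component vJ cG.
apply: eq_big => [[G G']|[G G']] /=.
  apply/idP/idP.
    move=> /andP[/andP[cM /eqP cv] /eqP[E1 E2]].
    have [c1 c2 c3 _] := split_component vJ cM.
    by move: c1 c2 c3; rewrite /= cv E1 E2 => -> -> ->; rewrite eqxx.
  move=> /andP[/andP[c1 /eqP c2] c3].
  by have [-> -> -> -> _] := merge_configs vJ' J'J c1 c2 c3; rewrite !eqxx.
move=> /andP[/andP[cM /eqP cv] /eqP[E1 E2]].
have [c1 c2 c3 _] := split_component vJ cM.
rewrite cv E1 in c1; rewrite cv E1 in c2; rewrite cv E2 in c3.
have [_ _ _ _ /andP[d1 d2]] := merge_configs vJ' J'J c1 c2 c3.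
by rewrite /weight /= !prod_setU// mulrACA.
Qed.

End clusters.

(** * Cumulants of labelled sums *)

Section cumulants.
Import mathcomp.boot.fintype mathcomp.boot.finset.
Local Close Scope classical_set_scope.
Context {I Q : finType} {F : comNzRingType}.
Variables (v : I) (q0 : Q) (lamQ : Q -> F).
Variables (M K : {ffun I -> Q} -> {set I} -> F).
Implicit Types (J : {set I}) (l : {ffun I -> Q}).

Hypothesis M_local : forall l l' J, (forall i, i \in J -> l i = l' i) -> M l J = M l' J.
Hypothesis M0 : forall l, M l set0 = 1.
Hypothesis MK : forall l J, v \in J -> M l J =
  \sum_(J' : {set I} | (v \in J') && (J' \subset J)) K l J' * M l (J :\: J').

(** The recursion [MK] determines [K l J] from the values of [M l] on subsets
    of [J], hence from the labels in [J]. *)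
Lemma K_local l l' J : v \in J -> (forall i, i \in J -> l i = l' i) -> K l J = K l' J.
Proof.
move: {2}#|J| (leqnn #|J|) => s; elim: s J => [|s IH] J.
  by rewrite leqn0 cards_eq0 => /eqP ->; rewrite inE.
move=> Js vJ ll'; have := MK l vJ; rewrite (M_local ll') (MK l' vJ).
rewrite (bigD1 J)/= ?vJ ?subxx// [RHS](bigD1 J)/= ?vJ ?subxx//.
rewrite setDv !M0 !mulr1 => E; apply/esym; move: E.
rewrite (eq_bigr (fun J' : {set I} => K l J' * M l (J :\: J'))); first exact: addIr.
move=> J' /andP[/andP[vJ' J'J] J'nJ]; congr (_ * _).
  apply/esym/IH => //; last by move=> i iJ'; apply: ll'; exact: (fintype.subsetP J'J).
  by rewrite -ltnS (leq_trans _ Js)// proper_card// properEneq J'nJ.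
by apply: M_local => i; rewrite inE => /andP[_ /ll'].
Qed.

(** Labels outside J are set to a default value, so that a labelling of J is a
    labelling of I fixed by this map. *)
Definition pin J l : {ffun I -> Q} := [ffun i => if i \in J then l i else q0].

Definition label_sum J (f : {ffun I -> Q} -> F) : F :=
  \sum_(l | pin J l == l) (\prod_(i in J) lamQ (l i)) * f l.

(** Labels in disjoint sets are chosen independently. *)
Lemma label_sum_product J J' f g : J' \subset J ->
  (forall l, f (pin J' l) = f l) -> (forall l, g (pin (J :\: J') l) = g l) ->
  label_sum J (fun l => f l * g l) = label_sum J' f * label_sum (J :\: J') g.
Proof.
move=> /fintype.subsetP J'J fc gc; rewrite /label_sum big_distrlr pair_big /=.
pose glue (ll : {ffun I -> Q} * {ffun I -> Q}) : {ffun I -> Q} :=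
  [ffun i => if i \in J' then ll.1 i else ll.2 i].
rewrite (reindex_onto glue (fun l => (pin J' l, pin (J :\: J') l))); last first.
  move=> l /eqP lE; apply/ffunP => i; rewrite !ffunE !inE /=.
  have [//|iJ'] := boolP (i \in J').
  by rewrite -{2}lE ffunE.
have gl ll : (pin J' (glue ll) == ll.1) = (pin J' ll.1 == ll.1).
  by congr (_ == _); apply/ffunP => i; rewrite /glue !ffunE; case: (i \in J').
have gr ll : (pin (J :\: J') (glue ll) == ll.2) = (pin (J :\: J') ll.2 == ll.2).
  congr (_ == _); apply/ffunP => i; rewrite /glue !ffunE !inE.
  by case: (i \in J').
apply: eq_big => [[l1 l2]|[l1 l2]] /=.
  rewrite xpair_eqE (gl (l1, l2)) (gr (l1, l2)) /=.
  apply/andP/andP => -[]; first by move=> _ /andP[].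
  move=> /eqP e1 /eqP e2; rewrite e1 e2 !eqxx; split=> //; apply/eqP/ffunP => i.
  rewrite !ffunE /=; have [//|iJ] := boolP (i \in J).
  have /negPf -> : i \notin J' by apply: contra iJ => /J'J.
  by rewrite -e2 ffunE !inE (negPf iJ) andbF.
rewrite xpair_eqE => /andP[_ /andP[/eqP e1 /eqP e2]].
rewrite -fc -gc e1 e2.
have -> : \prod_(i in J) lamQ (glue (l1, l2) i) =
    (\prod_(i in J') lamQ (l1 i)) * \prod_(i in J :\: J') lamQ (l2 i).
  rewrite (big_setID J') /= (_ : J :&: J' = J'); last by apply/setIidPr/fintype.subsetP.
  congr (_ * _); apply: eq_bigr => i.
    by move=> iJ'; rewrite ffunE iJ'.
  by rewrite inE => /andP[/negPf iJ' _]; rewrite ffunE iJ'.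
by rewrite mulrACA.
Qed.

Variables (z k : nat -> F).
Hypothesis z0 : z 0 = 1.
Hypothesis zE : forall J, label_sum J (M^~ J) = z #|J|.
Hypothesis zk : forall s, (s < #|I|)%N ->
  z s.+1 = \sum_(i < s.+1) ('C(s, i))%:R * k i.+1 * z (s - i)%N.

Lemma sum_subsets_containing J (f : nat -> F) : v \in J ->
  \sum_(J' : {set I} | (v \in J') && (J' \subset J)) f #|J'| =
  \sum_(i < #|J|) ('C(#|J|.-1, i))%:R * f i.+1.
Proof.
move=> vJ; have cJ : #|J| = #|J :\ v|.+1 by rewrite (cardsD1 v) vJ.
rewrite (reindex_onto (fun B : {set I} => v |: B) (fun J' => J' :\ v)); last first.
  by move=> J' /andP[vJ' _]; rewrite setD1K.
rewrite (eq_bigl (fun B : {set I} => B \subset J :\ v)); last first.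
  move=> B; rewrite setU11 /= subUset sub1set vJ /= subsetD1.
  congr (_ && _); apply/eqP/idP => [<-|vB]; last by rewrite setU1K.
  by rewrite !inE eqxx.
rewrite cJ /=.
rewrite (partition_big (fun B : {set I} => inord #|B| : 'I_#|J :\ v|.+1) predT)//=.
apply: eq_bigr => i _.
have -> : ('C(#|J :\ v|, i))%:R * f i.+1 =
    \sum_(B in [set B : {set I} | B \subset J :\ v & #|B| == i]) f i.+1.
  by rewrite sumr_const cards_draws mulr_natl.
apply: eq_big => [B|B].
  rewrite inE; have [BJ /=|//] := boolP (B \subset _).
  by rewrite -val_eqE /= inordK// ltnS subset_leq_card.
move=> /andP[BJ /eqP Bi]; rewrite cardsU1.
have -> : v \notin B by apply: contraTN BJ => vB; apply/subsetPn; exists v => //; rewrite !inE eqxx.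
by rewrite -Bi inordK// ltnS subset_leq_card.
Qed.

(** Summation over the labels turns [MK] into a recursion for the sums of [K] in
    which the moments depend on cardinals only; the sequence k satisfies the
    same recursion, after grouping the subsets by cardinal. No vertices need to
    be relabelled. *)
Lemma label_sum_connected J : v \in J -> label_sum J (K^~ J) = k #|J|.
Proof.
move: {2}#|J| (leqnn #|J|) => s; elim: s J => [|s IH] J.
  by rewrite leqn0 cards_eq0 => /eqP ->; rewrite inE.
move=> Js vJ.
have E1 : z #|J| = \sum_(J' : {set I} | (v \in J') && (J' \subset J))
    label_sum J' (K^~ J') * z (#|J| - #|J'|)%N.
  rewrite -zE /label_sum.
  under eq_bigr => l _ do rewrite MK// mulr_sumr.
  rewrite exchange_big /=; apply: eq_bigr => J' /andP[vJ' J'J].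
  have -> : (#|J| - #|J'|)%N = #|J :\: J'| by rewrite cardsD (setIidPr J'J).
  rewrite -zE.
  rewrite -(@label_sum_product J J' (K^~ J') (M^~ (J :\: J')) J'J)//.
    by move=> l; apply: K_local => // i iJ'; rewrite ffunE iJ'.
  by move=> l; apply: M_local => i iJ'; rewrite ffunE iJ'.
have E2 : z #|J| = \sum_(J' : {set I} | (v \in J') && (J' \subset J))
    k #|J'| * z (#|J| - #|J'|)%N.
  rewrite (sum_subsets_containing (fun j => k j * z (#|J| - j)%N) vJ).
  have J0 : (0 < #|J|)%N by rewrite card_gt0; apply/set0Pn; exists v.
  have JI : (#|J| <= #|I|)%N by exact: max_card.
  case: #|J| J0 JI => // j _ jI; rewrite zk//.
  by apply: eq_bigr => i _; rewrite mulrA.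
move: E1; rewrite {}E2.
rewrite (bigD1 J)/= ?vJ ?subxx// [RHS](bigD1 J)/= ?vJ ?subxx//.
rewrite subnn z0 !mulr1 => E; apply/esym; move: E.
rewrite (eq_bigr (fun J' : {set I} => label_sum J' (K^~ J') * z (#|J| - #|J'|)%N)); first exact: addIr.
move=> J' /andP[/andP[vJ' J'J] J'nJ]; congr (_ * _); apply/esym/IH => //.
by rewrite -ltnS (leq_trans _ Js)// proper_card// properEneq J'nJ.
Qed.

End cumulants.

(** * Feynman graphs as partitions of legs *)

Section graph_connectivity.
Import mathcomp.boot.fintype mathcomp.boot.finset.
Local Close Scope classical_set_scope.
Context {pbar m : nat} {p : {ffun 'I_m -> 'I_pbar.+1}}.
Implicit Types G : graph p.
Local Notation tg := (fun a : leg p => tag a).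

Lemma legsT : legs tg [set: 'I_m] = [set: leg p].
Proof. by apply/setP => a; rewrite !inE. Qed.

Lemma is_graph_config G : is_graph G = config (legs tg [set: 'I_m]) G.
Proof. by rewrite /is_graph /config legsT subsetT /= setTD. Qed.

Lemma adjacent_sym G : symmetric (Defs.adjacent G).
Proof.
move=> u u'; rewrite /Defs.adjacent andbCA; congr [&& _, _ & _].
by apply: eq_existsb => a; rewrite andbC.
Qed.

(** A walk through empty vertices is a walk between full vertices that are adjacent
    through a block; every empty vertex is met by an edge. *)
Lemma connected_graphE G v : is_graph G ->
  connected_graph G = (component tg v G == [set: 'I_m]).
Proof.
rewrite is_graph_config => /config_iff[H0 HS OS Hc Hd].
apply/idP/eqP => [/forallP cG|cG].
  pose D : pred (vertex p) := fun u => match u with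
    | inl (inl j) => j \in component tg v G
    | inl (inr B) => [exists a in B, tag a \in component tg v G]
    | inr a => tag a \in component tg v G end.
  have stepD u u' : D u -> Defs.adjacent G u u' -> D u'.
    move=> Du /and3P[Gu Gu' /existsP[a /andP[au au']]].
    have aD : tag a \in component tg v G.
      move: u Du Gu au => [[j|B]|b] /=; last by move=> bD _ /eqP ->.
        by move=> jD _ /eqP ->.
      move=> /exists_inP[b bB bD] BG aB.
      by apply: (component_step bD); apply/adjP; exists B, b, a.
    move: u' Gu' au' => [[j|B]|b] /=; last by move=> _ /eqP <-.
      by move=> _ /eqP <-.
    by move=> BG aB; apply/exists_inP; exists a.
  apply/setP => j; rewrite [RHS]inE.
  have /forallP/(_ (inl (inl j)))/= := cG (inl (inl v)).
  move=> /connectP[s]; have : D (inl (inl v)) by exact: mem_component.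
  elim: s (inl (inl v) : vertex p) => [u Du _ /= e|u' s IH u Du /= /andP[uu' u's] e].
    by rewrite -e in Du.
  by apply: (IH u') => //; exact: stepD uu'.
have symc u u' : connect (Defs.adjacent G) u u' = connect (Defs.adjacent G) u' u.
  exact: (sym_connect_sym (adjacent_sym G)).
have blk B j : B \in inner G -> [exists a in B, tag a == j] ->
    connect (Defs.adjacent G) (inl (inl j)) (inl (inr B)).
  move=> BG /exists_inP[a aB aj]; apply: connect1; apply/and3P; split=> //.
  by apply/existsP; exists a; rewrite /= aj.
have full j : connect (Defs.adjacent G) (inl (inl v)) (inl (inl j)).
  have : j \in component tg v G by rewrite cG inE.
  rewrite inE => /connectP[s]; elim: s v {cG} => [u _ ->//|u' s IH u /= /andP[uu' u's] e].
  apply: connect_trans (IH _ u's e).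
  move: uu' => /exists_inP[B BG /andP[h h']].
  by apply: (connect_trans (blk _ _ BG h)); rewrite symc; exact: blk.
have all u : is_vertex G u -> connect (Defs.adjacent G) (inl (inl v)) u.
  move: u => [[j|B]|a] /= Gu; first exact: full.
    have [a aB] := set0Pn _ (H0 _ Gu).
    by apply: (connect_trans (full (tag a))); apply: blk => //; apply/exists_inP; exists a.
  apply: (connect_trans (full (tag a))); apply: connect1; apply/and3P; split=> //.
  by apply/existsP; exists a; rewrite /= !eqxx.
apply/forallP => u; apply/forallP => u'; apply/implyP => Gu; apply/implyP => Gu'.
by apply: connect_trans (all _ Gu'); rewrite symc; exact: all.
Qed.

End graph_connectivity.

Section labels.
Import mathcomp.boot.fintype mathcomp.boot.finset.
Local Close Scope classical_set_scope.
Context {R : realType} {n : nat}.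
Variables (Psi : 'rV[R[i]]_n -> R[i]) (pbar : nat).
Variable lam : forall p : nat, p.-tuple 'I_n -> R.
Arguments lam : clear implicits.
Variables (t : R) (phi : 'rV[R]_n) (i0 : 'I_n).

(** Number of legs and indices of a full vertex in one object: a sum over p and
    then over X becomes a sum over independent labels. *)
Definition label : finType := {q : 'I_pbar.+1 & q.-tuple 'I_n}.

Lemma label_inj (q q' : label) : val (tagged q) = val (tagged q') -> q = q'.
Proof.
move: q q' => [q X] [q' X'] /= XX'.
have e : q = q' by apply: val_inj; rewrite /= -(size_tuple X) -(size_tuple X') XX'.
by subst q'; congr existT; exact: val_inj.
Qed.

Definition label_coef (q : label) : R[i] := (lam (tag q) (tagged q))%:C.

Definition label_monomial (q : label) (x : 'rV[R]_n) : R := \prod_(i <- tagged q) x 0 i.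

Definition block_weight (A : finType) (X : A -> 'I_n) (B : {set A}) : R[i] :=
  t%:C * Ccoef Psi [seq X a | a <- enum B].

Definition outer_weight (A : finType) (X : A -> 'I_n) (a : A) : R[i] := (phi 0 (X a))%:C.

Context {m : nat}.
Variable v : 'I_m.
Implicit Types (p : {ffun 'I_m -> 'I_pbar.+1}) (l : {ffun 'I_m -> label}).

Definition coords p l : {ffun leg p -> 'I_n} :=
  [ffun a : leg p => nth i0 (tagged (l (tag a))) (nat_of_ord (tagged a))].

Definition labels p (X : {ffun leg p -> 'I_n}) : {ffun 'I_m -> label} :=
  [ffun j => Tagged (fun q : 'I_pbar.+1 => q.-tuple 'I_n)
    [tuple X (Tagged (fun j => 'I_(p j)) s) | s < p j]].

Definition degrees l : {ffun 'I_m -> 'I_pbar.+1} := [ffun j => tag (l j)].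

Definition graph_connected_weight p (X : {ffun leg p -> 'I_n}) (J : {set 'I_m}) : R[i] :=
  connected_weight (fun a : leg p => tag a) (block_weight X) (outer_weight X) v J.

Lemma labelsK p : cancel (@labels p) (coords p).
Proof.
move=> X; apply/ffunP => -[j s]; rewrite !ffunE /=.
by rewrite (nth_mktuple _ i0 s).
Qed.

Lemma degrees_labels p (X : {ffun leg p -> 'I_n}) : degrees (labels X) = p.
Proof. by apply/ffunP => j; rewrite !ffunE. Qed.

Lemma coordsK p l : degrees l = p -> labels (coords p l) = l.
Proof.
move=> lp; apply/ffunP => j; apply: label_inj; rewrite ffunE /=.
have sz : size (tagged (l j)) = p j by rewrite size_tuple -lp ffunE.
apply: (@eq_from_nth _ i0); first by rewrite size_map -cardE card_ord.
move=> i; rewrite size_map -cardE card_ord => ip.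
by rewrite (nth_mktuple _ i0 (Ordinal ip)) ffunE.
Qed.

Lemma prod_legs l (J : {set 'I_m}) (f : 'I_n -> R) :
  \prod_(a in legs (fun a : leg (degrees l) => tag a) J) f (coords (degrees l) l a) =
  \prod_(j in J) \prod_(i <- tagged (l j)) f i.
Proof.
transitivity (\prod_(j in J) \prod_(s : 'I_(degrees l j))
    f (coords (degrees l) l (Tagged (fun j => 'I_(degrees l j)) s))).
  by rewrite sig_big_dep /=; apply: eq_big => -[j s]; rewrite ?inE ?andbT.
apply: eq_bigr => j _; rewrite (big_nth i0).
have -> : size (tagged (l j)) = degrees l j by rewrite size_tuple ffunE.
by rewrite big_mkord; apply: eq_bigr => s _; rewrite ffunE.
Qed.

Lemma connected_weight_degrees p l J : degrees l = p ->
  graph_connected_weight (coords (degrees l) l) J = graph_connected_weight (coords p l) J.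
Proof. by move=> <-. Qed.

(** Full vertices whose tensor vanishes contribute 0, so that the sum may run over
    all numbers of legs. *)
Lemma connected_sumE : connected_sum Psi pbar lam t phi m =
  \sum_(l : {ffun 'I_m -> label}) (\prod_j label_coef (l j)) * graph_connected_weight (coords (degrees l) l) [set: 'I_m].
Proof.
transitivity (\sum_(p : {ffun 'I_m -> 'I_pbar.+1}) \sum_(X : {ffun leg p -> 'I_n})
    (\prod_j label_coef (labels X j)) * graph_connected_weight X [set: 'I_m]).
  rewrite /connected_sum big_mkcond; apply: eq_bigr => p _.
  have E (X : {ffun leg p -> 'I_n}) :
      (\prod_j label_coef (labels X j)) * graph_connected_weight X [set: 'I_m] =
      \sum_(G : graph p | is_graph G && connected_graph G)
        ((\prod_(b in outer G) (phi 0 (X b))%:C) *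
         (\prod_(B in inner G) (t%:C * Ccoef Psi [seq X a | a <- enum B])) *
         (\prod_(j < m)
           (lam (p j) [tuple X (Tagged (fun j => 'I_(p j)) s) | s < p j])%:C)).
    rewrite mulrC mulr_suml; apply: eq_big => [G|G _].
      rewrite -is_graph_config; have [gG /=|//] := boolP (is_graph G).
      by rewrite (connected_graphE v).
    rewrite /weight /block_weight /outer_weight mulrC [X in _ = X * _]mulrC mulrC.
    by congr (_ * _); apply: eq_bigr => j _; rewrite /label_coef ffunE.
  case: ifP => [_|/negbT].
    by rewrite exchange_big; apply: eq_bigr => X _; rewrite E.
  rewrite negb_forall => /existsP[j]; rewrite negb_exists => /forallP l0.
  rewrite big1// => X _; rewrite (bigD1 j)//= /label_coef ffunE /=.
  by have := l0 [tuple X (Tagged (fun j => 'I_(p j)) s) | s < p j];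
    rewrite negbK => /eqP ->; rewrite !mul0r.
rewrite [RHS](partition_big degrees predT)//=; apply: eq_bigr => p _.
rewrite [RHS](reindex_onto (@labels p) (coords p)); last first.
  by move=> l /eqP; exact: coordsK.
apply: eq_big => [X|X _]; first by rewrite degrees_labels labelsK !eqxx.
congr (_ * _).
by rewrite (connected_weight_degrees _ (degrees_labels X)) labelsK.
Qed.

End labels.

(** * Differential operators on monomials *)

Section operators_on_monomials.
Import mathcomp.boot.fintype mathcomp.boot.finset.
Local Close Scope classical_set_scope.
Context {R : realType} {n : nat} {A : finType}.
Variables (phi : 'rV[R]_n) (X : A -> 'I_n).
Implicit Types (S B : {set A}).
Local Notation ops := (seq (R[i] * seq 'I_n)).
Local Notation e_ j := (delta_mx 0 j : 'rV[R]_n).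

Definition mon S (x : 'rV[R]_n) : R := \prod_(a in S) x 0 (X a).

Lemma polyfun_mon S : polyfun (mon S).
Proof. by apply: pf_prod => a; exact: pf_var. Qed.

Lemma smooth_mon S : smoothR (mon S).
Proof. exact/polyfun_smooth/polyfun_mon. Qed.

Lemma is_derive_mon S j (x : 'rV[R]_n) : is_derive x (e_ j) (mon S : 'rV[R]_n -> R^o)
  (\sum_(a in S) (X a == j)%:R * mon (S :\ a) x).
Proof.
move: {2}#|S| (erefl #|S|) => s; elim: s S => [|s IH] S.
  move=> /eqP; rewrite cards_eq0 => /eqP ->; rewrite big_set0.
  rewrite (_ : mon set0 = fun=> 1); first exact: is_derive_cst.
  by apply/funext => y; rewrite /mon big_set0.
move=> Ss; have [a aS] : exists a, a \in S by apply/set0Pn; rewrite -card_gt0 Ss.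
have Sa : #|S :\ a| = s by move: Ss; rewrite (cardsD1 a) aS => -[].
have -> : mon S = fun x => x 0 (X a) * mon (S :\ a) x.
  by apply/funext => y; rewrite /mon (big_setD1 a).
apply: (is_derive_eq (is_derive_mul (is_derive_coord x (X a) j) (IH _ Sa))).
rewrite (big_setD1 a aS) /=; congr (_ + _).
rewrite mulr_sumr; apply: eq_bigr => b; rewrite !inE => /andP[ba bS].
rewrite mulrCA; congr (_ * _); rewrite [RHS]/mon (big_setD1 a) /=; last first.
  by rewrite !inE aS eq_sym ba.
by rewrite -/(mon _ _) setDDl setUC -setDDl.
Qed.

Lemma pd_mon S j : pd [:: j] (mon S) =
  fun x => \sum_(a <- enum S) (X a == j)%:R * mon (S :\ a) x.
Proof.
apply/funext => x; have := is_derive_mon S j x => -[_ /= ->].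
by rewrite big_enum.
Qed.

Lemma pd_cat s s' (f : 'rV[R]_n -> R) : pd (s ++ s') f = pd s (pd s' f).
Proof. by rewrite /pd foldr_cat. Qed.

Lemma op_at_sum (b : ops) s (I : Type) (r : seq I) (c : I -> R) F :
  (forall i, smoothR (F i)) ->
  op_at b phi (pd s (fun x => \sum_(i <- r) c i * F i x)) =
  \sum_(i <- r) (c i)%:C * op_at b phi (pd s (F i)).
Proof.
move=> sF; have [_ E] := smooth_sum r c sF.
under eq_bigr do rewrite mulr_sumr.
rewrite exchange_big /=; apply: eq_bigr => cs _.
rewrite -pd_cat E rmorph_sum mulr_sumr; apply: eq_bigr => i _.
by rewrite -pd_cat rmorphM /= mulrCA.
Qed.

Lemma sum_tuple_rcons (V : nmodType) l (f : seq 'I_n -> V) :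
  \sum_(Y : l.+1.-tuple 'I_n) f Y = \sum_j \sum_(Y : l.-tuple 'I_n) f (rcons Y j).
Proof.
have rv k (g : seq 'I_n -> V) :
    \sum_(Y : k.-tuple 'I_n) g Y = \sum_(Y : k.-tuple 'I_n) g (rev Y).
  have inj : injective (fun Y : k.-tuple 'I_n => [tuple of rev Y]).
    by apply: (can_inj (g := fun Y : k.-tuple 'I_n => [tuple of rev Y])) => Y;
      apply: val_inj; rewrite /= revK.
  by rewrite (reindex_inj inj).
rewrite rv (reindex (fun p : 'I_n * l.-tuple 'I_n => [tuple of p.1 :: p.2])) /=; last first.
  exists (fun X : l.+1.-tuple 'I_n => (thead X, [tuple of behead X])) => [[j Y] _|Y _] /=.
    by congr (_, _); apply: val_inj.
  by rewrite [RHS]tuple_eta; apply: val_inj.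
rewrite -(pair_big xpredT xpredT (fun j (Y : l.-tuple 'I_n) => f (rev (j :: Y)))) /=.
apply: eq_bigr => j _; rewrite [RHS](rv l (fun Y => f (rcons Y j))).
by apply: eq_bigr => Y _; rewrite rev_cons.
Qed.

Definition colors B := [seq X a | a <- enum B].

Lemma colors_add B a : a \notin B -> perm_eq (rcons (colors B) (X a)) (colors (a |: B)).
Proof.
move=> aB; rewrite perm_rcons -map_cons; apply: perm_map; apply: uniq_perm.
- by rewrite /= mem_enum aB enum_uniq.
- exact: enum_uniq.
- by move=> b; rewrite !inE !mem_enum !inE.
Qed.

(** Each derivative removes one leg of the matching colour. Summed against a
    symmetric tensor, l derivatives contract every set B of l legs once for each
    of the l! orders in which B can be used up. *)
Lemma contract_mon (b : ops) l (c : seq 'I_n -> R[i]) S :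
  (forall s s', perm_eq s s' -> c s = c s') ->
  \sum_(Y : l.-tuple 'I_n) c Y * op_at b phi (pd Y (mon S)) =
  l`!%:R * \sum_(B : {set A} | (B \subset S) && (#|B| == l))
    c (colors B) * op_at b phi (mon (S :\: B)).
Proof.
elim: l c S => [|l IH] c S cp.
  rewrite (big_pred1 [tuple]) /=; last by move=> Y; apply/esym/eqP; exact: tuple0.
  rewrite mul1r (big_pred1 set0) /=.
    by rewrite /colors enum_set0 setD0.
  move=> B; rewrite cards_eq0 andbC; have [->|/negPf B0] := eqVneq B set0.
    by rewrite sub0set /= eqxx.
  by rewrite /= B0.
transitivity (\sum_j \sum_(Y : l.-tuple 'I_n)
    c (rcons Y j) * op_at b phi (pd (rcons Y j) (mon S))).
  exact: (sum_tuple_rcons l (fun Y => c Y * op_at b phi (pd Y (mon S)))).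
have E1 j (Y : l.-tuple 'I_n) : c (rcons Y j) * op_at b phi (pd (rcons Y j) (mon S)) =
   \sum_(a <- enum S) (X a == j)%:R * (c (rcons Y (X a)) * op_at b phi (pd Y (mon (S :\ a)))).
  rewrite -cats1 pd_cat pd_mon op_at_sum; last by move=> a; exact: smooth_mon.
  rewrite mulr_sumr cats1; apply: eq_bigr => a _.
  case: eqP => [->|_]; first by rewrite !mul1r.
  by rewrite !mul0r mulr0.
under eq_bigr => j _ do under eq_bigr => Y _ do rewrite E1.
under eq_bigr => j _ do rewrite exchange_big /=.
rewrite exchange_big /= big_enum /=.
have E2 a : \sum_j \sum_(Y : l.-tuple 'I_n) (X a == j)%:R *
     (c (rcons Y (X a)) * op_at b phi (pd Y (mon (S :\ a)))) =
   l`!%:R * \sum_(B : {set A} | (B \subset S :\ a) && (#|B| == l))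
     c (rcons (colors B) (X a)) * op_at b phi (mon ((S :\ a) :\: B)).
  rewrite (bigD1 (X a))//= [X in _ + X]big1 ?addr0; last first.
    by move=> j; rewrite eq_sym => /negPf ->; rewrite big1// => Y _; rewrite mul0r.
  under eq_bigr do rewrite eqxx mul1r.
  rewrite -(IH (fun s => c (rcons s (X a)))) // => s s' ss'.
  by apply: cp; rewrite -!cats1 perm_cat2r.
under eq_bigr => a _ do rewrite E2.
rewrite -mulr_sumr factS mulnC natrM -mulrA; congr (_ * _).
rewrite mulr_natl -sumrMnl.
transitivity (\sum_(B : {set A} | (B \subset S) && (#|B| == l.+1)) \sum_(a in B)
    c (colors B) * op_at b phi (mon (S :\: B))); last first.
  by apply: eq_bigr => B /andP[_ /eqP <-]; rewrite sumr_const.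
rewrite [RHS](exchange_big_dep (mem S)) /=; last first.
  by move=> B a /andP[/fintype.subsetP BS _] /BS.
apply: eq_bigr => a aS.
rewrite [RHS](reindex_onto (fun B => a |: B) (fun B => B :\ a)); last first.
  by move=> B /andP[_ aB]; rewrite setD1K.
apply: eq_big => [B|B /andP[BS _]].
  rewrite subsetD1 subUset sub1set aS setU11 andbT /=.
  have [aB|aB] := boolP (a \in B).
    rewrite andbF; apply/esym/negP => /andP[_ /eqP E].
    by move: aB; rewrite -E !inE eqxx.
  by rewrite setU1K// eqxx !andbT cardsU1 aB add1n eqSS.
have aB : a \notin B by apply: contraTN BS => aB; apply/subsetPn; exists a => //; rewrite !inE eqxx.
by rewrite (cp _ _ (colors_add aB)) setDDl.
Qed.

Lemma op_at_mul (a b : ops) f : op_at (op_mul b a) phi f =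
  \sum_(q <- a) q.1 * op_at b phi (pd q.2 f).
Proof.
rewrite /op_at /op_mul big_allpairs_dep /= exchange_big /=; apply: eq_bigr => q _.
rewrite mulr_sumr; apply: eq_bigr => p _.
by rewrite pd_cat mulrCA mulrA.
Qed.

Variable Psi : 'rV[R[i]]_n -> R[i].
Hypothesis Psi0 : Psi 0 = 0.
Hypothesis P1 : analytic_at Psi 0.

(** The factorials of the Taylor polynomial cancel those of [contract_mon]. Orders
    above the number of legs do not contribute, so that the truncation is
    invisible. *)
Lemma op_at_taylor K (b : ops) S : (#|S| < K)%N ->
  op_at (op_mul b (op_taylor Psi K)) phi (mon S) =
  \sum_(B : {set A} | B \subset S) Ccoef Psi (colors B) * op_at b phi (mon (S :\: B)).
Proof.
move=> SK; rewrite op_at_mul /op_taylor big_flatten big_map /= -[X in iota 0 X]subn0 big_mkord.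
transitivity (\sum_(l < K) \sum_(B : {set A} | (B \subset S) && (#|B| == l))
    Ccoef Psi (colors B) * op_at b phi (mon (S :\: B))).
  apply: eq_bigr => l _; rewrite big_image /=.
  under eq_bigr do rewrite -mulrA.
  rewrite -mulr_sumr (@contract_mon b l (Ccoef Psi) S); last exact: Ccoef_perm.
  by rewrite mulKf// pnatr_eq0 -lt0n fact_gt0.
have h B : B \subset S -> (#|B| < K)%N by move=> /subset_leq_card /leq_ltn_trans; apply.
case: K SK h => // K SK h.
rewrite [RHS](partition_big (fun B : {set A} => inord #|B| : 'I_K.+1) predT)//=.
apply: eq_bigr => k _; apply: eq_bigl => B.
have [/= BS|//] := boolP (B \subset S).
by rewrite -val_eqE /= inordK// h.
Qed.

Lemma op_at_exp K k S : (#|S| < K)%N ->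
  op_at (op_exp (op_taylor Psi K) k) phi (mon S) =
  k`!%:R * config_sumk (fun B => Ccoef Psi (colors B)) (outer_weight phi X) k S.
Proof.
elim: k S => [|k IH] S SK.
  rewrite /op_at big_seq1 /= mul1r config_sumk0 mul1r rmorph_prod.
  by [].
rewrite [op_exp _ _]/= op_at_taylor// factS mulnC natrM -mulrA config_sumkS mulr_sumr.
rewrite (bigD1 set0) ?sub0set//=.
have -> : Ccoef Psi (colors set0) = 0 by rewrite /colors enum_set0 Ccoef_nil Psi0.
rewrite mul0r add0r; apply: eq_big => [B|B _]; first by rewrite andbC.
have BK : (#|S :\: B| < K)%N by rewrite (leq_ltn_trans _ SK)// subset_leq_card// subsetDl.
by rewrite (IH _ BK) [LHS]mulrCA.
Qed.

(** The Feynman rules for a single product of legs: the k-th power of the operator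
    removes k blocks one after the other, and the factor 1 / k! forgets the order;
    the remaining legs are evaluated at phi. *)
Lemma op_at_multiplier (t : R) K S : (#|S| < K)%N ->
  op_at (op_multiplier Psi t K) phi (mon S) =
  config_sum (block_weight Psi t X) (outer_weight phi X) S.
Proof.
move=> SK; rewrite (config_sumE _ _ SK) /op_at /op_multiplier big_flatten big_map /=.
rewrite -[X in iota 0 X]subn0 big_mkord; apply: eq_bigr => k _; rewrite big_map /=.
under eq_bigr do rewrite -!mulrA.
rewrite -2!mulr_sumr -/(op_at _ _ _) op_at_exp// [X in _ * X]mulrCA mulKf; last first.
  by rewrite pnatr_eq0 -lt0n fact_gt0.
rewrite /config_sumk mulr_sumr; apply: eq_bigr => G /andP[_ /eqP <-].
by rewrite /weight /block_weight big_split /= prodr_const mulrA.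
Qed.

End operators_on_monomials.

(** * Moments and connected graphs *)

Section moments.
Import mathcomp.boot.fintype mathcomp.boot.finset.
Local Close Scope classical_set_scope.
Context {R : realType} {n : nat}.
Variables (Psi : 'rV[R[i]]_n -> R[i]) (pbar : nat).
Variable lam : forall p : nat, p.-tuple 'I_n -> R.
Arguments lam : clear implicits.
Variables (t : R) (phi : 'rV[R]_n) (i0 : 'I_n) (K : nat).
Hypothesis Psi0 : Psi 0 = 0.
Hypothesis P1 : analytic_at Psi 0.
Local Notation label := (label (n := n) pbar).
Local Notation L := (op_at (op_multiplier Psi t K) phi).

Definition moment (s : nat) : R[i] := L (fun x => potential pbar lam x ^+ s).

Definition label_moment m (l : {ffun 'I_m -> label}) (J : {set 'I_m}) : R[i] :=
  L (fun x => \prod_(j in J) label_monomial (l j) x).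

Lemma label_moment_local m (l l' : {ffun 'I_m -> label}) (J : {set 'I_m}) :
  (forall j, j \in J -> l j = l' j) -> label_moment l J = label_moment l' J.
Proof.
move=> ll'; congr op_at; apply/funext => x.
by apply: eq_bigr => j /ll' ->.
Qed.

Lemma card_leg m (l : {ffun 'I_m -> label}) : (#|leg (degrees l)| <= m * pbar)%N.
Proof.
rewrite card_tagged sumnE big_map big_enum /= -[m in (m * _)%N]card_ord -sum_nat_const.
by apply: leq_sum => j _; rewrite card_ord -ltnS.
Qed.

Lemma label_moment_config m (l : {ffun 'I_m -> label}) (J : {set 'I_m}) :
  (m * pbar < K)%N -> label_moment l J =
  config_sum (block_weight Psi t (coords i0 (degrees l) l))
    (outer_weight phi (coords i0 (degrees l) l))
    (legs (fun a : leg (degrees l) => tag a) J).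
Proof.
move=> mK; rewrite -(@op_at_multiplier _ _ _ phi _ Psi Psi0 P1 t K); last first.
  exact: leq_ltn_trans (leq_trans (max_card _) (card_leg l)) mK.
congr op_at; apply/funext => x.
by rewrite /mon (prod_legs i0 l J (fun i => x 0 i)).
Qed.

Lemma potential_labels x :
  potential pbar lam x = \sum_(q : label) lam (tag q) (tagged q) * label_monomial q x.
Proof.
rewrite /potential /tensor_form sig_big_dep /=.
apply: eq_bigr => -[q X] _ /=; congr (_ * _); rewrite /label_monomial /=.
by rewrite big_tuple.
Qed.

Lemma polyfun_label_monomial q : polyfun (label_monomial (R := R) (q : label)).
Proof. by apply: pf_prod => i; exact: pf_var. Qed.

Definition label0 : label := Tagged (fun q : 'I_pbar.+1 => q.-tuple 'I_n)
  (i := ord0) [tuple].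

Lemma label_sum_moment m (J : {set 'I_m}) :
  label_sum label0 (label_coef (pbar := pbar) lam) J ((@label_moment m)^~ J) = moment #|J|.
Proof.
pose r := [seq l : {ffun 'I_m -> label} <- enum {ffun 'I_m -> label} | pin label0 J l == l].
pose c (l : {ffun 'I_m -> label}) := \prod_(j in J) lam (tag (l j)) (tagged (l j)).
transitivity (\sum_(l <- r) (c l)%:C *
    L (pd [::] (fun x => \prod_(j in J) label_monomial (l j) x))).
  rewrite /label_sum /r big_filter big_enum_cond /=; apply: eq_big => [l|l _] //.
  by congr (_ * _); rewrite /c rmorph_prod.
rewrite -op_at_sum; last first.
  move=> l; apply/polyfun_smooth/pf_prod => j; exact: polyfun_label_monomial.
congr op_at; apply/funext => x /=.
transitivity (\prod_(j in J) potential pbar lam x); last by rewrite prodr_const.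
under [RHS]eq_bigr do rewrite potential_labels.
rewrite (big_distr_big label0) /= /r big_filter big_enum_cond /=.
apply: eq_big => [l|l _]; last by rewrite /c -big_split.
rewrite inE; apply/eqP/pffun_onP => [<-|[/fintype.subsetP sJ _]].
  split=> //; apply/fintype.subsetP => j; rewrite inE ffunE.
  by case: ifP => //; rewrite eqxx.
apply/ffunP => j; rewrite ffunE; case: ifP => // /negP jJ.
by apply/esym/eqP; apply: contraT => lj; case: jJ; apply: sJ; rewrite inE.
Qed.

Lemma moment0 : (0 < K)%N -> moment 0 = 1.
Proof.
move=> K0; pose l : {ffun 'I_0 -> label} := [ffun=> label0].
transitivity (label_moment l set0).
  by congr op_at; apply/funext => x; rewrite expr0 big_set0.
rewrite label_moment_config ?mul0n//.
have -> : legs (fun a : leg (degrees l) => tag a) set0 = set0.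
  by apply/setP => a; rewrite !inE.
by rewrite (@config_sumE _ _ _ _ 1) ?cards0// big_ord1 config_sumk0 big_set0.
Qed.

(** For a fixed number of vertices, connected graphs are the cumulants of the
    moments: the combination of the cluster expansion with the sum over labels. *)
Lemma connected_sum_cumulant m (k : nat -> R[i]) : (m.+1 * pbar < K)%N ->
  (forall s, (s < m.+1)%N -> moment s.+1 =
     \sum_(i < s.+1) ('C(s, i))%:R * k i.+1 * moment (s - i)%N) ->
  connected_sum Psi pbar lam t phi m.+1 = k m.+1.
Proof.
move=> mK Hk; have K0 : (0 < K)%N by exact: leq_ltn_trans mK.
rewrite (connected_sumE Psi pbar lam t phi i0 ord0).
pose W (l : {ffun 'I_m.+1 -> label}) (J : {set 'I_m.+1}) :=
  graph_connected_weight Psi t phi ord0 (coords i0 (degrees l) l) J.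
have M0 l : @label_moment m.+1 l set0 = 1.
  rewrite -(moment0 K0); congr op_at; apply/funext => x.
  by rewrite expr0 big_set0.
have MK l (J : {set 'I_m.+1}) : ord0 \in J -> @label_moment m.+1 l J =
    \sum_(J' : {set 'I_m.+1} | (ord0 \in J') && (J' \subset J))
      W l J' * label_moment l (J :\: J').
  move=> J0; rewrite label_moment_config// (cluster_expansion _ _ _ J0).
  by apply: eq_bigr => J' _; rewrite label_moment_config.
have Hk' s : (s < #|'I_m.+1|)%N -> moment s.+1 =
     \sum_(i < s.+1) ('C(s, i))%:R * k i.+1 * moment (s - i)%N.
  by rewrite card_ord; exact: Hk.
have := @label_sum_connected _ _ _ ord0 label0 (label_coef (pbar := pbar) lam)
  (@label_moment m.+1) W (@label_moment_local m.+1) M0 MK moment k (moment0 K0)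
  (@label_sum_moment m.+1) Hk' [set: 'I_m.+1].
rewrite inE cardsT card_ord => /(_ isT) <-.
rewrite /label_sum; apply: eq_big => [l|l _].
  by apply/esym/eqP/ffunP => j; rewrite ffunE inE.
by congr (_ * _); apply: eq_bigl => j; rewrite inE.
Qed.

(** Induction on s. The recursion at s has a unique solution for the term of index
    s + 1, and [connected_sum_cumulant] identifies it with the sum over connected
    graphs. *)
Lemma connected_sum_recursion N : (N * pbar < K)%N -> forall s, (s < N)%N ->
  moment s.+1 = \sum_(i < s.+1) ('C(s, i))%:R *
    connected_sum Psi pbar lam t phi i.+1 * moment (s - i)%N.
Proof.
move=> NK s; elim/ltn_ind: s => s IH sN.
have K0 : (0 < K)%N by exact: leq_ltn_trans NK.
pose cs := connected_sum Psi pbar lam t phi.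
pose last_term := moment s.+1 - \sum_(i < s) ('C(s, i))%:R * cs i.+1 * moment (s - i)%N.
pose k i := if (i <= s)%N then cs i else last_term.
have ks i : (i <= s)%N -> k i = cs i by rewrite /k => ->.
have rec s' : (s' < s.+1)%N -> moment s'.+1 =
    \sum_(i < s'.+1) ('C(s', i))%:R * k i.+1 * moment (s' - i)%N.
  rewrite ltnS leq_eqVlt => /orP[/eqP ->|s's].
    rewrite big_ord_recr /= subnn moment0// mulr1 binn mul1r {2}/k ltnn.
    rewrite (eq_bigr (fun i : 'I_s => ('C(s, i))%:R * cs i.+1 * moment (s - i)%N)).
      by rewrite /last_term addrC subrK.
    by move=> i _; rewrite ks.
  rewrite (IH _ s's (ltn_trans s's sN)); apply: eq_bigr => i _.
  by rewrite ks// (leq_trans _ s's).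
have sK : (s.+1 * pbar < K)%N by rewrite (leq_ltn_trans _ NK)// leq_mul2r sN orbT.
have E := connected_sum_cumulant sK rec.
rewrite (rec s (leqnn _)); apply: eq_bigr => i _; congr (_ * _ * _).
have := ltn_ord i; rewrite ltnS leq_eqVlt => /orP[/eqP ->|is']; first by rewrite E.
by rewrite ks.
Qed.

End moments.

(** * Formal exponential and logarithm *)

Section exponential_of_cumulants.
Context {R : realType}.
Variables (z k : nat -> R[i]) (N : nat).
Hypothesis z0 : z 0 = 1.
Hypothesis zk : forall s, (s < N)%N ->
  z s.+1 = \sum_(i < s.+1) ('C(s, i))%:R * k i.+1 * z (s - i)%N.

Let kpoly : {poly R[i]} := \poly_(m < N.+1) (if m == 0 then 0 else k m / m`!%:R).
Let epoly : {poly R[i]} := \sum_(i < N.+1) (i`!%:R)^-1 *: kpoly ^+ i.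
Let zpoly : {poly R[i]} := \poly_(m < N.+1) (z m / m`!%:R).

Let fact_neq0 m : (m`!%:R : R[i]) != 0.
Proof. by rewrite pnatr_eq0 -lt0n fact_gt0. Qed.

Lemma kpoly0 : kpoly`_0 = 0. Proof. by rewrite coef_poly. Qed.

Lemma coef_kpoly_exp i m : (m < i)%N -> (kpoly ^+ i)`_m = 0.
Proof.
have -> : kpoly = kpoly %/ 'X * 'X.
  by rewrite divpK// -['X]subr0 dvdp_XsubCl; apply/eqP; rewrite horner_coef0 kpoly0.
by rewrite exprMn coefMXn => ->.
Qed.

Lemma deriv_epoly : epoly^`() = kpoly^`() * (epoly - (N`!%:R)^-1 *: kpoly ^+ N).
Proof.
rewrite /epoly [in RHS]big_ord_recr /= addrK raddf_sum mulr_sumr big_ord_recl /=.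
rewrite expr0 derivZ derivC scaler0 add0r; apply: eq_bigr => i _.
rewrite derivZ ?lift0 /bump /= ?add1n deriv_exp -scalerAr -[X in _ *: X = _]scaler_nat scalerA.
by congr (_ *: _); rewrite factS natrM invfM mulrAC mulVf ?mul1r// pnatr_eq0.
Qed.

(** The recursion for z is the coefficient form of Z' = K' Z, and the truncated
    exponential of K solves the same equation up to degree N, because K has no
    constant term. *)
Lemma coef_epoly m : (m <= N)%N -> epoly`_m = z m / m`!%:R.
Proof.
elim/ltn_ind: m => -[|m] IH mN.
  rewrite /epoly coef_sum big_ord_recl /= coefZ expr0 coef1 mulr1 big1 ?addr0 ?z0//.
    by rewrite mul1r.
  by move=> i _; rewrite coefZ coef_kpoly_exp ?mulr0.
have m1 : (m.+1%:R : R[i]) != 0 by rewrite pnatr_eq0.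
apply: (mulIf m1); rewrite mulr_natr -coef_deriv deriv_epoly mulrBr coefB.
have -> : (kpoly^`() * ((N`!%:R)^-1 *: kpoly ^+ N))`_m = 0.
  rewrite -scalerAr coefZ coefM big1 ?mulr0// => i _.
  by rewrite coef_kpoly_exp ?mulr0// (leq_ltn_trans (leq_subr _ _)).
have -> : z m.+1 / (m.+1)`!%:R * m.+1%:R = z m.+1 / m`!%:R.
  by rewrite factS natrM invfM mulrA mulrAC -[_ / m.+1%:R * _]mulrA mulVf// mulr1.
rewrite subr0 coefM zk// mulr_suml.
apply: eq_bigr => i _; have im : (i <= m)%N by rewrite -ltnS.
have h1 : (m - i < m.+1)%N by rewrite ltnS leq_subr.
have h2 : (m - i <= N)%N by rewrite (leq_trans (leq_subr _ _))// ltnW.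
rewrite coef_deriv (IH _ h1 h2).
rewrite coef_poly ltnS (leq_ltn_trans im mN) /=.
have -> : k i.+1 / (i.+1)`!%:R *+ i.+1 = k i.+1 / i`!%:R.
  rewrite -mulr_natr factS natrM invfM -!mulrA; congr (_ * _).
  by rewrite mulrCA mulVf ?mulr1// pnatr_eq0.
have -> : ('C(m, i))%:R = m`!%:R / (i`!%:R * (m - i)`!%:R) :> R[i].
  by rewrite -natrM -(bin_fact im) natrM mulfK// natrM mulf_neq0.
by rewrite invfM; field; rewrite !fact_neq0.
Qed.

Lemma poly_high_order (p : {poly R[i]}) (x : R[i]) b : cabs x <= b -> b <= 1 ->
  (forall m, (m <= N)%N -> p`_m = 0) ->
  cabs p.[x] <= (\sum_(i < size p) cabs p`_i) * b ^+ N.+1.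
Proof.
move=> xb b1 p0; have b0 : 0 <= b := le_trans (cabs_ge0 _) xb.
rewrite horner_coef (le_trans (cabs_sum _ _ _))// mulr_suml; apply: ler_sum => i _.
have [iN|Ni] := leqP i N; first by rewrite p0// mul0r cabs0 mul0r.
rewrite cabsM ler_wpM2l ?cabs_ge0// cabsX (@le_trans _ _ (b ^+ i))//.
  by rewrite lerXn2r// nnegrE cabs_ge0.
by rewrite ler_wiXn2l.
Qed.

Definition cumulant_sum (x : R) : R[i] :=
  \sum_(1 <= m < N.+1) (x ^+ m / m`!%:R)%:C * k m.

Let complex_coef (x : R) m : (x ^+ m / m`!%:R)%:C = x%:C ^+ m / m`!%:R.
Proof. by rewrite rmorphM rmorphXn fmorphV rmorph_nat. Qed.

Lemma cumulant_sumE x : cumulant_sum x = kpoly.[x%:C].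
Proof.
rewrite horner_poly /cumulant_sum -(big_mkord xpredT (fun m =>
  (if m == 0%N then 0 else k m / m`!%:R) * x%:C ^+ m)) big_ltn//= mul0r add0r.
rewrite big_nat_cond [RHS]big_nat_cond; apply: eq_bigr => m /andP[/andP[m0 _] _].
by rewrite gtn_eqF// complex_coef mulrC mulrA mulrAC.
Qed.

Lemma cumulant_sum_le : exists2 C : R, 0 <= C & forall b, 0 <= b <= 1 ->
  cabs (cumulant_sum (- b)) <= C * b.
Proof.
exists (\sum_(1 <= m < N.+1) cabs (k m)).
  by rewrite sumr_ge0// => m _; exact: cabs_ge0.
move=> b /andP[b0 b1]; rewrite /cumulant_sum (le_trans (cabs_sum _ _ _))// mulr_suml.
rewrite big_nat_cond [leRHS]big_nat_cond; apply: ler_sum => m /andP[/andP[m0 _] _].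
rewrite cabsM mulrC ler_wpM2l ?cabs_ge0// cabs_real normrM normrX normrN (ger0_norm b0).
rewrite (@le_trans _ _ (b ^+ m))//; last first.
  by rewrite -[leRHS]expr1 ler_wiXn2l.
by rewrite ler_piMr ?exprn_ge0// ger0_norm ?invr_ge0 ?ler0n// invf_le1 ?ler1n ?ltr0n ?fact_gt0.
Qed.

Lemma exp_cumulant_sum : exists2 C : R, 0 <= C & forall b, 0 < b <= 1 ->
  cabs (\sum_(m < N.+1) ((- b) ^+ m / m`!%:R)%:C * z m - cexp (cumulant_sum (- b))) <=
  C * b ^+ N.+1.
Proof.
have [D D0 HD] := cumulant_sum_le.
pose S := \sum_(i < size (zpoly - epoly)) cabs (zpoly - epoly)`_i.
have S0 : 0 <= S by rewrite sumr_ge0// => i _; exact: cabs_ge0.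
exists (S + (2 * D) ^+ N.+1 * expR D).
  by rewrite addr_ge0// mulr_ge0 ?expR_ge0// exprn_ge0// mulr_ge0.
move=> b /andP[b0 b1]; set w := cumulant_sum (- b).
have wb : cabs w <= D * b by apply: HD; rewrite b1 ltW.
have -> : \sum_(m < N.+1) ((- b) ^+ m / m`!%:R)%:C * z m = zpoly.[(- b)%:C].
  rewrite horner_poly; apply: eq_bigr => m _.
  by rewrite complex_coef mulrC mulrA mulrAC.
have E : epoly.[(- b)%:C] = exp_trunc N.+1 w.
  rewrite /epoly horner_sum /exp_trunc; apply: eq_bigr => i _.
  by rewrite hornerZ horner_exp -cumulant_sumE.
rewrite (_ : _ - cexp w = (zpoly - epoly).[(- b)%:C] - (cexp w - exp_trunc N.+1 w)); last first.
  by rewrite hornerD hornerN E opprB addrA subrK.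
rewrite (le_trans (cabsB _ _))// mulrDl lerD//.
  apply: poly_high_order => //; first by rewrite cabs_real normrN gtr0_norm.
  by move=> m mN; rewrite coefB coef_epoly// coef_poly ltnS mN subrr.
rewrite (le_trans (cexp_taylor _ _))// mulrAC -exprMn ler_pM ?expR_ge0 ?exprn_ge0 ?mulr_ge0 ?cabs_ge0//.
  rewrite lerXn2r ?nnegrE ?mulr_ge0 ?cabs_ge0 ?(ltW b0)//; lra.
by rewrite ler_expR (le_trans wb)// ler_piMr.
Qed.

(** The logarithm inherits the error of the approximation: f / exp (sum) is close
    to 1, where the principal branch is Lipschitz. *)
Lemma cln_cumulant_sum (f : R -> R[i]) C0 : 0 <= C0 ->
  (forall b, 0 < b <= 1 ->
    cabs (f b - \sum_(m < N.+1) ((- b) ^+ m / m`!%:R)%:C * z m) <= C0 * b ^+ N.+1) ->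
  exists C e : R, [/\ 0 <= C, 0 < e & forall b, 0 < b < e ->
    cabs (cln (f b) - cumulant_sum (- b)) <= C * b ^+ N.+1].
Proof.
move=> C00 Hf; have [C1 C10 H1] := exp_cumulant_sum.
have [D D0 HD] := cumulant_sum_le.
pose B := (C0 + C1) * expR D.
have B0 : 0 <= B by rewrite mulr_ge0 ?expR_ge0// addr_ge0.
(* below e, all of b, B * b and D * b are at most 1/2 *)
pose e := (2 * (1 + B + D))^-1.
have BD : 0 < 1 + B + D by lra.
have e0 : 0 < e by rewrite invr_gt0 mulr_gt0.
exists (4 * B), e; split => //; first exact: mulr_ge0.
move=> b /andP[b0 be].
have be1 : b * (1 + B + D) < 2^-1.
  by rewrite -ltr_pdivlMr// -invfM.
have b1 : b <= 1 by nra.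
have bb : 0 < b <= 1 by rewrite b0 b1.
have bN : b ^+ N.+1 <= b by rewrite -[leRHS]expr1 ler_wiXn2l// ltW.
have bN0 : 0 <= b ^+ N.+1 by rewrite exprn_ge0// ltW.
set w := cumulant_sum (- b).
have wb : cabs w <= D * b by apply: HD; rewrite b1 ltW.
have fw : cabs (f b * cexp (- w) - 1) <= B * b ^+ N.+1.
  have -> : f b * cexp (- w) - 1 = (f b - cexp w) * cexp (- w) by rewrite mulrBl cexpN.
  rewrite cabsM /B mulrAC ler_pM ?cabs_ge0//.
    rewrite -(subrK (\sum_(m < N.+1) ((- b) ^+ m / m`!%:R)%:C * z m) (f b)) -addrA.
    rewrite (le_trans (cabsD _ _))// mulrDl lerD ?Hf ?H1//.
  rewrite cabs_cexp ler_expR cReN (le_trans (ler_norm _))// normrN.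
  by rewrite (le_trans (normr_Re_le _))// (le_trans wb)// ler_piMr.
rewrite (le_trans (cln_near _ _))//.
- rewrite (le_trans (normr_Im_le _))// (le_trans wb)//; nra.
- rewrite (le_trans fw)// (@le_trans _ _ (B * b))// ?ler_wpM2l//; nra.
- by rewrite -mulrA ler_wpM2l.
Qed.

End exponential_of_cumulants.

(** * Expansion of the logarithm *)

Theorem theorem2p17 (R : realType) (d : nat) (d_gt0 : (0 < d)%N)
    (Psi : 'rV[R[i]]_d -> R[i])
    (Psi0 : Psi 0 = 0)
    (Psi_smooth : smooth (symbol Psi))
    (P1 : exists2 r : R, 0 < r &
      forall a : 'rV[R[i]]_d, (forall j, cabs (a 0 j) < r) -> analytic_at Psi a)
    (P2 : exists2 c : R, 0 < c &
      forall xi : 'rV[R]_d,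
        complex.Re (symbol Psi xi) <= c * ln (1 + enorm xi))
    (P3 : forall al : {ffun 'I_d -> nat}, exists (N : nat) (b : R), 0 < b /\
      forall xi : 'rV[R]_d,
        cabs (multi_deriv al (symbol Psi) xi) <= b * (1 + enorm xi) ^+ N)
    (pbar : nat) (pbar_gt0 : (0 < pbar)%N) (pbar_even : ~~ odd pbar)
    (lam : forall p : nat, p.-tuple 'I_d -> R)
    (lam_sym : forall (p : nat) (X Y : p.-tuple 'I_d),
      (p <= pbar)%N -> perm_eq X Y -> lam p X = lam p Y)
    (lam_pos : forall x : 'rV[R]_d, x != 0 -> 0 < tensor_form lam pbar x)
    (t : R) (t_ge0 : 0 <= t) (phi : 'rV[R]_d) (N : nat) :
  (fun beta : R =>
     beta ^- N *
     cabs (cln (Phi Psi t (boltzmann pbar lam beta) phi) -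
           \sum_(1 <= m < N.+1)
             ((- beta) ^+ m / m`!%:R)%:C * connected_sum Psi pbar lam t phi m))
    @ 0^'+ --> (0 : R).
Proof.
have P10 : analytic_at Psi 0.
  by have [r r0 H] := P1; apply: H => j; rewrite mxE cabs0.
have pbar1 : (1 < pbar)%N by case: pbar pbar_gt0 pbar_even {lam_sym lam_pos} => [|[]].
(* exceeds the number of legs of N vertices, and compensates the loss of 2 d
   powers of eps in the estimate of the remainder *)
pose K := (pbar * N.+1 + 2 * d)%N.
have K0 : (0 < K)%N by rewrite /K; nia.
have NK : (N * pbar < K)%N by rewrite /K; nia.
have [C [M [C0 HC]]] := multiplier_expansion Psi0 P10 P2 t_ge0 K0.
have [C1 C10 H1] := Phi_expansion phi d_gt0 pbar1 lam_pos
  (cmeasurable_multiplier t Psi_smooth) C0 HC.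
pose z := moment Psi pbar lam t phi K.
have z0 : z 0%N = 1 := moment0 pbar lam t phi (Ordinal d_gt0) Psi0 P10 K0.
have zk := connected_sum_recursion lam t phi (Ordinal d_gt0) Psi0 P10 NK.
have [D [e [D0 e0 HD]]] := cln_cumulant_sum z0 zk C10 H1.
apply/cvgr0Pnorm_lt => eps eps0; near=> b.
have b0 : 0 < b by [].
have be : b < e by near: b; exact: nbhs_right_lt.
have beps : b < eps / (D + 1).
  by near: b; apply: nbhs_right_lt; rewrite divr_gt0// ltr_wpDl.
rewrite ger0_norm; last by rewrite mulr_ge0 ?cabs_ge0// invr_ge0 exprn_ge0// ltW.
apply: (@le_lt_trans _ _ (b ^- N * (D * b ^+ N.+1))).
  by rewrite ler_wpM2l ?invr_ge0 ?exprn_ge0 ?(ltW b0)//; apply: HD; rewrite b0.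
rewrite exprSr mulrCA mulKf ?expf_neq0 ?gt_eqF//.
have : b * (D + 1) < eps by rewrite -ltr_pdivlMr// ltr_wpDl.
by rewrite mulrDr mulr1 mulrC; apply: lt_trans; rewrite ltrDl.
Unshelve. all: by end_near.
Qed.
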